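(* Let $k\in L^1_{\mathrm{loc}}([0,\infty))$ be nonnegative, non-increasing and right-continuous with $\lim_{s\to\infty}k(s)=0$. The generator $(\Lambda^k,D(\Lambda^k,\mathcal H))$ of the $C_0$-semigroup $(U_t^k)_{t>0}$ on $\mathcal H=L^2([0,\infty);H)$ is given as follows: $$D(\Lambda^k,\mathcal H)=\{u\in\mathcal H\mid r\mapsto|\psi^k(-ir)|\,\hat u(r)\in L^2(\mathbb R;H_{\mathbb C})\},$$ $$(\Lambda^ku)^\wedge(r)=-\psi^k(-ir)\,\hat u(r),\qquad r\in\mathbb R.$$
   Context: $H$ is a real separable Hilbert space and $H_{\mathbb C}$ its complexification. Functions $u\in\mathcal H=L^2([0,\infty);H)$ are regarded as functions from $\mathbb R$ to $H$ by setting $u:=0$ on $(-\infty,0)$, and $\hat u(r):=\int_{\mathbb R}e^{irs}u(s)\,\mathrm ds$, $r\in\mathbb R$, is the Fourier transform (in the $L^2$ sense). $M^k$ is the unique measure on $((0,\infty),\mathcal B((0,\infty)))$ with $k(s)=M^k((s,\infty))$ for $s\in(0,\infty)$; it satisfies $\int_{(0,\infty)}(\tau\wedge1)\,M^k(\mathrm d\tau)<\infty$. For $\lambda\in\mathbb C$ with $\operatorname{Re}\lambda\ge0$, $\psi^k(\lambda):=\int_{(0,\infty)}(1-e^{-\lambda\tau})\,M^k(\mathrm d\tau)$. For $t\ge0$, $\mu_t^k$ is the unique probability measure on $[0,\infty)$ with $\int_{[0,\infty)}e^{-\lambda s}\mu_t^k(\mathrm ds)=e^{-t\psi^k(\lambda)}$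 for $\lambda\in(0,\infty)$. With the right shifts $U_sf(r):=\mathbf 1_{[0,\infty)}(r-s)f(r-s)$, $r\in[0,\infty)$, the semigroup is $U_t^kf:=\int_{[0,\infty)}U_sf\,\mu_t^k(\mathrm ds)=f*\mu_t^k$, $f\in\mathcal H$, $t\ge0$; it is a $C_0$-semigroup of contractions on $\mathcal H$. $\Lambda^k$ with domain $D(\Lambda^k,\mathcal H)$ is its infinitesimal generator on $\mathcal H$. *)

(* Defs.v *)
From HB Require Import structures.
From mathcomp Require Import all_boot all_order all_algebra.
From mathcomp Require Import sesquilinear.
From mathcomp Require Import all_classical all_reals all_analysis.
From mathcomp Require Import complex.
Import Order.TTheory GRing.Theory Num.Theory.
Import numFieldNormedType.Exports.

Set Implicit Arguments.
Unset Strict Implicit.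
Unset Printing Implicit Defensive.

Local Open Scope classical_set_scope.
Local Open Scope ring_scope.
Local Open Scope complex_scope.

Definition separable (T : topologicalType) : Prop :=
  exists A : set T, countable A /\ dense A.

Section bochner.
Context (d : measure_display) (T : measurableType d) (R : realType)
  (E : normedModType R).
Implicit Types (mu : {measure set T -> \bar R}) (D : set T) (f s : T -> E).

(* For separable E, which is the only case used, Borel measurability and strong
   measurability coincide. *)
Definition borel_measurable D f : Prop :=
  measurable_fun D (f : T -> g_sigma_algebraType (@open E)).

Definition simple_on mu D s : Prop :=
  [/\ finite_set (s @` D),
      forall c, measurable (D `&` s @^-1` [set c])
    & forall c, c != 0 -> (mu (D `&` s @^-1` [set c]) < +oo)%E].

Definition simple_integral mu D s : E :=
  \sum_(c \in s @` D) fine (mu (D `&` s @^-1` [set c])) *: c.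

Definition is_bochner_integral mu D f (v : E) : Prop :=
  borel_measurable D f /\
  exists s : nat -> T -> E,
    [/\ forall n, simple_on mu D (s n),
        (fun n => \int[mu]_(x in D) `|f x - s n x|%:E)%E @ \oo --> 0%E
      & (fun n => simple_integral mu D (s n)) @ \oo --> v].

(* 0 when f is not Bochner integrable on D *)
Definition bochner_integral mu D f : E :=
  xget 0 [set v | is_bochner_integral mu D f v].

End bochner.

Section complex_valued.
Context (R : realType).

Definition cexp (z : R[i]) : R[i] :=
  (expR (complex.Re z) * cos (complex.Im z)) +i*
  (expR (complex.Re z) * sin (complex.Im z)).

Definition cintegral (d : measure_display) (T : measurableType d)
    (mu : {measure set T -> \bar R}) (D : set T) (f : T -> R[i]) : R[i] :=
  Rintegral mu D (fun x => complex.Re (f x)) +i*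
  Rintegral mu D (fun x => complex.Im (f x)).

End complex_valued.

(* The pair (x, y) stands for x + i y. The norm of the complexification is
   cplx_norm, not the max-norm that the library puts on H * H; the two are
   equivalent, hence give the same Borel sets and the same Bochner integral. *)
Section complexification.
Context (R : realType) (H : normedModType R).

Definition cplx_norm (x : H * H) : R := Num.sqrt (`|x.1| ^+ 2 + `|x.2| ^+ 2).

Definition cplx_scale (z : R[i]) (x : H * H) : H * H :=
  (complex.Re z *: x.1 - complex.Im z *: x.2,
   complex.Re z *: x.2 + complex.Im z *: x.1).

Definition cplx_embed (x : H) : H * H := (x, 0).

End complexification.

Section L2.
Context (R : realType) (E : normedModType R).

(* The norm N of the target space is a parameter because of cplx_norm. *)
Definition L2norm (N : E -> R) (f : R -> E) : \bar R :=
  'N[@lebesgue_measure R]_(2%:E)[EFin \o N \o f]%E.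

(* Functions, not classes modulo a.e. equality. *)
Definition L2 (N : E -> R) : set (R -> E) :=
  [set f | borel_measurable (setT : set (measurableTypeR R)) f /\
           (L2norm N f < +oo)%E].

(* L^2([0, oo); E), its elements being extended by 0 to (-oo, 0) *)
Definition L2pos : set (R -> E) :=
  [set u | L2 Num.norm u /\ forall r, r < 0 -> u r = 0].

End L2.

Section fourier.
Context (R : realType) (H : normedModType R).

Definition truncated_fourier (u : R -> H) (n : nat) (r : R) : H * H :=
  bochner_integral (@lebesgue_measure R) `[- n%:R, n%:R]%classic
    (fun s => cplx_scale (cexp (0 +i* (r * s))) (cplx_embed (u s))).

(* Limit in L^2 of the truncated integrals; as for any element of L^2, the
   representative is arbitrary. *)
Definition fourier (u : R -> H) : R -> H * H :=
  xget (cst 0) [set g | L2 (@cplx_norm R H) g /\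
    (fun n : nat => L2norm (@cplx_norm R H)
       (fun r => g r - truncated_fourier u n r)) @ \oo --> 0%E].

End fourier.

(* M^k; a measure on (0, oo) is seen as a measure on R vanishing on (-oo, 0]. *)
Definition is_kernel_measure (R : realType) (k : R -> R)
    (M : {measure set (measurableTypeR R) -> \bar R}) : Prop :=
  M `]-oo, 0]%classic = 0%E /\
  forall s : R, 0 < s -> M `]s, +oo[%classic = (k s)%:E.

Definition psi (R : realType) (M : {measure set (measurableTypeR R) -> \bar R})
    (z : R[i]) : R[i] :=
  cintegral M `]0, +oo[%classic (fun tau : R => 1 - cexp (- z * tau%:C)).

(* mu_t^k; likewise a measure on R concentrated on [0, oo) *)
Definition is_subordinator_law (R : realType)
    (M : {measure set (measurableTypeR R) -> \bar R}) (t : R)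
    (nu : probability (measurableTypeR R) R) : Prop :=
  nu `[0, +oo[%classic = 1%E /\
  forall z : R, 0 < z ->
    cintegral nu `[0, +oo[%classic (fun s : R => cexp (- z%:C * s%:C)) =
    cexp (- t%:C * psi M z%:C).

Section semigroup.
Context (R : realType) (H : normedModType R).

Definition rshift (s : R) (f : R -> H) : R -> H :=
  fun r => if 0 <= r - s then f (r - s) else 0.

(* The convolution f * mu_t: for a.e. r, the value at r of the L^2-valued
   integral of s |-> rshift s f. *)
Definition conv_semigroup (mu : R -> probability (measurableTypeR R) R)
    (t : R) (f : R -> H) : R -> H :=
  fun r => bochner_integral (mu t) `[0, +oo[%classic
    (fun s : R => rshift s f r).

(* v represents the generator of U on L2pos applied to u *)
Definition generator_graph (U : R -> (R -> H) -> (R -> H)) (u v : R -> H) :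
    Prop :=
  [/\ L2pos u, L2pos v
    & L2norm Num.norm (fun r => t^-1 *: (U t u r - u r) - v r)
        @[t --> 0^'+] --> 0%E].

Definition generator_domain (U : R -> (R -> H) -> (R -> H)) : set (R -> H) :=
  [set u | exists v, generator_graph U u v].

End semigroup.

(* Main.v *)
(* Write psi for r |-> psi^k(-ir). The convolution semigroup acts on Fourier
   transforms as multiplication by exp(-t psi), and |exp(-tz) - 1| <= C t |z| when
   Re z >= 0. If (U_t u - u)/t converges to v, then v^ is the pointwise limit
   -psi u^ of the multiplied transforms; conversely, if psi u^ is square
   integrable, then dominated convergence gives the L2 limit of the transforms,
   and a lower Plancherel inequality brings it back to a limit in L2(H).

   The argument rests on three facts.
   - Two-sided Plancherel inequalities, sufficient for the argument. For w in
     L1 and L2, the Abel mean of |w^|^2 is the double integral of <w s, w t>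
     against the Poisson kernel K_e(s - t), whose total mass is 2 pi; it differs
     from 2 pi |w|^2 by at most pi |w|^2 plus half of the energy, the double
     integral of |w s - w t|^2 K_e(s - t), and the latter tends to 0 with e.
   - The passage from the Laplace transform, known for real lambda > 0, to the
     imaginary axis. Around l0 > 0, both sides of the identity
     E exp(-lambda s) = exp(-t psi^k(lambda)) are limits of polynomials in
     l0 - lambda with nonnegative nondecreasing coefficients; such limits are
     determined by their real values, so the identity extends to the disk of
     radius l0 around l0. These disks exhaust Re lambda > 0, and dominated
     convergence reaches Re lambda = 0.
   - All Bochner integrals are handled through their scalar products, a Borel
     function into a separable space being a limit of simple functions. *)

(* The transform only carries square-integrability, Cauchy sequences and limits from one side to the
   other, so bounds pi and 3 pi around the exact constant 2 pi do the work of the isometry. In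
   particular, the v that belongs to a given u is produced on the side of H: by the lower inequality
   the difference quotients are themselves Cauchy, and their limit stays supported in [0, oo).

   On the way to the imaginary axis, positivity plays the part of holomorphy. In exp(-lambda s) =
   exp(-l0 s) exp((l0 - lambda) s), expanding the second factor gives coefficients that are
   integrals of nonnegative functions, for the law as well as for psi^k(l0) - psi^k(lambda);
   multiplication by t and exponentiation preserve the sign. The difference with psi^k(l0) copes
   with an infinite mass of M^k near 0, as only powers s^i with i >= 1 are integrated.

   The norm of [H * H] is the max-norm, while [dot2] induces the Euclidean one; most factors 2 below
   come from this, or from (x + y)^2 <= 2 x^2 + 2 y^2. *)
Require Import Defs.
From HB Require Import structures.
From mathcomp Require Import all_boot all_order all_algebra.
From mathcomp Require Import sesquilinear.
From mathcomp Require Import all_classical all_reals all_analysis.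
From mathcomp Require Import complex measurable_realfun.
From mathcomp Require Import ring lra.
Import Order.TTheory GRing.Theory Num.Theory.
Import numFieldNormedType.Exports.

Local Open Scope classical_set_scope.
Local Open Scope ring_scope.
Local Open Scope complex_scope.

Set Implicit Arguments.
Unset Strict Implicit.

(** * Borel functions into a separable space *)

Section borel.
Context (R : realType).
Implicit Types E F : normedModType R.

Definition dense_seq E (a : nat -> E) : Prop :=
  forall (x : E) (e : R), 0 < e -> exists n, `|x - a n| < e.

(** The injection of the countable dense set into the naturals is inverted by choice. Indices
    outside its image give 0, a value that may lie outside the set but does no harm to density. *)
Lemma separable_dense_seq E : separable E -> exists a : nat -> E, dense_seq a.
Proof.
move=> [A [/countable_injP[f fi] dA]].
exists (fun n => xget 0 [set x | A x /\ f x = n]) => x e e0.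
have [|y [/= xy Ay]] := dA (ball x e) _ (ball_open x e).
  by exists x; exact: ballxx.
exists (f y); case: xgetP => [z _ [Az fz]|/(_ y)/=]; last by move/not_andP; case.
rewrite (fi _ _ _ _ fz); [|exact/mem_set..].
by move: xy; rewrite -ball_normE.
Qed.

Lemma dense_seq_pair E F (a : nat -> E) (b : nat -> F) :
  dense_seq a -> dense_seq b ->
  dense_seq (fun n => if unpickle n is Some (i, j) then (a i, b j) else 0 : E * F).
Proof.
move=> da db [x y] e e0; have [i xi] := da x e e0; have [j yj] := db y e e0.
exists (pickle (i, j)); rewrite pickleK.
by rewrite prod_normE /= gt_max xi yj.
Qed.

Context d (T : measurableType d).

Lemma open_borel E (D : set T) (f : T -> E) :
  (forall U, open U -> measurable (D `&` f @^-1` U)) -> borel_measurable D f.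
Proof.
by move=> h; apply: (@measurability _ _ T (g_sigma_algebraType (@open E)) D f (@open E)) => // _ [U oU <-]; exact: h.
Qed.

Lemma borel_open E (D : set T) (f : T -> E) : measurable D ->
  borel_measurable D f -> forall U, open U -> measurable (D `&` f @^-1` U).
Proof. by move=> mD mf U oU; apply: mf => //; exact: sub_sigma_algebra. Qed.

(** In a separable space an open set is the union of those balls with centre [a n] and radius
    1/(k+1) that it contains, and the preimage of a ball involves only the distance to its
    centre. *)
Lemma dist_borel E (a : nat -> E) (D : set T) (f : T -> E) :
  dense_seq a -> measurable D ->
  (forall c, measurable_fun D (fun x => `|f x - c|)) -> borel_measurable D f.
Proof.
move=> da mD mf; apply: open_borel => U oU.
pose B n k := if `[< ball (a n) k.+1%:R^-1 `<=` U >] then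
  D `&` (fun x => `|f x - a n|) @^-1` `]-oo, k.+1%:R^-1[ else set0.
have -> : D `&` f @^-1` U = \bigcup_n \bigcup_k B n k.
  apply/seteqP; split=> [x [Dx Ufx]|x [n _ [k _]]]; last first.
    rewrite /B; case: asboolP => // h [Dx] /=; rewrite in_itv /= => fx.
    by split => //; apply: h; rewrite -ball_normE /= distrC.
  have /nbhs_ballP[e /= e0 eU] : nbhs (f x) U by exact: open_nbhs_nbhs.
  (* With a radius below e/2 and a centre closer to [f x] than this radius, the whole ball stays in
     the e-ball around [f x], hence in [U]. *)
  have [k ke] : exists k, k.+1%:R^-1 < e / 2.
    exact: filter_ex (near_infty_natSinv_lt (PosNum (divr_gt0 e0 (ltr0Sn R 1)))).
  have k0 : 0 < k.+1%:R^-1 :> R by rewrite invr_gt0.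
  have [n xn] := da (f x) _ k0.
  exists n => //; exists k => //; rewrite /B asboolT; last first.
    move=> y; rewrite -ball_normE /= => ny; apply: eU; rewrite -ball_normE /=.
    rewrite (le_lt_trans (ler_distD (a n) _ _))// (splitr e) ltrD//.
      exact: lt_trans ke.
    exact: lt_trans ke.
  by split => //=; rewrite in_itv.
apply: bigcupT_measurable => n; apply: bigcupT_measurable => k.
rewrite /B; case: asboolP => // _.
exact: mf.
Qed.

Lemma borel_comp E F (D : set T) (f : T -> E) (Phi : E -> F) :
  measurable D -> continuous Phi -> borel_measurable D f ->
  borel_measurable D (Phi \o f).
Proof.
move=> mD /continuousP cPhi mf; apply: open_borel => U oU.
by rewrite comp_preimage; apply: borel_open => //; exact: cPhi.
Qed.

Lemma borel_real E (D : set T) (f : T -> E) (phi : E -> R) :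
  measurable D -> continuous phi -> borel_measurable D f ->
  measurable_fun D (phi \o f).
Proof.
move=> mD /continuousP cphi mf.
apply: (@measurability _ _ T (measurableTypeR R) D (phi \o f) _ (RGenOInfty.measurableE R)) => _ [_ [x ->] <-].
rewrite comp_preimage; apply: borel_open => //; apply: cphi.
exact: interval_open.
Qed.

Lemma real_borel (D : set T) (f : T -> R) : measurable D ->
  measurable_fun D f -> borel_measurable D (f : T -> R^o).
Proof.
move=> mD mf; apply: open_borel => U oU; apply: mf => //.
exact: open_measurable.
Qed.

Lemma borel_dist E (D : set T) (f : T -> E) (c : E) : measurable D ->
  borel_measurable D f -> measurable_fun D (fun x => `|f x - c|).
Proof.
move=> mD mf; apply: (@borel_real _ _ _ (fun y => `|y - c|) _ _ mf) => //.
by move=> y; apply: cvg_norm; apply: cvgB => //; exact: cvg_cst.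
Qed.

Lemma borel_norm E (D : set T) (f : T -> E) : measurable D ->
  borel_measurable D f -> measurable_fun D (fun x => `|f x|).
Proof.
move=> mD /(borel_dist 0 mD); under eq_fun do rewrite subr0; exact.
Qed.

(** The distance to a point of the product is the maximum of two measurable distances, so
    [dist_borel] applies; separability enters through the dense sequence of the product. *)
Lemma borel_pair E F (a : nat -> E) (b : nat -> F) (D : set T)
    (f : T -> E) (g : T -> F) : dense_seq a -> dense_seq b -> measurable D ->
  borel_measurable D f -> borel_measurable D g ->
  borel_measurable D (fun x => (f x, g x)).
Proof.
move=> da db mD mf mg; apply: (dist_borel (dense_seq_pair da db)) => // -[c e].
have := measurable_maxr (borel_dist c mD mf) (borel_dist e mD mg).
by apply: eq_measurable_fun => x _; rewrite prod_normE.
Qed.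

Lemma borel_fst E F (D : set T) (f : T -> E * F) : measurable D ->
  borel_measurable D f -> borel_measurable D (fst \o f).
Proof. by move=> mD; apply: borel_comp => // x; exact: cvg_fst. Qed.

Lemma borel_snd E F (D : set T) (f : T -> E * F) : measurable D ->
  borel_measurable D f -> borel_measurable D (snd \o f).
Proof. by move=> mD; apply: borel_comp => // x; exact: cvg_snd. Qed.

Lemma borel_add E (a : nat -> E) (D : set T) (f g : T -> E) :
  dense_seq a -> measurable D ->
  borel_measurable D f -> borel_measurable D g ->
  borel_measurable D (fun x => f x + g x).
Proof.
move=> da mD mf mg.
apply: (@borel_comp _ _ _ _ (fun z => z.1 + z.2) _ _ (borel_pair da da mD mf mg)) => //.
exact: add_continuous.
Qed.

Lemma dense_seq_real : exists a : nat -> R^o, dense_seq a.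
Proof.
exists (fun n => if unpickle n is Some q then ratr q else 0) => x e e0.
have /rat_in_itvoo[q /itvP xq] : x < x + e by rewrite ltrDl.
exists (pickle q); rewrite pickleK distrC ger0_norm ?subr_ge0 ?xq//.
by rewrite ltrBlDl xq.
Qed.

Lemma borel_scale E (a : nat -> E) (D : set T) (h : T -> R) (f : T -> E) :
  dense_seq a -> measurable D -> measurable_fun D h ->
  borel_measurable D f -> borel_measurable D (fun x => h x *: f x).
Proof.
move=> da mD mh mf; have [b db] := dense_seq_real.
apply: (@borel_comp _ _ _ _ (fun z : R^o * E => z.1 *: z.2) _ _
  (borel_pair db da mD (real_borel mD mh) mf)) => //.
exact: scale_continuous.
Qed.

Lemma borel_cst E (D : set T) (c : E) : measurable D -> borel_measurable D (cst c).
Proof. by move=> _; exact: measurable_cst. Qed.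

End borel.

(** * The Bochner integral tested against a pairing *)

Section pairing.
Context (R : realType) (E : normedModType R).

(** Shared by the inner product of [H] and by [dot2] on [H * H]. The last clause is an inequality
    because [H * H] carries the max-norm, whose square lies below [dot2 x x]. *)
Record is_pairing (p : E -> E -> R) (C : R) : Prop := IsPairing {
  pairing_lin : forall a x y z, p (a *: x + y) z = a * p x z + p y z ;
  pairing_le : forall x y, `|p x y| <= C * `|x| * `|y| ;
  pairing_ge : forall x, `|x| ^+ 2 <= p x x }.

(** A sequential form, which passes from [H] to [H * H] componentwise. *)
Definition seq_complete : Prop := forall v : nat -> E,
  (forall e : R, 0 < e -> exists N, forall m n,
     (N <= m)%N -> (N <= n)%N -> `|v m - v n| <= e) ->
  exists l : E, v n @[n --> \oo] --> l.

Context (p : E -> E -> R) (C : R) (hp : is_pairing p C).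

Lemma pairingD x y z : p (x + y) z = p x z + p y z.
Proof. by rewrite -[x]scale1r (pairing_lin hp) mul1r scale1r. Qed.

Lemma pairing0 z : p 0 z = 0.
Proof. by have := pairingD 0 0 z; rewrite addr0; lra. Qed.

Lemma pairingZ a x z : p (a *: x) z = a * p x z.
Proof. by rewrite -[a *: x]addr0 (pairing_lin hp) pairing0 addr0. Qed.

Lemma pairingN x z : p (- x) z = - p x z.
Proof. by rewrite -scaleN1r pairingZ mulN1r. Qed.

Lemma pairingB x y z : p (x - y) z = p x z - p y z.
Proof. by rewrite pairingD pairingN. Qed.

Lemma pairing_continuous z : continuous (p^~ z).
Proof.
move=> x; apply/cvgrPdist_le => e e0.
have K0 : 0 < `|C| * `|z| + 1 by rewrite ltr_wpDl// mulr_ge0.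
near=> y; rewrite -pairingB (le_trans (pairing_le hp _ _))//.
have xy : `|x - y| <= e / (`|C| * `|z| + 1).
  by near: y; apply: cvgr_dist_le => //; rewrite divr_gt0.
rewrite -(divfK (lt0r_neq0 K0) e) mulrC.
apply: (@le_trans _ _ (`|z| * (`|C| * `|x - y|))).
  by rewrite ler_wpM2l// ler_wpM2r// ler_norm.
rewrite mulrA mulrC (mulrC `|z|) ler_pM// lerDl//.
Unshelve. all: by end_near. Qed.

Context d (T : measurableType d) (mu : {measure set T -> \bar R}) (D : set T).
Hypothesis mD : measurable D.

Lemma simple_borel (s : T -> E) : simple_on mu D s -> borel_measurable D s.
Proof.
move=> [fs ms _]; apply: open_borel => U oU.
have -> : D `&` s @^-1` U = \bigcup_(c in s @` D `&` U) (D `&` s @^-1` [set c]).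
  apply/seteqP; split => [x [Dx Ux]|x [c [_ Uc] [Dx /= xc]]].
    by exists (s x) => //; split => //; exists x.
  by split => //=; rewrite xc.
apply: fin_bigcup_measurable => //; exact: finite_setIl.
Qed.

Lemma pairing_measurable (f : T -> E) y :
  borel_measurable D f -> measurable_fun D (fun x => p (f x) y).
Proof. by move=> mf; apply: (@borel_real _ _ _ _ _ _ (p^~ y)) => //; exact: pairing_continuous. Qed.

Lemma pairing_integrable (f : T -> E) y : borel_measurable D f ->
  mu.-integrable D (fun x => `|f x|%:E) ->
  mu.-integrable D (fun x => (p (f x) y)%:E).
Proof.
move=> mf /(integrableZl mD (C * `|y|)) /le_integrable; apply => //.
  exact/measurable_EFinP/pairing_measurable.
move=> x Dx /=; rewrite lee_fin (le_trans (pairing_le hp _ _))//.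
by rewrite (mulrAC C) ler_norm.
Qed.

(** A free [G] lets the same expansion serve for the pairing with a vector and for the norm. *)
Lemma simple_sumE (s : T -> E) : simple_on mu D s ->
  let r := finmap.enum_fset (fset_set (s @` D)) in
  forall x, D x -> forall G : E -> R,
  G (s x) = \sum_(c <- r) G c * \1_(D `&` s @^-1` [set c]) x.
Proof.
move=> [fs _ _] r x Dx G.
have xr : s x \in r by rewrite /r in_fset_set// inE; exists x.
rewrite (bigD1_seq _ xr) ?finmap.fset_uniq//= indicE mem_set// mulr1.
rewrite big1 ?addr0// => c cx.
rewrite indicE memNset ?mulr0// => -[_ /= xc].
by move: cx; rewrite xc eqxx.
Qed.

Lemma level_integrable (s : T -> E) c : simple_on mu D s -> c != 0 ->
  mu.-integrable D (fun x => (\1_(D `&` s @^-1` [set c]) x)%:E).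
Proof.
move=> [fs ms fms] c0; apply/integrableP; split.
  exact/measurable_EFinP/measurable_indic.
rewrite (eq_integral (fun x => (\1_(D `&` s @^-1` [set c]) x)%:E)); last first.
  by move=> x _; rewrite gee0_abs// lee_fin.
by rewrite integral_indic// setIAC setIid fms.
Qed.

Lemma simple_pairing (s : T -> E) y : simple_on mu D s ->
  p (simple_integral mu D s) y = Rintegral mu D (fun x => p (s x) y).
Proof.
move=> ss; have [fs ms fms] := ss.
rewrite /simple_integral fsbig_finite//.
rewrite (big_morph (p^~ y) (fun a b => pairingD a b y) (pairing0 y)).
have H x : x \in D -> p (s x) y = \sum_(c <- finmap.enum_fset (fset_set (s @` D)))
    p c y * \1_(D `&` s @^-1` [set c]) x.
  by rewrite inE => Dx; exact: (simple_sumE ss Dx (p^~ y)).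
rewrite (eq_Rintegral _ H) /Rintegral.
under eq_integral do rewrite -sumEFin.
have int c : mu.-integrable D (fun x => (p c y * \1_(D `&` s @^-1` [set c]) x)%:E).
  (* The level set of 0 may have infinite measure; its term is integrable because the pairing with 0
     vanishes. *)
  have [->|c0] := eqVneq c 0.
    by under eq_fun do rewrite pairing0 mul0r; exact: integrable0.
  under eq_fun do rewrite EFinM.
  by apply: integrableZl => //; exact: level_integrable ss c0.
rewrite integral_sum//.
have fi c : (\int[mu]_(x in D) (p c y * \1_(D `&` s @^-1` [set c]) x)%:E)%E =
   (p (fine (mu (D `&` s @^-1` [set c])) *: c) y)%:E.
  rewrite pairingZ.
  have [->|c0] := eqVneq c 0.
    by rewrite pairing0 mulr0; under eq_integral do rewrite mul0r; rewrite integral0.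
  under eq_integral do rewrite EFinM.
  rewrite integralZl//; last exact: level_integrable ss c0.
  rewrite integral_indic// setIAC setIid mulrC EFinM fineK// ge0_fin_numE//.
  exact: fms.
by rewrite (eq_bigr _ (fun c _ => fi c)) sumEFin.
Qed.

Lemma simple_integrable (s : T -> E) : simple_on mu D s ->
  mu.-integrable D (fun x => `|s x|%:E).
Proof.
move=> ss; have [fs ms fms] := ss.
have H x : x \in D -> `|s x|%:E = (\sum_(c <- finmap.enum_fset (fset_set (s @` D)))
    (`|c| * \1_(D `&` s @^-1` [set c]) x)%:E)%E.
  by rewrite inE => Dx; rewrite sumEFin; congr EFin; exact: (simple_sumE ss Dx Num.norm).
apply: (eq_integrable mD (fun x => \sum_(c <- finmap.enum_fset (fset_set (s @` D)))
    (`|c| * \1_(D `&` s @^-1` [set c]) x)%:E)%E).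
  by move=> x xD; rewrite H.
apply: integrable_sum => // c _.
have [->|c0] := eqVneq c 0.
  by under eq_fun do rewrite normr0 mul0r; exact: integrable0.
under eq_fun do rewrite EFinM.
by apply: integrableZl => //; exact: level_integrable ss c0.
Qed.

Section integrable.
Context (f : T -> E) (a : nat -> E).
Hypotheses (da : dense_seq a) (mf : borel_measurable D f)
  (intf : mu.-integrable D (fun x => `|f x|%:E)).

Lemma borel_sub (g h : T -> E) : borel_measurable D g ->
  borel_measurable D h -> borel_measurable D (fun x => g x - h x).
Proof.
move=> mg mh; apply: (borel_add da mD mg).
apply: (@borel_comp _ _ _ _ _ _ _ -%R _ _ mh) => //.
exact: opp_continuous.
Qed.

Lemma sub_integrable (g h : T -> E) : borel_measurable D g ->
  borel_measurable D h ->
  mu.-integrable D (fun x => `|g x|%:E) ->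
  mu.-integrable D (fun x => `|h x|%:E) ->
  mu.-integrable D (fun x => `|g x - h x|%:E).
Proof.
move=> mg mh ig ih; apply: (le_integrable mD) (integrableD mD ig ih) => //.
  by apply/measurable_EFinP/borel_norm => //; exact: borel_sub.
move=> x Dx /=; rewrite !lee_fin !ger0_norm ?addr_ge0//.
exact: ler_normB.
Qed.

(** The comparison is with the integral of the pairing rather than with a limit vector. It thus
    serves twice: to identify a given Bochner integral, and to show that the approximating sums are
    Cauchy before any limit is known. *)
Lemma simple_pairing_dist (s : T -> E) y : simple_on mu D s ->
  `|p (simple_integral mu D s) y - \int[mu]_(x in D) p (f x) y| <=
  C * `|y| * \int[mu]_(x in D) `|f x - s x|.
Proof.
move=> ss; rewrite (simple_pairing _ ss) distrC.
have ms := simple_borel ss; have is_ := simple_integrable ss.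
have ifs := sub_integrable mf ms intf is_.
rewrite -RintegralB//; [|exact: pairing_integrable..].
rewrite (le_trans (le_normr_Rintegral _ _))//.
  apply: (eq_integrable mD (fun x => (p (f x - s x) y)%:E)).
    by move=> x _ /=; rewrite pairingB.
  by apply: pairing_integrable => //; exact: borel_sub.
rewrite -RintegralZl//; apply: le_Rintegral => //.
- apply/integrable_norm/(eq_integrable mD (fun x => (p (f x - s x) y)%:E)).
    by move=> x _ /=; rewrite pairingB.
  by apply: pairing_integrable => //; exact: borel_sub.
- exact: (integrableZl mD _ ifs).
- by move=> x Dx; rewrite -pairingB mulrAC; exact: (pairing_le hp).
Qed.

Lemma is_bochner_pairing v y : is_bochner_integral mu D f v ->
  p v y = \int[mu]_(x in D) p (f x) y.
Proof.
move=> [_ [s [ss s0 sv]]].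
apply/eqP; rewrite -subr_eq0 -normr_le0; apply/ler_addgt0Pl => e e0.
rewrite addr0.
have s0' : \int[mu]_(x in D) `|f x - s n x| @[n --> \oo] --> 0.
  exact: (fine_cvg s0).
(* The added 1 keeps the divisor positive when [C] or [y] is 0. *)
have K0 : 0 < `|C| * `|y| + 1 by rewrite ltr_wpDl// mulr_ge0.
near \oo => n.
have h1 : `|p v y - p (simple_integral mu D (s n)) y| <= e / 2.
  near: n; move: (cvg_comp _ _ sv (@pairing_continuous y v)) => /cvgrPdist_le; apply.
  by rewrite divr_gt0.
have h2 : \int[mu]_(x in D) `|f x - s n x| <= (e / 2) / (`|C| * `|y| + 1).
  near: n; move/cvgrPdist_le : s0' => /(_ ((e / 2) / (`|C| * `|y| + 1))).
  rewrite !divr_gt0// => /(_ isT); apply: filterS => n.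
  by rewrite sub0r normrN; apply: le_trans; exact: ler_norm.
rewrite -(subrKA (p (simple_integral mu D (s n)) y)) (le_trans (ler_normD _ _))//.
rewrite (splitr e) lerD// (le_trans (simple_pairing_dist _ (ss n)))//.
apply: (@le_trans _ _ ((`|C| * `|y| + 1) * \int[mu]_(x in D) `|f x - s n x|)).
  apply: ler_wpM2r; first exact: Rintegral_ge0.
  by rewrite (@le_trans _ _ (`|C| * `|y|)) ?lerDl// ler_wpM2r// ler_norm.
by rewrite mulrC -ler_pdivlMr.
Unshelve. all: by end_near. Qed.

(** A point nearest to [f x] among 0 and the first n terms of [a]. Starting from 0 makes [|f x|] a
    bound of the error, which is the domination used for the convergence of the integrals. *)
Fixpoint nearest n : T -> E := if n is n'.+1 then
  fun x => if `|f x - a n'| < `|f x - nearest n' x| then a n' else nearest n' x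
  else cst 0.

Lemma nearest_le n x : `|f x - nearest n x| <= `|f x|.
Proof.
elim: n => [|n ih] /=; first by rewrite subr0.
by case: ifPn => // h; rewrite (le_trans (ltW h)).
Qed.

Lemma nearest_nonincr m n x : (m <= n)%N ->
  `|f x - nearest n x| <= `|f x - nearest m x|.
Proof.
elim: n => [|n ih]; first by rewrite leqn0 => /eqP ->.
rewrite leq_eqVlt => /predU1P[->//|]; rewrite ltnS => /ih.
by apply: le_trans => /=; case: ifPn => // /ltW.
Qed.

Lemma nearest_seq m n x : (m < n)%N -> `|f x - nearest n x| <= `|f x - a m|.
Proof.
move=> mn; apply: (le_trans (nearest_nonincr x mn)) => /=.
by case: ifPn => //; rewrite -leNgt.
Qed.

Lemma nearest_cvg x : `|f x - nearest n x| @[n --> \oo] --> 0.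
Proof.
apply/cvgrPdist_lt => e e0; have [m fm] := da (f x) e0.
exists m.+1 => // n /= mn; rewrite sub0r normrN normr_id.
exact: le_lt_trans (nearest_seq x mn) fm.
Qed.

Lemma nearest_dist_measurable n :
  measurable_fun D (fun x => `|f x - nearest n x|).
Proof.
elim: n => [|n ih] /=; first exact: borel_dist.
apply: (eq_measurable_fun (fun x => Num.min `|f x - a n| `|f x - nearest n x|)).
  by move=> x _; rewrite /Num.min; case: ifPn.
by apply: measurable_minr => //; exact: borel_dist.
Qed.

Lemma nearest_finite n : finite_set (nearest n @` D).
Proof.
elim: n => [|n ih] /=.
  by apply: (sub_finite_set _ (finite_set1 0)) => _ [x _ <-].
have fs : finite_set ([set a n] `|` [set nearest n x | x in D]).
  by rewrite finite_setU; split.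
apply: (sub_finite_set _ fs) => _ [x Dx <-].
by case: ifPn => _; [left|right; exists x].
Qed.

Lemma nearest_level n c : measurable (D `&` nearest n @^-1` [set c]).
Proof.
elim: n => [|n ih] /=.
  have [->|c0] := eqVneq c 0.
    by rewrite (_ : _ @^-1` _ = setT) ?setIT//; apply/seteqP.
  rewrite (_ : _ @^-1` _ = set0) ?setI0//; apply/seteqP; split => // x /= xc.
  by move: c0; rewrite -xc eqxx.
have mlt : measurable (D `&` [set x | `|f x - a n| < `|f x - nearest n x|]).
  have := measurable_fun_ltr (borel_dist (a n) mD mf) (nearest_dist_measurable n).
  by move=> /(_ mD [set true] I); rewrite /preimage.
rewrite (_ : _ `&` _ =
  (D `&` [set x | `|f x - a n| < `|f x - nearest n x|]) `&` [set _ | a n = c] `|`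
  (D `&` nearest n @^-1` [set c]) `\`
  (D `&` [set x | `|f x - a n| < `|f x - nearest n x|])); last first.
  apply/seteqP; split => x /=; case: ifPn => h.
  - by move=> [Dx xc]; left.
  - by move=> [Dx xc]; right; split => // -[].
  - by move=> [[[]]|[[? ?] []]].
  - by move=> [[[]]|[]].
apply: measurableU; last exact: measurableD.
have [anc|anc] := pselect (a n = c).
  by rewrite (_ : [set _ : T | a n = c] = setT) ?setIT//; apply/seteqP; split.
by rewrite (_ : [set _ : T | a n = c] = set0) ?setI0//; apply/seteqP; split.
Qed.

(** On the level set of a nonzero [c], the point [c] is no farther from [f x] than 0 is, so |c| <= 2
    |f x|, and Markov's inequality bounds the measure of this set. *)
Lemma nearest_simple n : simple_on mu D (nearest n).
Proof.
split; [exact: nearest_finite|exact: nearest_level|move=> c c0].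
have c2 : 0 < `|c| / 2 by rewrite divr_gt0 ?normr_gt0.
have mf' := borel_norm mD mf.
have := le_integral_abse mu mD (measurable_int mu intf) c2.
have -> : (\int[mu]_(x in D) `|(`|f x|%:E)| = \int[mu]_(x in D) `|f x|%:E)%E.
  by apply: eq_integral => x _; rewrite gee0_abs ?lee_fin.
move=> /le_lt_trans /(_ (integrable_lty mD intf)) h.
have {}h : (mu (D `&` [set x | ((`|c| / 2)%:E <= `|(`|f x|%:E)|)%E]) < +oo)%E.
  move: h; case: (mu _) (measure_ge0 mu (D `&` [set x | ((`|c| / 2)%:E <= `|(`|f x|%:E)|)%E])) => //.
  - by move=> r _ _; rewrite ltry.
  - by rewrite gt0_muley// lte_fin.
apply: le_lt_trans h; apply: le_measure; rewrite ?inE//.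
- exact: nearest_level.
- have := measurable_fun_ler (@measurable_cst _ _ _ _ D (`|c| / 2)) mf'.
  move=> /(_ mD [set true] I); rewrite /preimage/=.
  by congr (measurable (_ `&` _)); apply/seteqP; split => x /=; rewrite lee_fin normr_id.
- move=> x [Dx /= xc]; split => //=; rewrite lee_fin normr_id ler_pdivrMr//.
  rewrite -[c](subrKC (f x)) mulr_natr mulr2n.
  by rewrite (le_trans (ler_normD _ _))// lerD2l distrC -xc nearest_le.
Qed.

Lemma nearest_cvg_int :
  (\int[mu]_(x in D) `|f x - nearest n x|%:E)%E @[n --> \oo] --> 0%E.
Proof.
have [||||_ _] := @dominated_convergence _ _ _ mu D mD
  (fun n x => `|f x - nearest n x|%:E) (cst 0%E) (fun x => `|f x|%:E) _ _ _ intf.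
- by move=> n; exact/measurable_EFinP/nearest_dist_measurable.
- exact: measurable_cst.
- apply: aeW => x Dx; apply/cvg_EFin; first exact: nearW.
  exact: nearest_cvg.
- by apply: aeW => x n Dx /=; rewrite normr_id lee_fin nearest_le.
- by rewrite integral0.
Qed.

(** The difference y of two simple integrals is tested against itself: |y|^2 <= [p y y], and both
    terms of [p y y] are close to the same integral of [p (f x) y], with an error proportional to
    |y|. Cancelling |y| gives the Cauchy property. *)
Lemma is_bochner_ex : seq_complete -> exists v, is_bochner_integral mu D f v.
Proof.
move=> Ecomp.
have s0 : \int[mu]_(x in D) `|f x - nearest n x| @[n --> \oo] --> 0.
  exact: (fine_cvg nearest_cvg_int).
pose S n := simple_integral mu D (nearest n).
suff [v Sv] : exists v : E, S n @[n --> \oo] --> v.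
  exists v; split => //; exists nearest; split => //.
  - exact: nearest_simple.
  - exact: nearest_cvg_int.
apply: Ecomp => e e0.
pose K := `|C| + 1.
have K0 : 0 < K by rewrite ltr_wpDl.
have Sb n y : `|p (S n) y - \int[mu]_(x in D) p (f x) y| <=
    K * `|y| * \int[mu]_(x in D) `|f x - nearest n x|.
  rewrite (le_trans (simple_pairing_dist _ (nearest_simple n)))//.
  rewrite ler_wpM2r ?Rintegral_ge0// ler_wpM2r// /K.
  by rewrite (le_trans (ler_norm C)) ?lerDl.
have [N _ HN] : \forall n \near \oo,
    \int[mu]_(x in D) `|f x - nearest n x| <= e / 2 / K.
  move/cvgrPdist_le : s0 => /(_ (e / 2 / K)).
  rewrite !divr_gt0// => /(_ isT); apply: filterS => n.
  by rewrite sub0r normrN; apply: le_trans; exact: ler_norm.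
exists N => m n Nm Nn.
set y := S m - S n.
have [->|y0] := eqVneq y 0; first by rewrite normr0 ltW.
have y0' : 0 < `|y| by rewrite normr_gt0.
rewrite -(ler_pM2l y0') -expr2 (le_trans (pairing_ge hp y))//.
have -> : p y y = (p (S m) y - \int[mu]_(x in D) p (f x) y) -
  (p (S n) y - \int[mu]_(x in D) p (f x) y) by rewrite {1}/y pairingB; ring.
rewrite (le_trans (ler_norm _))// (le_trans (ler_normB _ _))//.
rewrite (splitr e) mulrDr lerD//.
  rewrite (le_trans (Sb _ _))// (mulrC K) -mulrA ler_wpM2l//.
  by rewrite mulrC -ler_pdivlMr//; exact: HN.
rewrite (le_trans (Sb _ _))// (mulrC K) -mulrA ler_wpM2l//.
by rewrite mulrC -ler_pdivlMr//; exact: HN.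
Qed.

Lemma bochner_pairing y : seq_complete ->
  p (bochner_integral mu D f) y = \int[mu]_(x in D) p (f x) y.
Proof.
move=> /is_bochner_ex [v hv]; apply: is_bochner_pairing.
by rewrite /bochner_integral; case: xgetP => // /(_ v).
Qed.

End integrable.

End pairing.

(** * Square-integrable functions *)

Section ereal_limits.
Context (R : realType).
Local Open Scope ereal_scope.

Lemma cvge0P (T : Type) (F : set_system T) (FF : Filter F) (g : T -> \bar R) :
  (forall t, 0 <= g t) ->
  g @ F --> 0 <-> forall e : R, (0 < e)%R -> \forall t \near F, g t <= e%:E.
Proof.
move=> g0; split=> [g_0 e e0|h].
  move: g_0 => /fine_cvgP[fing /cvgrPdist_le/(_ e e0)].
  apply: filterS2 fing => t fgt; rewrite sub0r normrN/= => ge.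
  by rewrite -(fineK fgt) lee_fin (le_trans _ ge)// ler_norm.
apply/fine_cvgP; split.
  near=> t; rewrite ge0_fin_numE//.
  by apply: (@le_lt_trans _ _ 1%:E); [near: t; exact: h|exact: ltry].
apply/cvgrPdist_le => e e0; near=> t; have ge : g t <= e%:E by near: t; exact: h.
rewrite sub0r normrN ger0_norm ?fine_ge0//= -lee_fin fineK//.
by rewrite ge0_fin_numE// (le_lt_trans ge)// ltry.
Unshelve. all: by end_near. Qed.

Lemma limn_einf_le (u : nat -> \bar R) N c :
  (forall n, (N <= n)%N -> u n <= c) -> limn_einf u <= c.
Proof.
move=> uc; rewrite limn_einf_lim; apply: lime_le; first exact: is_cvg_einfs.
apply: nearW => n; apply: (@le_trans _ _ (u (maxn N n))).
  by apply: ereal_inf_lbound; exists (maxn N n) => //=; exact: leq_maxr.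
exact/uc/leq_maxl.
Qed.

Lemma le_epsilon_eq0 (x : \bar R) : 0 <= x ->
  (forall e : R, (0 < e)%R -> x <= e%:E) -> x = 0.
Proof.
move=> x0 h; apply/eqP; rewrite eq_le x0 andbT.
by apply/lee_addgt0Pr => e e0; rewrite add0e h.
Qed.

End ereal_limits.

Section sqint.
Context (R : realType) (d : measure_display) (T : measurableType d)
  (mu : {measure set T -> \bar R}).
Local Open Scope ereal_scope.

(** The squared L2 norm, extended and without a root, so that Fatou and Tonelli apply with no
    finiteness condition. On [H * H] it refers to the max-norm. *)
Definition sqint (E : normedModType R) (f : T -> E) : \bar R :=
  \int[mu]_x (`|f x| ^+ 2)%:E.

Context (E : normedModType R) (a : nat -> E) (da : dense_seq a).
Implicit Types f g : T -> E.

Lemma sqint_ge0 f : 0 <= sqint f.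
Proof. by apply: integral_ge0 => x _; rewrite lee_fin. Qed.

Lemma sq_measurable f : borel_measurable setT f ->
  measurable_fun setT (fun x => (`|f x| ^+ 2)%:E).
Proof. by move=> mf; apply/measurable_EFinP/measurable_funX/borel_norm. Qed.

Lemma le_sqint f g : borel_measurable setT f -> borel_measurable setT g ->
  (forall x, (`|f x| <= `|g x|)%R) -> sqint f <= sqint g.
Proof.
move=> mf mg fg; apply: ge0_le_integral => //; try exact: sq_measurable.
by move=> x _; rewrite lee_fin lerXn2r// nnegrE.
Qed.

Lemma ae_eq_sqint f g : borel_measurable setT f -> borel_measurable setT g ->
  {ae mu, forall x, f x = g x} -> sqint f = sqint g.
Proof.
move=> mf mg fg; apply: ae_eq_integral => //; try exact: sq_measurable.
by apply: filterS fg => x fgx _; rewrite fgx.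
Qed.

Lemma sqintZ (k : R) f : borel_measurable setT f ->
  sqint (fun x => k *: f x)%R = (k ^+ 2)%:E * sqint f.
Proof.
move=> mf; rewrite -ge0_integralZl_EFin//.
- by apply: eq_integral => x _; rewrite normrZ exprMn -normrX ger0_norm// sqr_ge0.
- exact: sq_measurable.
- exact: sqr_ge0.
Qed.

Lemma sqintN f : borel_measurable setT f -> sqint (fun x => - f x)%R = sqint f.
Proof. by move=> mf; apply: eq_integral => x _; rewrite normrN. Qed.

(** The pointwise inequality (x + y)^2 <= 2 x^2 + 2 y^2 stands in for Minkowski; constants are
    immaterial in the limits below. *)
Lemma sqintD f g : borel_measurable setT f -> borel_measurable setT g ->
  sqint (fun x => f x + g x)%R <= 2%:E * sqint f + 2%:E * sqint g.
Proof.
move=> mf mg.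
rewrite -!ge0_integralZl_EFin//; try exact: sq_measurable;
  try by move=> x _; rewrite lee_fin.
rewrite -ge0_integralD//; [|first [by move=> x _; rewrite -EFinM lee_fin mulr_ge0|
  by apply: emeasurable_funM => //; exact: sq_measurable]..].
apply: ge0_le_integral => //.
- by apply/sq_measurable/(borel_add da).
- by apply: emeasurable_funD; apply: emeasurable_funM => //; exact: sq_measurable.
- move=> x _; rewrite -!EFinM -EFinD lee_fin.
  apply: (@le_trans _ _ ((`|f x| + `|g x|) ^+ 2)%R).
    by rewrite lerXn2r ?nnegrE ?addr_ge0// ler_normD.
  rewrite -subr_ge0.
  have -> : (2 * `|f x| ^+ 2 + 2 * `|g x| ^+ 2 - (`|f x| + `|g x|) ^+ 2 =
    (`|f x| - `|g x|) ^+ 2)%R by ring.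
  exact: sqr_ge0.
Qed.

Lemma borelB f g : borel_measurable setT f -> borel_measurable setT g ->
  borel_measurable setT (fun x => f x - g x)%R.
Proof. by move=> mf mg; exact: (borel_sub measurableT da). Qed.

Lemma sqintB f g : borel_measurable setT f -> borel_measurable setT g ->
  sqint (fun x => f x - g x)%R <= 2%:E * sqint f + 2%:E * sqint g.
Proof.
move=> mf mg; rewrite -(sqintN mg); apply: sqintD => //.
apply: (@borel_comp _ _ _ _ _ _ _ -%R%R _ _ mg) => //; exact: opp_continuous.
Qed.

Lemma sqint_subC f g : sqint (fun x => f x - g x)%R = sqint (fun x => g x - f x)%R.
Proof. by apply: eq_integral => x _; rewrite distrC. Qed.

Lemma sqint_subadd g f h : borel_measurable setT f -> borel_measurable setT g ->
  borel_measurable setT h ->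
  sqint (fun x => f x - h x)%R <=
  2%:E * sqint (fun x => f x - g x)%R + 2%:E * sqint (fun x => g x - h x)%R.
Proof.
move=> mf mg mh; have := sqintD (borelB mf mg) (borelB mg mh).
by under [X in sqint X]eq_fun do rewrite subrKA.
Qed.

Lemma borel_lim (f : nat -> T -> E) g : (forall n, borel_measurable setT (f n)) ->
  (forall x, (f n x @[n --> \oo] --> g x)%R) -> borel_measurable setT g.
Proof.
move=> mf fg; apply: (dist_borel da) => // c.
apply: (measurable_fun_cvg (fun n => borel_dist c measurableT (mf n))) => x _.
by apply: cvg_norm; apply: cvgB => //; exact: cvg_cst.
Qed.

Lemma sqint_fatou (f : nat -> T -> E) g N (C : \bar R) :
  (forall n, borel_measurable setT (f n)) -> borel_measurable setT g ->
  {ae mu, forall x, (f n x @[n --> \oo] --> g x)%R} ->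
  (forall n, (N <= n)%N -> sqint (f n) <= C) -> sqint g <= C.
Proof.
move=> mf mg fg fC.
apply: (le_trans _ (limn_einf_le fC)).
apply: (le_trans _ (fatou _ _ _ _)) => //.
- apply: ae_ge0_le_integral => //.
  + exact: sq_measurable.
  + move=> x _; rewrite limn_einf_lim; apply: lime_ge; first exact: is_cvg_einfs.
    apply: nearW => n; apply: le_ereal_inf_tmp => _ [m _ <-]; by rewrite lee_fin.
  + apply: (emeasurable_fun_cvg (fun n x => einfs (fun k => (`|f k x| ^+ 2)%:E) n)).
      by apply: measurable_fun_einfs => n; exact: sq_measurable.
    by move=> x _; rewrite limn_einf_lim; exact: is_cvg_einfs.
  + apply: filterS fg => x fgx _.
    have h : (`|f n x| ^+ 2)%:E @[n --> \oo] --> (`|g x| ^+ 2)%:E.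
      apply: cvg_EFin; first exact: nearW.
      rewrite [X in X @ _ --> _](_ : _ = fun n => `|f n x| ^+ 2)%R//.
      rewrite expr2; under eq_fun do rewrite expr2.
      by apply: cvgM; apply: cvg_norm.
    by have [-> _] := cvg_limn_einf_sup h.
- by move=> n; exact: sq_measurable.
Qed.

Lemma sqint_eq0 f : borel_measurable setT f -> sqint f = 0 ->
  {ae mu, forall x, f x = 0%R}.
Proof.
move=> mf f0.
have /ae_eq_integral_abs : measurable_fun setT (fun x => (`|f x| ^+ 2)%:E).
  exact: sq_measurable.
move=> /(_ mu measurableT)[+ _]; rewrite (eq_integral (fun x => (`|f x| ^+ 2)%:E)).
  move=> /(_ f0); apply: filterS => x /(_ I) /= [] /eqP.
  by rewrite sqrf_eq0 normr_eq0 => /eqP.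
by move=> x _; rewrite gee0_abs// lee_fin.
Qed.

(** Fatou for [f n - g], which tends pointwise to [h - g], bounds the squared norm of [h - g] by
    every positive e. *)
Lemma sqint_lim_unique (f : nat -> T -> E) g h :
  (forall n, borel_measurable setT (f n)) ->
  borel_measurable setT g -> borel_measurable setT h ->
  (forall e : R, (0 < e)%R -> exists N, forall n, (N <= n)%N ->
     sqint (fun x => f n x - g x)%R <= e%:E) ->
  {ae mu, forall x, (f n x @[n --> \oo] --> h x)%R} ->
  {ae mu, forall x, g x = h x}.
Proof.
move=> mf mg mh fg fh.
suff : sqint (fun x => h x - g x)%R = 0.
  move=> /(sqint_eq0 (borelB mh mg)); apply: filterS => x /eqP.
  by rewrite subr_eq0 => /eqP.
apply: le_epsilon_eq0; first exact: sqint_ge0.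
move=> e /fg[N fgN].
apply: (@sqint_fatou (fun n x => f n x - g x)%R _ N) => //.
- by move=> n; exact: borelB.
- exact: borelB.
- by apply: filterS fh => x fhx; apply: cvgB => //; exact: cvg_cst.
Qed.

(** Along a subsequence whose squared increments have integral at most 8^-k, the sum of 4^k times
    the squared increments has finite integral. Almost everywhere the k-th increment is then at most
    M 2^-k, so completeness of the space gives a pointwise limit, and Fatou makes it an L2 limit of
    the whole sequence. *)
Lemma riesz_fischer (f : nat -> T -> E) : seq_complete E ->
  (forall n, borel_measurable setT (f n)) ->
  (forall e : R, (0 < e)%R -> exists N, forall m n, (N <= m)%N -> (N <= n)%N ->
    sqint (fun x => f m x - f n x)%R <= e%:E) ->
  exists2 g, borel_measurable setT g &
    forall e : R, (0 < e)%R -> exists N, forall n, (N <= n)%N ->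
      sqint (fun x => f n x - g x)%R <= e%:E.
Proof.
move=> Ec mf fC.
have /choice[N HN] : forall k, exists N, forall m n, (N <= m)%N -> (N <= n)%N ->
    sqint (fun x => f m x - f n x)%R <= ((8^-1 : R) ^+ k)%:E.
  by move=> k; apply: fC; rewrite exprn_gt0.
(* Partial sums of the successors are monotone and dominate both [N k] and [k]. *)
pose phi k := (\sum_(j < k.+1) (N j).+1)%N.
have phiS k : (phi k <= phi k.+1)%N by rewrite /phi [leqRHS]big_ord_recr leq_addr.
have phiN k : (N k <= phi k)%N.
  by rewrite /phi big_ord_recr /= (leq_trans (leqnSn _))// leq_addl.
have phik k : (k <= phi k)%N.
  elim: k => // k ih; rewrite /phi big_ord_recr /= (leq_ltn_trans ih)//.
  by rewrite addnS ltnS leq_addr.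
pose g k := f (phi k).
have gC k : sqint (fun x => g k.+1 x - g k x)%R <= ((8^-1 : R) ^+ k)%:E.
  by apply: HN => //; rewrite (leq_trans _ (phiS k)).
(* The weight 4 is below 8, so that the integrals are summable, and above 1, so that a finite sum
   forces geometric decay of the increments. *)
pose D k x := (4 ^+ k * `|g k.+1 x - g k x| ^+ 2)%:E.
have D0 k x : 0 <= D k x by rewrite lee_fin mulr_ge0.
have mD k : measurable_fun setT (D k).
  apply/measurable_EFinP/measurable_funM => //.
  by apply/measurable_funX/borel_norm => //; exact: (borelB (mf _) (mf _)).
pose h x := \sum_(k <oo) D k x.
have mh : measurable_fun setT h.
  by apply: ge0_emeasurable_sum => // k x _ _; exact: D0.
have h0 x : 0 <= h x by apply: nneseries_ge0 => k _ _; exact: D0.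
have hlt : \int[mu]_x h x < +oo.
  rewrite integral_nneseries//.
  apply: (@le_lt_trans _ _ (\sum_(k <oo) (2 / (2 ^ (k + 1))%:R : R)%:E)).
    apply: lee_nneseries => k _.
      by move=> _; apply: integral_ge0 => x _; exact: D0.
    rewrite /D; under eq_integral do rewrite EFinM.
    rewrite ge0_integralZl_EFin//.
    - have -> : (2 / (2 ^ (k + 1))%:R = 4 ^+ k * 8^-1 ^+ k :> R)%R.
        rewrite -exprMn addn1 natrX exprS invfM mulrA divff ?mul1r//.
        by rewrite -exprVn; congr (_ ^+ _)%R; lra.
      by rewrite (EFinM (4 ^+ k)%R) lee_wpmul2l// ?lee_fin ?exprn_ge0//; exact: gC.
    - by apply: sq_measurable; exact: (borelB (mf _) (mf _)).
  by rewrite (cvg_lim _ (@cvg_geometric_eseries_half R 2%R 0))// ltry.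
pose G := [set x | h x < +oo].
have mG : measurable G.
  by have := emeasurable_fun_infty_o measurableT mh +oo; rewrite setTI.
have aeG : {ae mu, forall x, G x}.
  have /integrable_ae : mu.-integrable setT h.
    apply/integrableP; split => //.
    by under eq_integral do rewrite gee0_abs//.
  move=> /(_ measurableT); apply: filterS => x /(_ I).
  by rewrite ge0_fin_numE.
have gcv x : G x -> exists l : E, (g k x @[k --> \oo] --> l)%R.
  move=> Gx; have hx : h x = (fine (h x))%:E by rewrite fineK// ge0_fin_numE.
  pose M := Num.sqrt (fine (h x)).
  have M0 : (0 <= M)%R by exact: sqrtr_ge0.
  have dk k : (`|g k.+1 x - g k x| <= M * 2^-1 ^+ k)%R.
    have : D k x <= h x.
      rewrite /h (@nneseriesD1 _ _ k)// ?leeDl//.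
        by apply: nneseries_ge0 => j _ _; exact: D0.
    rewrite hx lee_fin => Dh; rewrite -(@ler_pXn2r _ 2)// ?nnegrE ?mulr_ge0// exprMn.
    rewrite sqr_sqrtr ?fine_ge0// -exprM mulnC exprM.
    have -> : ((2^-1 : R) ^+ 2 = 4^-1)%R by rewrite exprVn; congr (_^-1)%R; ring.
    by rewrite exprVn ler_pdivlMr ?exprn_gt0// mulrC.
  apply: Ec => e e0.
  (* The exact value of the geometric sum on the right lets the induction on [j] close. *)
  have gd n j : (`|g (n + j)%N x - g n x| <= 2 * M * (2^-1 ^+ n - 2^-1 ^+ (n + j)))%R.
    elim: j => [|j ih]; first by rewrite addn0 !subrr normr0 mulr0.
    rewrite addnS -(subrKA (g (n + j)%N x)) (le_trans (ler_normD _ _))//.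
    apply: (le_trans (lerD (dk _) ih)).
    rewrite le_eqVlt; apply/orP; left; apply/eqP.
    by rewrite exprS; field.
  have [N0 _ HN0] : \forall n \near \oo, (2 * M * 2^-1 ^+ n <= e)%R.
    have w1 : (`|2^-1 : R| < 1)%R by rewrite ger0_norm// invf_lt1// ltr1n.
    have /cvgrPdist_le/(_ _ e0) := cvg_geometric (2 * M) w1.
    by apply: filterS => n /=; rewrite sub0r normrN; apply: le_trans; exact: ler_norm.
  exists N0 => m n; wlog mn : m n / (n <= m)%N.
    move=> W Nm Nn; have /orP[mn|nm] := leq_total m n; last exact: W.
    by rewrite distrC; exact: W.
  move=> _ Nn; rewrite -(subnKC mn) (le_trans (gd _ _))//.
  rewrite (le_trans _ (HN0 n Nn))// ler_wpM2l ?mulr_ge0//.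
  by rewrite gerDl oppr_le0 exprn_ge0.
pose l x := if pselect (G x) is left Gx then projT1 (cid (gcv x Gx)) else 0%R.
have lcv x : G x -> (g k x @[k --> \oo] --> l x)%R.
  by move=> Gx; rewrite /l; case: pselect => // Gx'; case: cid.
(* Outside [G] the limit is set to 0; multiplied by the indicator of [G], the subsequence converges
   to [l] at every point, not just almost everywhere. *)
have ml : borel_measurable setT l.
  apply: (@borel_lim (fun k x => (\1_G x : R) *: g k x)%R).
    by move=> k; apply: (borel_scale da) => //; exact: mf.
  move=> x; rewrite indicE; have [xG|xG] := boolP (x \in G).
    under eq_fun do rewrite scale1r.
    by apply: lcv; rewrite inE in xG.
  under eq_fun do rewrite scale0r.
  rewrite /l; case: pselect => [Gx|_]; first by rewrite mem_set in xG.
  exact: cvg_cst.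
exists l => // e /fC[N0 N0e]; exists N0 => n N0n.
apply: (@sqint_fatou (fun k x => f n x - g k x)%R _ N0).
- by move=> k; exact: (borelB (mf _) (mf _)).
- exact: (borelB (mf _) ml).
- by apply: filterS aeG => x Gx; apply: cvgB (lcv x Gx); exact: cvg_cst.
- by move=> k Nk; apply: N0e => //; exact: leq_trans (phik k).
Qed.
End sqint.

(** * Fubini and translation invariance for real integrands *)

Section fubini_real.
Context d1 d2 (T1 : measurableType d1) (T2 : measurableType d2) (R : realType).
Context (m1 : {sigma_finite_measure set T1 -> \bar R})
  (m2 : {sigma_finite_measure set T2 -> \bar R}).
Implicit Type f : T1 * T2 -> R.

Lemma measurable_Rintegral f : measurable_fun setT f ->
  measurable_fun setT (fun x => \int[m2]_y f (x, y)).
Proof.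
move=> mf; rewrite /Rintegral.
apply: measurableT_comp; first exact: fine_measurable.
under eq_fun do rewrite integralE.
have mf' : measurable_fun setT (EFin \o f) by exact/measurable_EFinP.
apply: emeasurable_funB.
- rewrite (_ : (fun _ => _) = fubini_F m2 (EFin \o f)^\+%E).
    by apply: measurable_fun_fubini_tonelli_F => //; exact: measurable_funepos.
  by apply/funext => x; apply: eq_integral => y _; rewrite !funeposE.
- rewrite (_ : (fun _ => _) = fubini_F m2 (EFin \o f)^\-%E).
    by apply: measurable_fun_fubini_tonelli_F => //; exact: measurable_funeneg.
  by apply/funext => x; apply: eq_integral => y _; rewrite !funenegE.
Qed.

(** The real integral of a section truncates infinite values through [fine]. By integrability this
    happens only on a null set, so the iterated integrals agree with the extended ones. *)
Lemma Rfubini f : measurable_fun setT f ->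
  (\int[m1]_x \int[m2]_y `|f (x, y)|%:E < +oo)%E ->
  \int[m1]_x (\int[m2]_y f (x, y)) = \int[m2]_y (\int[m1]_x f (x, y)).
Proof.
move=> mf foo; have mf' : measurable_fun setT (EFin \o f) by exact/measurable_EFinP.
have imf : (m1 \x m2)%E.-integrable setT (EFin \o f).
  by apply/(integrable12ltyP m1 m2 mf').
rewrite {1}/Rintegral [RHS]/Rintegral; congr fine.
transitivity (\int[m1]_x (\int[m2]_y (f (x, y))%:E))%E.
  apply: ae_eq_integral => //.
  - exact/measurable_EFinP/measurable_Rintegral.
  - exact: measurable_fubini_F imf.
  - apply: filterS (ae_integrable1 imf) => x ix _.
    by rewrite /Rintegral fineK//; exact: integrable_fin_num.
rewrite (Fubini imf); apply: ae_eq_integral => //.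
- exact: measurable_fubini_G imf.
- apply/measurable_EFinP/measurableT_comp; first exact: fine_measurable.
  exact: measurable_fubini_G imf.
- apply: filterS (ae_integrable2 imf) => y iy _.
  by rewrite /Rintegral fineK//; exact: integrable_fin_num.
Qed.

Lemma prod_dominated f (g : T1 -> R) (h : T2 -> R) : measurable_fun setT f ->
  m1.-integrable setT (EFin \o g) -> m2.-integrable setT (EFin \o h) ->
  (forall x y, `|f (x, y)| <= g x * h y) ->
  (\int[m1]_x \int[m2]_y `|f (x, y)|%:E < +oo)%E.
Proof.
move=> mf ig ih fgh.
have mg := (measurable_EFinP _ _).1 (measurable_int _ ig).
have mh := (measurable_EFinP _ _).1 (measurable_int _ ih).
pose K := (\int[m2]_y `|h y|%:E)%E.
have K0 : (0 <= K)%E by apply: integral_ge0 => y _; rewrite lee_fin.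
have Kf : K \is a fin_num.
  by rewrite ge0_fin_numE//; move/integrableP : ih => [_].
have mnf : measurable_fun setT (fun z => `|f z|%:E).
  exact/measurable_EFinP/measurableT_comp.
apply: (@le_lt_trans _ _ (\int[m1]_x (`|g x|%:E * K))%E).
  apply: ge0_le_integral => //.
  - by move=> x _; apply: integral_ge0 => y _; rewrite lee_fin.
  - by apply: (measurable_fun_fubini_tonelli_F (fun z => `|f z|%:E)).
  - apply: emeasurable_funM => //; apply/measurable_EFinP/measurableT_comp => //.
  - move=> x _; rewrite /K -ge0_integralZl//; last first.
      by apply/measurable_EFinP/measurableT_comp.
    apply: ge0_le_integral => //.
    + apply/measurable_EFinP/measurableT_comp => //; apply: measurableT_comp mf _.
      exact: measurable_pair1.
    + apply: emeasurable_funM => //; apply/measurable_EFinP/measurableT_comp => //.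
    + move=> y _; rewrite -EFinM lee_fin (le_trans (fgh _ _))//.
      by rewrite -normrM ler_norm.
rewrite ge0_integralZr//.
  rewrite -(fineK Kf); move/integrableP : ig => [_ gy].
  have gf : (\int[m1]_x `|g x|%:E)%E \is a fin_num.
    by rewrite ge0_fin_numE//; apply: integral_ge0 => x _; rewrite lee_fin.
  by rewrite -(fineK gf) -EFinM ltry.
by apply/measurable_EFinP/measurableT_comp.
Qed.

End fubini_real.

Section translation.
Context (R : realType).
Local Notation mu := (@lebesgue_measure R).

Lemma measurable_shift (a : R) :
  measurable_fun setT ((fun x => x + a) : measurableTypeR R -> measurableTypeR R).
Proof. exact: (@measurable_funD _ _ _ _ id (cst a)). Qed.

(** Uniqueness of Lebesgue measure leaves only half-open intervals to check. *)
Lemma lebesgue_measure_shift (a : R) (A : set R) : measurable A ->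
  pushforward mu ((fun x => x + a) : _ -> measurableTypeR R) A = mu A.
Proof.
move=> mA; apply/esym/lebesgue_measure_unique => //=.
  exact: measurable_shift.
move=> _ _ [[b c]] _ <-.
rewrite /pushforward.
have -> : (fun x => x + a) @^-1` `]b, c] = `]b - a, c - a]%classic.
  by apply/seteqP; split => x /=; rewrite !in_itv/= ltrBlDr lerBrDr.
rewrite !lebesgue_measure_itv/= !lte_fin ltrD2r.
by case: ifPn => // _; rewrite -!EFinB; congr EFin; ring.
Qed.

Lemma ge0_integral_shift (a : R) (f : R -> \bar R) :
  measurable_fun setT f -> (forall x, 0 <= f x)%E ->
  (\int[mu]_x f (x + a)%R = \int[mu]_x f x)%E.
Proof.
move=> mf f0.
rewrite -(@ge0_integral_pushforward _ _ _ _ _ _ (measurable_shift a) mu setT f)//.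
apply: eq_measure_integral => //; first exact: measurable_shift.
by move=> H A mA _; exact: lebesgue_measure_shift.
Qed.

Lemma integral_shift (a : R) (f : R -> \bar R) : measurable_fun setT f ->
  (\int[mu]_x f (x + a)%R = \int[mu]_x f x)%E.
Proof.
move=> mf; rewrite integralE [RHS]integralE.
rewrite -(ge0_integral_shift a (measurable_funepos mf))//.
rewrite -(ge0_integral_shift a (measurable_funeneg mf))//.
by congr (_ - _)%E; apply: eq_integral => x _; rewrite ?funeposE ?funenegE.
Qed.

End translation.

(** * The L2 norm of the statement through integrals of squares *)

Section L2norm.
Context (R : realType) (E : normedModType R) (N : E -> R)
  (N0 : forall x, 0 <= N x).
Local Notation mu := (@lebesgue_measure R).
Local Open Scope ereal_scope.

Lemma L2norm_sqr (f : R -> E) :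
  L2norm N f `^ 2 = \int[mu]_x ((N (f x)) ^+ 2)%:E.
Proof.
rewrite /L2norm poweR_Lnorm//; apply: eq_integral => x _ /=.
by rewrite /= ger0_norm// powR_mulrn.
Qed.

Lemma L2norm_le (f : R -> E) (e : R) : (0 <= e)%R ->
  L2norm N f <= e%:E <-> \int[mu]_x ((N (f x)) ^+ 2)%:E <= (e ^+ 2)%:E.
Proof.
move=> e0; rewrite -L2norm_sqr.
have eE : (e ^+ 2)%:E = e%:E `^ 2 by rewrite poweR_EFin powR_mulrn.
have L0 : 0 <= L2norm N f by exact: Lnorm_ge0.
split=> h.
  by rewrite eE; apply: gt0_ler_poweR => //; rewrite in_itv /= ?leey ?andbT ?lee_fin.
have -> : L2norm N f = (L2norm N f `^ 2) `^ (2^-1).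
  by rewrite -poweRrM divff// poweRe1.
have -> : e%:E = (e%:E `^ 2) `^ (2^-1).
  by rewrite -poweRrM divff// poweRe1// lee_fin.
rewrite -eE; apply: gt0_ler_poweR => //; rewrite in_itv /= ?leey ?andbT ?poweR_ge0//.
by rewrite lee_fin sqr_ge0.
Qed.

Lemma L2norm_lty (f : R -> E) :
  L2norm N f < +oo <-> \int[mu]_x ((N (f x)) ^+ 2)%:E < +oo.
Proof.
rewrite -L2norm_sqr; split; first exact: poweR_lty.
exact: lty_poweRy.
Qed.

(** The filter is arbitrary: it will be that of a sequence for the Fourier transform, and [0^'+] for
    the generator. *)
Lemma L2norm_cvg0 (T : Type) (F : set_system T) (FF : Filter F)
    (f : T -> R -> E) :
  L2norm N (f t) @[t --> F] --> 0 <->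
  (\int[mu]_x ((N (f t x)) ^+ 2)%:E) @[t --> F] --> 0.
Proof.
rewrite !cvge0P; last 2 first.
- by move=> t; apply: integral_ge0 => x _; rewrite lee_fin sqr_ge0.
- by move=> t; exact: Lnorm_ge0.
split=> h e e0.
  have se0 : (0 < Num.sqrt e)%R by rewrite sqrtr_gt0.
  apply: filterS (h _ se0) => t ht.
  by have := (L2norm_le _ (ltW se0)).1 ht; rewrite sqr_sqrtr// ltW.
have /h : (0 < e ^+ 2)%R by rewrite exprn_gt0.
by apply: filterS => t ?; apply/L2norm_le => //; exact: ltW.
Qed.

End L2norm.

(** * The Abel kernel and its Fourier transform *)

Section poisson_kernel.
Context (R : realType).
Local Notation mu := (@lebesgue_measure R).

Lemma scale_regE (a b : R) : a *: (b : R^o) = a * b.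
Proof. by []. Qed.

Lemma is_derive_mull (c r : R) : is_derive r 1 (fun r => c * r) c.
Proof.
have := @is_deriveZ _ _ _ (@id R) c r 1 1 (is_derive_id _ _).
by rewrite /GRing.scale /= mulr1.
Qed.

Lemma is_derive_expRl (c r : R) :
  is_derive r 1 (fun r => expR (c * r)) (c * expR (c * r)).
Proof.
have := is_derive1_comp (is_derive_expR (c * r)) (is_derive_mull c r).
by rewrite mulrC; apply.
Qed.

Lemma is_derive_cosl (c r : R) :
  is_derive r 1 (fun r => cos (c * r)) (- c * sin (c * r)).
Proof.
have := is_derive1_comp (is_derive_cos (c * r)) (is_derive_mull c r).
by rewrite mulNr -mulrN mulrC; apply.
Qed.

Lemma is_derive_sinl (c r : R) :
  is_derive r 1 (fun r => sin (c * r)) (c * cos (c * r)).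
Proof.
have := is_derive1_comp (is_derive_sin (c * r)) (is_derive_mull c r).
by rewrite mulrC; apply.
Qed.

Lemma is_derive_continuous (f : R -> R) df :
  (forall x : R, is_derive x 1 f (df x)) -> continuous f.
Proof.
by move=> h x; apply/differentiable_continuous/derivable1_diffP; case: (h x).
Qed.

Lemma cvg_expRl_bounded (c : R) (g : R -> R) (M : R) : c < 0 ->
  (forall r, `|g r| <= M) -> expR (c * r) * g r @[r --> +oo] --> 0.
Proof.
move=> c0 gM.
have M0 : 0 <= M by exact: le_trans (gM 0).
apply/norm_cvg0P; apply: (@squeeze_cvgr _ _ _ _ (cst 0) (fun r => expR (c * r) * M)).
- apply: nearW => r; rewrite normr_ge0 normrM ger0_norm ?expR_ge0//=.
  by rewrite ler_wpM2l// expR_ge0.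
- exact: cvg_cst.
- suff : expR (c * r) * M @[r --> +oo] --> 0 * M by rewrite mul0r.
  apply: cvgM; last exact: cvg_cst.
  have -> : (fun r => expR (c * r)) = (fun r => expR (- r)) \o (fun r => - c * r).
    by apply/funext => r /=; rewrite mulNr opprK.
  apply: cvg_comp (@cvgr_expR R).
  by apply: gt0_cvgMry => //; rewrite oppr_gt0.
Qed.

Section fixed_eps.
Context (e : R) (e0 : 0 < e).

(** An integrable damping factor that tends to 1 with e -> 0; its Fourier transform is [poisson]. *)
Definition abel (r : R) : R := expR (- e * `|r|).
Definition poisson (x : R) : R := 2 * e / (e ^+ 2 + x ^+ 2).

Lemma poisson_den x : 0 < e ^+ 2 + x ^+ 2.
Proof. by rewrite ltr_pwDl ?exprn_gt0 ?sqr_ge0. Qed.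

Lemma poisson_ge0 x : 0 <= poisson x.
Proof. by rewrite divr_ge0 ?mulr_ge0 ?(ltW e0)// ltW// poisson_den. Qed.

Lemma poissonN x : poisson (- x) = poisson x.
Proof. by rewrite /poisson sqrrN. Qed.

Lemma continuous_poisson : continuous poisson.
Proof.
move=> x; apply: cvgM; first exact: cvg_cst.
apply: cvgV; first by rewrite gt_eqF// poisson_den.
by apply: cvgD; [exact: cvg_cst|rewrite expr2; apply: cvgM; exact: cvg_id].
Qed.

Lemma continuous_abel : continuous abel.
Proof.
move=> x; rewrite /abel; apply: continuous_comp; last exact: continuous_expR.
by apply: cvgM; [exact: cvg_cst|exact: norm_continuous].
Qed.

Lemma abel_ge0 r : 0 <= abel r. Proof. exact: expR_ge0. Qed.

Lemma abel_le1 r : abel r <= 1.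
Proof. by rewrite -expR0 ler_expR mulNr oppr_le0 mulr_ge0// ltW. Qed.

Lemma measurable_abel : measurable_fun setT abel.
Proof. by apply: continuous_measurable_fun; exact: continuous_abel. Qed.

Lemma measurable_poisson : measurable_fun setT poisson.
Proof. by apply: continuous_measurable_fun; exact: continuous_poisson. Qed.

Lemma continuous_cosM (x : R) : continuous (fun r : R => cos (x * r)).
Proof. exact: (is_derive_continuous (is_derive_cosl x)). Qed.

(** Adding 1 to the cosine makes the integrand nonnegative, so that the fundamental theorem of
    calculus on a half-line applies; evenness doubles the result. The cosine alone is recovered by
    subtraction afterwards. *)
Lemma integral_abel_1cos (x : R) :
  (\int[mu]_r (abel r * (1 + cos (x * r)))%:E = (2 / e + poisson x)%:E)%E.
Proof.
have pd := poisson_den x.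
have f0 r : 0 <= 1 + cos (x * r) by rewrite -lerBlDl sub0r cos_geN1.
rewrite ge0_symfun_integralT.
(* On r >= 0 a primitive is -exp(-e r)/e plus the real part of exp((i x - e) r)/(i x - e). *)
- pose F : R -> R := (- e^-1) \*: (fun r => expR (- e * r)) +
    (fun r => expR (- e * r)) *
    ((x / (e ^+ 2 + x ^+ 2)) \*: (fun r => sin (x * r)) -
     (e / (e ^+ 2 + x ^+ 2)) \*: (fun r => cos (x * r))).
  have FE r : F r = - expR (- e * r) / e + expR (- e * r) *
    ((x * sin (x * r) - e * cos (x * r)) / (e ^+ 2 + x ^+ 2)).
    rewrite [F r](_ : _ = - e^-1 * expR (- e * r) + expR (- e * r) *
      (x / (e ^+ 2 + x ^+ 2) * sin (x * r) - e / (e ^+ 2 + x ^+ 2) * cos (x * r)))//.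
    by ring.
  pose f r := expR (- e * r) * (1 + cos (x * r)).
  have dF (r : R) : is_derive r 1 F (f r).
    have ? := is_derive_expRl (- e) r.
    have ? := is_derive_cosl x r.
    have ? := is_derive_sinl x r.
    apply: is_derive_eq.
    rewrite /f !fctE /= !scale_regE; field.
    by rewrite !gt_eqF.
  have cf : continuous f.
    move=> r; apply: cvgM.
      exact: (is_derive_continuous (is_derive_expRl (- e))).
    by apply: cvgD; [exact: cvg_cst|exact: continuous_cosM].
  rewrite (_ : [set r | 0 <= r] = `[0, +oo[%classic); last first.
    by apply/seteqP; split => r /=; rewrite in_itv /= andbT.
  have -> : (\int[mu]_(r in `[0%R, +oo[) (abel r * (1 + cos (x * r)))%:E =
      \int[mu]_(r in `[0%R, +oo[) (f r)%:E)%E.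
    apply: eq_integral => r; rewrite inE /= in_itv /= andbT => r0.
    by rewrite /abel ger0_norm.
  rewrite (@ge0_continuous_FTC2y _ f F 0 0).
  + rewrite -EFinB -EFinM; congr EFin.
    rewrite FE !mulr0 expR0 sin0 cos0 /poisson; field.
    by rewrite !gt_eqF.
  + by move=> r _; rewrite mulr_ge0// expR_ge0.
  + by apply: continuous_subspaceT.
  + have -> : F = fun r => expR (- e * r) *
      (- e^-1 + (x * sin (x * r) - e * cos (x * r)) / (e ^+ 2 + x ^+ 2)).
      by apply/funext => r; rewrite FE; ring.
    apply: (@cvg_expRl_bounded _ _ (e^-1 + (`|x| + e) / (e ^+ 2 + x ^+ 2))).
      by rewrite oppr_lt0.
    move=> r; rewrite (le_trans (ler_normD _ _))// lerD//.
      by rewrite normrN ger0_norm// invr_ge0 ltW.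
    rewrite normrM normfV (ger0_norm (ltW pd)) ler_wpM2r ?invr_ge0 ?(ltW pd)//.
    rewrite (le_trans (ler_normB _ _))// lerD// normrM.
      by rewrite ler_piMr// sin_max.
    by rewrite (ger0_norm (ltW e0)) ler_piMr ?(ltW e0)// cos_max.
  + by move=> r _; case: (dF r).
  + apply: cvg_at_right_filter.
    by apply: is_derive_continuous => y; exact: dF.
  + by move=> r _; rewrite derive1E; case: (dF r).
- by move=> r; rewrite mulr_ge0// abel_ge0.
- move=> r; apply: cvgM; first exact: continuous_abel.
  by apply: cvgD; [exact: cvg_cst|exact: continuous_cosM].
- by move=> r /=; rewrite /abel normrN mulrN cosN.
Qed.

(** The case x = 0 of the preceding integral, whose integrand is then twice [abel]. *)
Lemma integral_abel : (\int[mu]_r (abel r)%:E = (2 / e)%:E)%E.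
Proof.
have := integral_abel_1cos 0.
under eq_integral do rewrite mul0r cos0 mulrC EFinM.
rewrite ge0_integralZl_EFin//; last 2 first.
- by move=> r _; rewrite lee_fin abel_ge0.
- by apply/measurable_EFinP; exact: measurable_abel.
have -> : 2 / e + poisson 0 = (1 + 1) * (2 / e).
  by rewrite /poisson; field; rewrite gt_eqF.
rewrite EFinM => /(congr1 (fun z => (2^-1)%:E * z)%E).
rewrite !muleA -!EFinM (_ : 2^-1 * (1 + 1) = 1); last by field.
by rewrite mul1r !mul1e.
Qed.

Lemma integrable_abel : mu.-integrable setT (EFin \o abel).
Proof.
apply/integrableP; split; first by apply/measurable_EFinP; exact: measurable_abel.
under eq_integral do rewrite /= ger0_norm ?abel_ge0//.
by rewrite integral_abel ltry.
Qed.

Lemma integral_abel_cos (x : R) :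
  \int[mu]_r (abel r * cos (x * r)) = poisson x.
Proof.
have i1 : mu.-integrable setT (EFin \o (fun r => abel r * cos (x * r))).
  apply: (le_integrable measurableT _ _ integrable_abel).
    apply/measurable_EFinP/measurable_funM; first exact: measurable_abel.
    by apply: continuous_measurable_fun; exact: continuous_cosM.
  move=> r _; rewrite lee_fin /= normrM ler_piMr// cos_max//.
apply: (@addrI _ (2 / e)).
have <- : \int[mu]_r abel r = 2 / e by rewrite /Rintegral integral_abel.
rewrite -RintegralD//; last exact: integrable_abel.
rewrite [in RHS]/Rintegral integral_abel /= -[RHS]/(fine (2 / e + poisson x)%:E).
rewrite -(integral_abel_1cos x) /Rintegral; congr fine.
by apply: eq_integral => r _; rewrite mulrDr mulr1.
Qed.

Lemma integral_poisson : (\int[mu]_x (poisson x)%:E = (2 * pi)%:E)%E.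
Proof.
rewrite ge0_symfun_integralT.
- rewrite (_ : [set r | 0 <= r] = `[0, +oo[%classic); last first.
    by apply/seteqP; split => r /=; rewrite in_itv /= andbT.
  pose F : R -> R := 2 \*: (atan \o (fun r => e^-1 * r)).
  have dF (r : R) : is_derive r 1 F (poisson r).
    have da : is_derive (e^-1 * r) 1 (@atan R) (1 + (e^-1 * r) ^+ 2)^-1.
      split; first exact: derivable_atan.
      by rewrite -derive1E derive1_atan.
    have dl := is_derive_mull e^-1 r.
    have ? := is_derive1_comp da dl.
    apply: is_derive_eq; rewrite !scale_regE /poisson; field.
    by rewrite !gt_eqF ?poisson_den//= ltr_wpDr ?sqr_ge0// exprn_gt0.
  rewrite (@ge0_continuous_FTC2y _ poisson F 0 pi).
  + by rewrite -EFinB -EFinM /F /= mulr0 atan0 scaler0 subr0.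
  + by move=> r _; exact: poisson_ge0.
  + by apply: continuous_subspaceT; exact: continuous_poisson.
  + have -> : pi = 2 * (pi / 2) :> R by field.
    apply: cvgM; first exact: cvg_cst.
    apply: (@cvg_comp _ _ _ (fun r => e^-1 * r)); last exact: cvgy_atan.
    by apply: gt0_cvgMry => //; rewrite invr_gt0.
  + by move=> r _; case: (dF r).
  + apply: cvg_at_right_filter.
    by apply: is_derive_continuous => y; exact: dF.
  + by move=> r _; rewrite derive1E; case: (dF r).
- exact: poisson_ge0.
- exact: continuous_poisson.
- by move=> x /=; rewrite poissonN.
Qed.

Lemma integral_poisson_shift (a : R) : (\int[mu]_x (poisson (a - x))%:E = (2 * pi)%:E)%E.
Proof.
rewrite -integral_poisson.
have := @ge0_integral_shift R (- a) (fun x => (poisson x)%:E).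
move=> <-; last 2 first.
- by apply/measurable_EFinP; exact: measurable_poisson.
- by move=> x; rewrite lee_fin poisson_ge0.
by apply: eq_integral => x _; rewrite -poissonN opprB.
Qed.

Lemma poisson_le x : poisson x <= 2 / e.
Proof.
rewrite /poisson ler_pdivrMr ?poisson_den// mulrDr.
have -> : 2 / e * e ^+ 2 = 2 * e by field; rewrite gt_eqF.
by rewrite lerDl mulr_ge0 ?sqr_ge0// divr_ge0// ltW.
Qed.

End fixed_eps.

(** Away from 0, the kernel at scale e is at most a multiple, linear in e, of the kernel at scale 1,
    because 1/x^2 and 1/(1 + x^2) are comparable for |x| >= d. The latter kernel has mass 2 pi, so
    the tails vanish with e. *)
Lemma poisson_tail (e d x : R) : 0 < e -> 0 < d -> d <= `|x| ->
  poisson e x <= e * ((1 + d ^+ 2) / d ^+ 2) * poisson 1 x.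
Proof.
move=> e0 d0 dx.
have dx2 : d ^+ 2 <= x ^+ 2.
  by rewrite -[x ^+ 2]ger0_norm ?sqr_ge0// normrX lerXn2r// nnegrE ?(ltW d0).
have d2 : 0 < d ^+ 2 by rewrite exprn_gt0.
have x2 : 0 < x ^+ 2 by exact: lt_le_trans dx2.
have p1 : 0 < 1 + x ^+ 2 by rewrite addr_gt0.
have pe : 0 < e ^+ 2 + x ^+ 2 by rewrite addr_gt0// exprn_gt0.
rewrite /poisson ler_pdivrMr//.
have -> : e * ((1 + d ^+ 2) / d ^+ 2) * (2 * 1 / (1 ^+ 2 + x ^+ 2)) * (e ^+ 2 + x ^+ 2) =
  2 * e * (((1 + d ^+ 2) * (e ^+ 2 + x ^+ 2)) / (d ^+ 2 * (1 + x ^+ 2))).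
  by field; rewrite !gt_eqF.
rewrite ler_peMr ?mulr_ge0 ?(ltW e0)// ler_pdivlMr ?mulr_gt0// mul1r.
have := sqr_ge0 e; nra.
Qed.

End poisson_kernel.

(** * Vanishing of the Poisson energy *)

Section energy.
Context (R : realType) (H : normedModType R) (a : nat -> H) (da : dense_seq a).
Local Notation mu := (@lebesgue_measure R).
Local Notation T := (measurableTypeR R).
Local Notation mu2 := (mu \x mu)%E.
Implicit Types w f g : R -> H.

(* Up to a constant, the error made when the Abel mean of |FT w|^2 at scale e
   is replaced by the squared L2 norm of w. *)
Definition energy (e : R) w : \bar R :=
  (\int[mu2]_z (`|w z.1 - w z.2| ^+ 2 * poisson e (z.1 - z.2))%:E)%E.

Lemma borel_fst2 w : borel_measurable (setT : set T) w ->
  borel_measurable (setT : set (T * T)) (fun z => w z.1).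
Proof. by move=> mw; exact: (measurableT_comp mw measurable_fst). Qed.

Lemma borel_snd2 w : borel_measurable (setT : set T) w ->
  borel_measurable (setT : set (T * T)) (fun z => w z.2).
Proof. by move=> mw; exact: (measurableT_comp mw measurable_snd). Qed.

Lemma measurable_diff2 : measurable_fun (setT : set (T * T)) (fun z => z.1 - z.2 : R).
Proof. exact: measurable_funB measurable_fst measurable_snd. Qed.

Context (e : R) (e0 : 0 < e).

Lemma measurable_poisson2 :
  measurable_fun (setT : set (T * T)) (fun z => poisson e (z.1 - z.2)).
Proof. exact: (measurableT_comp (measurable_poisson e0) measurable_diff2). Qed.

Lemma measurable_energy w : borel_measurable (setT : set T) w ->
  measurable_fun (setT : set (T * T))
    (fun z => (`|w z.1 - w z.2| ^+ 2 * poisson e (z.1 - z.2))%:E).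
Proof.
move=> mw; apply/measurable_EFinP/measurable_funM; last exact: measurable_poisson2.
apply/measurable_funX/borel_norm => //.
by apply: (borel_sub measurableT da); [exact: borel_fst2|exact: borel_snd2].
Qed.

Lemma energy_ge0 w : (0 <= energy e w)%E.
Proof.
by apply: integral_ge0 => z _; rewrite lee_fin mulr_ge0 ?sqr_ge0 ?poisson_ge0.
Qed.

Lemma energyD f g : borel_measurable (setT : set T) f ->
  borel_measurable (setT : set T) g ->
  (energy e (fun x => (f x + g x)%R) <= 2%:E * energy e f + 2%:E * energy e g)%E.
Proof.
move=> mf mg; rewrite /energy.
have p0 (z : T * T) : 0 <= poisson e (z.1 - z.2) by exact: poisson_ge0.
have mf' := measurable_energy mf; have mg' := measurable_energy mg.
pose F (w : R -> H) (z : T * T) := (`|w z.1 - w z.2| ^+ 2 * poisson e (z.1 - z.2))%:E.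
have F0 w z : (0 <= F w z)%E by rewrite lee_fin mulr_ge0 ?sqr_ge0.
have F20 w z : (0 <= 2%:E * F w z)%E by rewrite mule_ge0.
have m2 w : measurable_fun setT (F w) -> measurable_fun setT (fun z => 2%:E * F w z)%E.
  by move=> ?; apply: emeasurable_funM.
rewrite -[X in (_ <= 2%:E * X + _)%E]/(\int[mu2]_z F f z)%E.
rewrite -[X in (_ <= _ + 2%:E * X)%E]/(\int[mu2]_z F g z)%E.
rewrite -!ge0_integralZl_EFin//.
rewrite -ge0_integralD//; [|exact: m2..].
apply: ge0_le_integral => //.
- by move=> z _; rewrite lee_fin mulr_ge0 ?sqr_ge0.
- by apply: (@measurable_energy (fun x => f x + g x)); exact: (borel_add da).
- by apply: emeasurable_funD; exact: m2.
- move=> z _; rewrite /F -!EFinM -EFinD lee_fin.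
  rewrite [leRHS](_ : _ = (2 * `|f z.1 - f z.2| ^+ 2 + 2 * `|g z.1 - g z.2| ^+ 2) *
    poisson e (z.1 - z.2)); last by ring.
  rewrite ler_wpM2r// opprD addrACA.
  apply: (@le_trans _ _ ((`|f z.1 - f z.2| + `|g z.1 - g z.2|) ^+ 2)).
    by rewrite lerXn2r ?nnegrE ?addr_ge0// ler_normD.
  rewrite -subr_ge0.
  set x := `|f _ - _|; set y := `|g _ - _|.
  have -> : 2 * x ^+ 2 + 2 * y ^+ 2 - (x + y) ^+ 2 = (x - y) ^+ 2 by ring.
  exact: sqr_ge0.
Qed.

Lemma integral_poisson_fst (h : R -> R) : measurable_fun setT h ->
  (forall x, 0 <= h x) ->
  (\int[mu2]_z (h z.1 * poisson e (z.1 - z.2))%:E =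
   (2 * pi)%:E * \int[mu]_x (h x)%:E)%E.
Proof.
move=> mh h0.
rewrite fubini_tonelli1; last 2 first.
- apply/measurable_EFinP/measurable_funM; last exact: measurable_poisson2.
  exact: measurableT_comp mh measurable_fst.
- by move=> z; rewrite lee_fin mulr_ge0 ?poisson_ge0.
rewrite -ge0_integralZl_EFin//; last 3 first.
- by move=> x _; rewrite lee_fin.
- exact/measurable_EFinP.
- by rewrite mulr_ge0 ?pi_ge0.
apply: eq_integral => x _; rewrite /fubini_F /=.
under eq_integral do rewrite EFinM.
rewrite ge0_integralZl_EFin//; last 2 first.
- by move=> y _; rewrite lee_fin poisson_ge0.
- apply/measurable_EFinP; apply: measurableT_comp (measurable_poisson e0) _.
  exact: measurable_funB.
by rewrite integral_poisson_shift// muleC.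
Qed.

Lemma integral_poisson_snd (h : R -> R) : measurable_fun setT h ->
  (forall x, 0 <= h x) ->
  (\int[mu2]_z (h z.2 * poisson e (z.1 - z.2))%:E =
   (2 * pi)%:E * \int[mu]_x (h x)%:E)%E.
Proof.
move=> mh h0.
rewrite fubini_tonelli2; last 2 first.
- apply/measurable_EFinP/measurable_funM; last exact: measurable_poisson2.
  exact: measurableT_comp mh measurable_snd.
- by move=> z; rewrite lee_fin mulr_ge0 ?poisson_ge0.
rewrite -ge0_integralZl_EFin//; last 3 first.
- by move=> x _; rewrite lee_fin.
- exact/measurable_EFinP.
- by rewrite mulr_ge0 ?pi_ge0.
apply: eq_integral => x _; rewrite /fubini_G /=.
under eq_integral => y do rewrite EFinM -[y - x]opprB poissonN.
rewrite ge0_integralZl_EFin//; last 2 first.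
- by move=> y _; rewrite lee_fin poisson_ge0.
- apply/measurable_EFinP; apply: measurableT_comp (measurable_poisson e0) _.
  exact: measurable_funB.
by rewrite integral_poisson_shift// muleC.
Qed.

(** From |x - y|^2 <= 2 |x|^2 + 2 |y|^2, each variable contributes twice the mass 2 pi. The bound is
    uniform in e, which lets vanishing energy pass to L2 limits. *)
Lemma energy_le w : borel_measurable (setT : set T) w ->
  (energy e w <= (8 * pi)%:E * sqint mu w)%E.
Proof.
move=> mw.
have p0 (z : T * T) : 0 <= poisson e (z.1 - z.2) by exact: poisson_ge0.
have mh : measurable_fun setT (fun x => 2 * `|w x| ^+ 2).
  by apply: measurable_funM => //; apply/measurable_funX/borel_norm.
have h0 x : 0 <= 2 * `|w x| ^+ 2 by rewrite mulr_ge0.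
have hE : (\int[mu]_x (2 * `|w x| ^+ 2)%:E = 2%:E * sqint mu w)%E.
  under eq_integral do rewrite EFinM.
  by rewrite ge0_integralZl_EFin//; exact: sq_measurable.
have -> : ((8 * pi)%:E * sqint mu w = (2 * pi)%:E * (2%:E * sqint mu w) +
    (2 * pi)%:E * (2%:E * sqint mu w))%E.
  rewrite !muleA -!EFinM -ge0_muleDl ?lee_fin ?mulr_ge0 ?pi_ge0// -EFinD.
  by congr (_%:E * _)%E; ring.
rewrite -hE -{1}(integral_poisson_fst mh h0) -(integral_poisson_snd mh h0).
have m1 : measurable_fun (setT : set (T * T)) (fun z => (2 * `|w z.1| ^+ 2 * poisson e (z.1 - z.2))%:E).
  apply/measurable_EFinP/measurable_funM; last exact: measurable_poisson2.
  exact: measurableT_comp mh measurable_fst.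
have m2 : measurable_fun (setT : set (T * T)) (fun z => (2 * `|w z.2| ^+ 2 * poisson e (z.1 - z.2))%:E).
  apply/measurable_EFinP/measurable_funM; last exact: measurable_poisson2.
  exact: measurableT_comp mh measurable_snd.
rewrite -ge0_integralD//; [|by move=> z _; rewrite lee_fin mulr_ge0..].
apply: ge0_le_integral => //.
- by move=> z _; rewrite lee_fin mulr_ge0 ?sqr_ge0.
- exact: measurable_energy.
- exact: emeasurable_funD.
- move=> z _; rewrite -EFinD lee_fin -mulrDl ler_wpM2r//.
  apply: (@le_trans _ _ ((`|w z.1| + `|w z.2|) ^+ 2)).
    by rewrite lerXn2r ?nnegrE ?addr_ge0// ler_normB.
  rewrite -subr_ge0.
  set x := `|w _|; set y := `|w _|.
  have -> : 2 * x ^+ 2 + 2 * y ^+ 2 - (x + y) ^+ 2 = (x - y) ^+ 2 by ring.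
  exact: sqr_ge0.
Qed.

(** The part of the mass 2 pi of the kernel centred at [s] that falls outside [U]. *)
Definition leak (U : set R) (s : R) : \bar R :=
  (\int[mu]_t (\1_(~` U) t * poisson e (s - t))%:E)%E.

Lemma leak_ge0 U s : (0 <= leak U s)%E.
Proof. by apply: integral_ge0 => t _; rewrite lee_fin mulr_ge0 ?poisson_ge0. Qed.

Lemma leak_le U s : measurable U -> (leak U s <= (2 * pi)%:E)%E.
Proof.
move=> mU; rewrite -(integral_poisson_shift e0 s).
have mp : measurable_fun setT (fun t : R => poisson e (s - t)).
  by apply: measurableT_comp (measurable_poisson e0) _; exact: measurable_funB.
apply: ge0_le_integral => //.
- by move=> t _; rewrite lee_fin mulr_ge0 ?poisson_ge0.
- apply/measurable_EFinP/measurable_funM => //.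
  by apply: measurable_indic; exact: measurableC.
- exact/measurable_EFinP.
- move=> t _; rewrite lee_fin ler_piMl ?poisson_ge0// indicE.
Qed.

Lemma leak_near (U : set R) (s d : R) : measurable U -> 0 < d -> ball s d `<=` U ->
  (leak U s <= (e * ((1 + d ^+ 2) / d ^+ 2 * (2 * pi)))%:E)%E.
Proof.
move=> mU d0 sU.
set K := (1 + d ^+ 2) / d ^+ 2.
have K0 : 0 <= K by rewrite divr_ge0 ?addr_ge0 ?sqr_ge0.
have mp e' : 0 < e' -> measurable_fun setT (fun t : R => poisson e' (s - t)).
  move=> e'0; apply: measurableT_comp (measurable_poisson e'0) _.
  exact: measurable_funB.
have -> : ((e * (K * (2 * pi)))%:E = \int[mu]_t (e * K * poisson 1 (s - t))%:E)%E.
  under eq_integral do rewrite EFinM.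
  rewrite ge0_integralZl_EFin//; last 3 first.
  - by move=> t _; rewrite lee_fin poisson_ge0.
  - by apply/measurable_EFinP; exact: mp.
  - by rewrite mulr_ge0// ltW.
  by rewrite integral_poisson_shift// mulrA EFinM.
apply: ge0_le_integral => //.
- by move=> t _; rewrite lee_fin mulr_ge0 ?poisson_ge0.
- apply/measurable_EFinP/measurable_funM; last exact: mp.
  by apply: measurable_indic; exact: measurableC.
- by apply/measurable_EFinP/measurable_funM => //; exact: mp.
- move=> t _; rewrite lee_fin indicE; have [|_] := boolP (t \in ~` U).
    rewrite inE => tU; rewrite mul1r; apply: poisson_tail => //.
    rewrite leNgt; apply/negP => st; apply: tU; apply: sU.
    by rewrite -ball_normE.
  by rewrite mul0r mulr_ge0 ?poisson_ge0// mulr_ge0// ltW.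
Qed.

Lemma measurable_leak U : measurable U -> measurable_fun setT (leak U).
Proof.
move=> mU; apply: (measurable_fun_fubini_tonelli_F (m2 := mu)
  (fun z : T * T => (\1_(~` U) z.2 * poisson e (z.1 - z.2))%:E)).
  apply/measurable_EFinP/measurable_funM; last exact: measurable_poisson2.
  apply: measurableT_comp measurable_snd.
  by apply: measurable_indic; exact: measurableC.
by move=> z; rewrite lee_fin mulr_ge0 ?poisson_ge0.
Qed.

(** The squared difference of indicators is 1 exactly when one of the two points is in [U] and the
    other is not. Both cases contribute the same because the kernel is even, hence the factor 2. *)
Lemma energy_indic U (c : H) : measurable U ->
  energy e (fun s => \1_U s *: c) =
  ((2 * `|c| ^+ 2)%:E * \int[mu]_s ((\1_U s)%:E * leak U s))%E.
Proof.
move=> mU.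
have mi (V : set T) : measurable V -> measurable_fun setT (\1_V : T -> R).
  by move=> ?; exact: measurable_indic.
have mC : measurable (~` U) by exact: measurableC.
pose F1 (z : T * T) := (\1_U z.1 * (\1_(~` U) z.2 * poisson e (z.1 - z.2)))%:E.
pose F2 (z : T * T) := (\1_U z.2 * (\1_(~` U) z.1 * poisson e (z.1 - z.2)))%:E.
have mF1 : measurable_fun setT F1.
  apply/measurable_EFinP/measurable_funM.
    exact: measurableT_comp (mi _ mU) measurable_fst.
  apply: measurable_funM; last exact: measurable_poisson2.
  exact: measurableT_comp (mi _ mC) measurable_snd.
have mF2 : measurable_fun setT F2.
  apply/measurable_EFinP/measurable_funM.
    exact: measurableT_comp (mi _ mU) measurable_snd.
  apply: measurable_funM; last exact: measurable_poisson2.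
  exact: measurableT_comp (mi _ mC) measurable_fst.
have F10 z : (0 <= F1 z)%E by rewrite lee_fin mulr_ge0// mulr_ge0 ?poisson_ge0.
have F20 z : (0 <= F2 z)%E by rewrite lee_fin mulr_ge0// mulr_ge0 ?poisson_ge0.
have I1 : (\int[mu2]_z F1 z = \int[mu]_s ((\1_U s)%:E * leak U s))%E.
  rewrite fubini_tonelli1//; apply: eq_integral => s _; rewrite /fubini_F /F1 /=.
  under eq_integral do rewrite EFinM.
  rewrite ge0_integralZl_EFin//.
  - by move=> t _; rewrite lee_fin mulr_ge0 ?poisson_ge0.
  - apply/measurable_EFinP/measurable_funM; first exact: mi.
    apply: measurableT_comp (measurable_poisson e0) _; exact: measurable_funB.
have I2 : (\int[mu2]_z F2 z = \int[mu]_s ((\1_U s)%:E * leak U s))%E.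
  rewrite fubini_tonelli2//; apply: eq_integral => s _; rewrite /fubini_G /F2 /=.
  under eq_integral => t do rewrite EFinM -[t - s]opprB poissonN.
  rewrite ge0_integralZl_EFin//.
  - by move=> t _; rewrite lee_fin mulr_ge0 ?poisson_ge0.
  - apply/measurable_EFinP/measurable_funM; first exact: mi.
    apply: measurableT_comp (measurable_poisson e0) _; exact: measurable_funB.
have -> : (energy e (fun s => \1_U s *: c) = \int[mu2]_z ((`|c| ^+ 2)%:E * (F1 z + F2 z)))%E.
  apply: eq_integral => z _; rewrite -scalerBl normrZ exprMn.
  rewrite /F1 /F2 -EFinD -EFinM; congr EFin.
  have -> : `|(\1_U z.1 : R) - \1_U z.2| ^+ 2 =
      \1_U z.1 * \1_(~` U) z.2 + \1_U z.2 * \1_(~` U) z.1.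
    rewrite -normrX ger0_norm ?sqr_ge0// !indicE !in_setC.
    by case: (z.1 \in U); case: (z.2 \in U) => /=; ring.
  by ring.
rewrite ge0_integralZl_EFin//; last 2 first.
- by move=> z _; rewrite adde_ge0.
- exact: emeasurable_funD.
rewrite ge0_integralD// I1 I2.
have X0 : (0 <= \int[mu]_s ((\1_U s)%:E * leak U s))%E.
  by apply: integral_ge0 => s _; rewrite mule_ge0 ?lee_fin ?leak_ge0.
rewrite (_ : 2 * _ = `|c| ^+ 2 + `|c| ^+ 2); last by ring.
by rewrite EFinD ge0_muleDl ?lee_fin// ge0_muleDr.
Qed.

End energy.

Section vanishing.
Context (R : realType) (H : normedModType R) (a : nat -> H) (da : dense_seq a).
Local Notation mu := (@lebesgue_measure R).
Local Notation T := (measurableTypeR R).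
Implicit Types w f g : R -> H.

(** The scale runs through 1/(n+1), a sequence, to fit dominated convergence. *)
Definition vanishing w : Prop := forall eta : R, 0 < eta -> exists N,
  forall n, (N <= n)%N -> (energy n.+1%:R^-1 w <= eta%:E)%E.

Lemma natSinv_gt0 n : 0 < n.+1%:R^-1 :> R. Proof. by rewrite invr_gt0. Qed.

Lemma natSinvM_le (K eta : R) : 0 <= K -> 0 < eta ->
  exists N, forall n, (N <= n)%N -> n.+1%:R^-1 * K <= eta.
Proof.
move=> K0 eta0.
have h : 0 < eta / (K + 1) by rewrite divr_gt0// ltr_wpDl.
have [N _ HN] := near_infty_natSinv_lt (PosNum h).
exists N => n /HN /= /ltW; rewrite ler_pdivlMr ?ltr_wpDl//; apply: le_trans.
by rewrite ler_wpM2l ?ler_wpDr// ltW// natSinv_gt0.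
Qed.

Lemma vanishing_add f g : borel_measurable (setT : set T) f ->
  borel_measurable (setT : set T) g ->
  vanishing f -> vanishing g -> vanishing (fun x => f x + g x).
Proof.
move=> mf mg vf vg eta eta0.
have eta4 : 0 < eta / 4 by rewrite divr_gt0.
have [N1 h1] := vf _ eta4; have [N2 h2] := vg _ eta4.
exists (maxn N1 N2) => n; rewrite geq_max => /andP[/h1 {}h1 /h2 {}h2].
apply: (le_trans (energyD da (natSinv_gt0 n) mf mg)).
apply: (@le_trans _ _ (2%:E * (eta / 4)%:E + 2%:E * (eta / 4)%:E)%E).
  by rewrite leeD// lee_wpmul2l.
by rewrite -!EFinM -EFinD lee_fin; lra.
Qed.

(** As [energy_le] is uniform in the scale, the functions of vanishing energy are closed under L2
    approximation. Each of the two energies is granted eta/4, the sum being counted with factors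
    2. *)
Lemma vanishing_approx f : borel_measurable (setT : set T) f ->
  (forall eta : R, 0 < eta -> exists g, [/\ borel_measurable (setT : set T) g,
    vanishing g & (sqint mu (fun x => (f x - g x)%R) <= eta%:E)%E]) ->
  vanishing f.
Proof.
move=> mf h eta eta0.
have pi8 : 0 < 8 * pi :> R by rewrite mulr_gt0 ?pi_gt0.
have eta8 : 0 < eta / 4 / (8 * pi) by rewrite !divr_gt0.
have [g [mg vg fg]] := h _ eta8.
have eta4 : 0 < eta / 4 by rewrite divr_gt0.
have [N hN] := vg _ eta4; exists N => n /hN {}hN.
have mfg := borelB da mf mg.
have -> : f = (fun x => (f x - g x) + g x) by apply/funext => x; rewrite subrK.
apply: (le_trans (energyD da (natSinv_gt0 n) mfg mg)).
apply: (@le_trans _ _ (2%:E * (eta / 4)%:E + 2%:E * (eta / 4)%:E)%E).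
  rewrite leeD// lee_wpmul2l//.
  apply: (le_trans (energy_le da (natSinv_gt0 n) mfg)).
  apply: (@le_trans _ _ ((8 * pi)%:E * (eta / 4 / (8 * pi))%:E)%E).
    by rewrite lee_wpmul2l// lee_fin ltW.
  by rewrite -EFinM lee_fin mulrC divfK// gt_eqF.
by rewrite -!EFinM -EFinD lee_fin; lra.
Qed.

Lemma borel_indicZ (U : set R) (c : H) : measurable U ->
  borel_measurable (setT : set T) (fun s => \1_U s *: c).
Proof.
move=> mU; apply: (borel_scale da) => //; exact: borel_cst.
Qed.

(** A point of an open set has a ball inside it, so the leak at that point is O(e). The bound 2 pi
    on a set of finite measure then gives dominated convergence. *)
Lemma vanishing_open (U : set R) (c : H) : open U -> (mu U < +oo)%E ->
  vanishing (fun s => \1_U s *: c).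
Proof.
move=> oU Uoo; have mU : measurable U by exact: open_measurable.
pose f n (s : T) := ((\1_U s)%:E * leak n.+1%:R^-1 U s)%E.
have f0 n s : (0 <= f n s)%E by rewrite mule_ge0 ?lee_fin// leak_ge0// natSinv_gt0.
have mf n : measurable_fun setT (f n).
  apply: emeasurable_funM; last by apply: measurable_leak => //; exact: natSinv_gt0.
  by apply/measurable_EFinP; exact: measurable_indic.
have [||||_ _] := @dominated_convergence _ _ _ mu setT measurableT f (cst 0%E)
    (fun s => (2 * pi)%:E * (\1_U s)%:E)%E mf.
- exact: measurable_cst.
- apply: aeW => s _; apply/cvge0P; first by move=> n; exact: f0.
  move=> eta eta0; rewrite /f indicE; have [|sU] := boolP (s \in U); last first.
    by apply: nearW => n; rewrite mul0e lee_fin ltW.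
  rewrite inE => sU.
  have /nbhs_ballP[d /= d0 dU] : nbhs s U by exact: open_nbhs_nbhs.
  have K0 : 0 <= (1 + d ^+ 2) / d ^+ 2 * (2 * pi).
    by rewrite mulr_ge0 ?divr_ge0 ?addr_ge0 ?sqr_ge0// mulr_ge0 ?pi_ge0.
  have [N hN] := natSinvM_le K0 eta0.
  exists N => // n /= Nn; rewrite mul1e.
  apply: (le_trans (leak_near (natSinv_gt0 n) mU d0 dU)).
  by rewrite lee_fin hN.
- apply: integrableZl => //; apply/integrableP; split.
    by apply/measurable_EFinP; exact: measurable_indic.
  under eq_integral do rewrite gee0_abs ?lee_fin//.
  by rewrite integral_indic// setIT.
- apply: aeW => s n _; rewrite gee0_abs// /f muleC lee_wpmul2r ?lee_fin//.
  by apply: leak_le => //; exact: natSinv_gt0.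
rewrite integral0 => cv eta eta0.
have c0 : 0 <= 2 * `|c| ^+ 2 by rewrite mulr_ge0.
have eta' : 0 < eta / (2 * `|c| ^+ 2 + 1) by rewrite divr_gt0// ltr_wpDl.
have [|N _ hN] := (cvge0P _ _).1 cv _ eta'.
  by move=> n; apply: integral_ge0.
exists N => n /hN /= {}hN; rewrite energy_indic ?natSinv_gt0//.
apply: (@le_trans _ _ ((2 * `|c| ^+ 2)%:E * (eta / (2 * `|c| ^+ 2 + 1))%:E)%E).
  by rewrite lee_wpmul2l.
rewrite -EFinM lee_fin mulrCA ler_piMr ?(ltW eta0)//.
by rewrite ler_pdivrMr ?ltr_wpDl// mul1r lerDl.
Qed.

Lemma sqint_indic (U : set R) (c : H) : measurable U ->
  sqint mu (fun s : R => \1_U s *: c) = ((`|c| ^+ 2)%:E * mu U)%E.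
Proof.
move=> mU; rewrite -[U in RHS]setIT -integral_indic//.
rewrite -ge0_integralZl_EFin//; last first.
  by apply/measurable_EFinP; exact: measurable_indic.
apply: eq_integral => s _; rewrite normrZ exprMn mulrC -EFinM; congr (_ * _)%:E.
by rewrite indicE; case: (_ \in _); rewrite ?normr1 ?normr0 ?expr1n ?expr0n.
Qed.

(** Outer regularity of Lebesgue measure makes the indicator an L2 limit of indicators of open
    sets. *)
Lemma vanishing_indic (U : set R) (c : H) : measurable U -> (mu U < +oo)%E ->
  vanishing (fun s => \1_U s *: c).
Proof.
move=> mU Uoo; apply: vanishing_approx; first exact: borel_indicZ.
move=> eta eta0.
have eta' : 0 < eta / (`|c| ^+ 2 + 1) by rewrite divr_gt0// ltr_wpDl.
have [V [oV UV VU]] := lebesgue_regularity_outer mU Uoo eta'.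
have mV : measurable V by exact: open_measurable.
have mVU : measurable (V `\` U) by exact: measurableD.
exists (fun s => \1_V s *: c); split; first exact: borel_indicZ.
  apply: vanishing_open => //.
  rewrite -(setDUK UV) (le_lt_trans (measureU2 _ _ _))//.
  by rewrite lte_add_pinfty// (lt_trans VU)// ltry.
rewrite sqint_subC.
rewrite (_ : (fun _ => _) = (fun s : R => \1_(V `\` U) s *: c)); last first.
  apply/funext => s; rewrite -scalerBl; congr (_ *: _).
  rewrite !indicE in_setD; have [sU|sU] := boolP (s \in U).
    by rewrite mem_set ?subrr// ; apply: UV; rewrite inE in sU.
  by rewrite subr0 andbT.
rewrite sqint_indic//.
apply: (@le_trans _ _ ((`|c| ^+ 2)%:E * (eta / (`|c| ^+ 2 + 1))%:E)%E).
  by rewrite lee_wpmul2l// ltW.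
rewrite -EFinM lee_fin mulrCA ler_piMr ?(ltW eta0)//.
by rewrite ler_pdivrMr ?ltr_wpDl// mul1r lerDl.
Qed.

Lemma vanishing_simple (s : R -> H) : simple_on mu (setT : set T) s -> vanishing s.
Proof.
move=> [fs ms fms].
set r := finmap.enum_fset (fset_set (s @` setT)).
pose S (l : seq H) x := \sum_(c <- l) \1_(s @^-1` [set c]) x *: c.
have sE : s = S r.
  apply/funext => x; rewrite /S.
  have xr : s x \in r by rewrite /r in_fset_set// inE; exists x.
  rewrite (bigD1_seq _ xr) ?finmap.fset_uniq//= indicE mem_set// scale1r.
  rewrite big1 ?addr0// => c cx.
  rewrite indicE memNset ?scale0r// => /= xc.
  by move: cx; rewrite xc eqxx.
have mS c : measurable (s @^-1` [set c]) by have := ms c; rewrite setTI.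
have [mSl vSl] : borel_measurable (setT : set T) (S r) /\ vanishing (S r).
  elim: r {sE} => [|c l [ihm ihv]].
    have -> : S [::] = cst 0 by apply/funext => x; rewrite /S big_nil.
    split; first exact: borel_cst.
    move=> eta eta0; exists 0%N => n _; rewrite /energy.
    under eq_integral do rewrite /cst subrr normr0 expr0n mul0r.
    by rewrite integral0 lee_fin ltW.
  have -> : S (c :: l) = (fun x => \1_(s @^-1` [set c]) x *: c + S l x).
    by apply/funext => x; rewrite /S big_cons.
  have mi := borel_indicZ c (mS c).
  split; first exact: (borel_add da).
  apply: vanishing_add => //.
  (* Only the level set of 0 may have infinite measure, and its term is the zero function. *)
  have [->|c0] := eqVneq c 0.
    have -> : (fun x => \1_(s @^-1` [set 0]) x *: (0 : H)) = cst 0.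
      by apply/funext => x; rewrite scaler0.
    move=> eta eta0; exists 0%N => n _; rewrite /energy.
    under eq_integral do rewrite /cst subrr normr0 expr0n mul0r.
    by rewrite integral0 lee_fin ltW.
  by apply: vanishing_indic => //; have := fms c c0; rewrite setTI.
by rewrite sE.
Qed.

(** The approximants [nearest] converge to [w] in L2, with error dominated by |w|. Integrability of
    |w| gives their nonzero levels finite measure. *)
Lemma vanishing_L2 w : borel_measurable (setT : set T) w ->
  mu.-integrable setT (fun x => `|w x|%:E) -> (sqint mu w < +oo)%E ->
  vanishing w.
Proof.
move=> mw iw qw; apply: vanishing_approx => //.
have mn n : borel_measurable (setT : set T) (nearest w a n).
  by apply: (@simple_borel _ _ _ _ mu); apply: nearest_simple.
have iw2 : mu.-integrable setT (fun x => (`|w x| ^+ 2)%:E).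
  apply/integrableP; split; first exact: sq_measurable.
  by under eq_integral do rewrite gee0_abs ?lee_fin ?sqr_ge0//.
have [||||_ _] := @dominated_convergence _ _ _ mu setT measurableT
    (fun n x => (`|w x - nearest w a n x| ^+ 2)%:E) (cst 0%E) _ _ _ _ iw2.
- by move=> n; apply: sq_measurable; exact: (borelB da).
- exact: measurable_cst.
- apply: aeW => x _; apply/cvg_EFin; first exact: nearW.
  rewrite -(mul0r 0); under eq_fun do rewrite expr2.
  by apply: cvgM; exact: nearest_cvg.
- by apply: aeW => x n _ /=; rewrite ger0_norm ?sqr_ge0// lee_fin lerXn2r ?nnegrE// nearest_le.
rewrite integral0 => cv eta eta0.
have [|N _ hN] := (cvge0P _ _).1 cv _ eta0.
  by move=> n; apply: integral_ge0 => x _; rewrite lee_fin sqr_ge0.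
exists (nearest w a N); split => //.
  by apply: vanishing_simple; exact: nearest_simple.
exact: (hN N (leqnn N)).
Qed.

End vanishing.

(** * The Fourier integral of an integrable function *)

Section inner_product.
Context (R : realType) (H : normedModType R).

(** The working form of the real inner product, detached from the sesquilinear structure of the
    statement and its conjugation [idfun]. *)
Record is_ip (dot : H -> H -> R) : Prop := IsIp {
  ip_lin : forall a x y z, dot (a *: x + y) z = a * dot x z + dot y z ;
  ip_sym : forall x y, dot x y = dot y x ;
  ip_norm : forall x, dot x x = `|x| ^+ 2 }.

Context (dot : H -> H -> R) (hd : is_ip dot).

Lemma ipDl x y z : dot (x + y) z = dot x z + dot y z.
Proof. by rewrite -[x]scale1r (ip_lin hd) mul1r scale1r. Qed.

Lemma ip0l z : dot 0 z = 0.
Proof. by have := ipDl 0 0 z; rewrite addr0; lra. Qed.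

Lemma ipZl a x z : dot (a *: x) z = a * dot x z.
Proof. by rewrite -[a *: x]addr0 (ip_lin hd) ip0l addr0. Qed.

Lemma ipZr a x z : dot x (a *: z) = a * dot x z.
Proof. by rewrite (ip_sym hd) ipZl (ip_sym hd). Qed.

Lemma ipDr x y z : dot z (x + y) = dot z x + dot z y.
Proof. by rewrite (ip_sym hd) ipDl !(ip_sym hd z). Qed.

Lemma ip0r z : dot z 0 = 0.
Proof. by rewrite (ip_sym hd) ip0l. Qed.

Lemma ipNl x z : dot (- x) z = - dot x z.
Proof. by rewrite -scaleN1r ipZl mulN1r. Qed.

Lemma ipBl x y z : dot (x - y) z = dot x z - dot y z.
Proof. by rewrite ipDl ipNl. Qed.

Lemma ipBr x y z : dot z (x - y) = dot z x - dot z y.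
Proof. by rewrite (ip_sym hd) ipBl !(ip_sym hd z). Qed.

Lemma ip_polarization x y : dot x y = (`|x + y| ^+ 2 - `|x - y| ^+ 2) / 4.
Proof.
rewrite -!(ip_norm hd) !ipDl ipNl !ipDr !(ip_sym hd _ (- y)) !ipNl.
by rewrite (ip_sym hd y x); field.
Qed.

Lemma ip_cs x y : `|dot x y| <= `|x| * `|y|.
Proof.
have [->|y0] := eqVneq y 0; first by rewrite ip0r normr0 mulr_ge0.
have ny : 0 < `|y| by rewrite normr_gt0.
pose v := (`|y| ^+ 2) *: x - dot x y *: y.
have := sqr_ge0 `|v|.
rewrite -(ip_norm hd v) /v ipBl !ipBr !ipZl !ipZr !(ip_norm hd) (ip_sym hd y x).
rewrite [X in 0 <= X](_ : _ = `|y| ^+ 2 * ((`|x| * `|y|) ^+ 2 - `|dot x y| ^+ 2)); last first.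
  by rewrite -[`|dot x y| ^+ 2]normrX ger0_norm ?sqr_ge0//; ring.
rewrite pmulr_rge0 ?exprn_gt0// subr_ge0.
by rewrite ler_pXn2r ?nnegrE ?mulr_ge0.
Qed.

Lemma ip_ext x y : (forall c, dot x c = dot y c) -> x = y.
Proof.
move=> h; apply/eqP; rewrite -subr_eq0 -normr_eq0 -sqrf_eq0 -(ip_norm hd).
by rewrite ipBl h subrr.
Qed.

Lemma ip_pairing : is_pairing dot 1.
Proof.
split; first exact: (ip_lin hd).
- by move=> x y; rewrite mul1r ip_cs.
- by move=> x; rewrite (ip_norm hd).
Qed.

(** The real part of the Hermitian product of the complexification. It already separates points, by
    testing against (c, 0) and (0, c). *)
Definition dot2 (x y : H * H) : R := dot x.1 y.1 + dot x.2 y.2.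

Lemma dot2_pairing : is_pairing dot2 2.
Proof.
split.
- by move=> a x y z; rewrite /dot2 /= !(ip_lin hd); ring.
- move=> x y; rewrite /dot2 (le_trans (ler_normD _ _))//.
  have -> : 2 * `|x| * `|y| = `|x| * `|y| + `|x| * `|y| by ring.
  have [h1 h2] : `|x.1| <= `|x| /\ `|x.2| <= `|x|.
    by rewrite prod_normE /= !le_max !lexx orbT.
  have [h3 h4] : `|y.1| <= `|y| /\ `|y.2| <= `|y|.
    by rewrite prod_normE /= !le_max !lexx orbT.
  by rewrite lerD// (le_trans (ip_cs _ _))// ler_pM.
- move=> x; rewrite /dot2 !(ip_norm hd) prod_normE /= /Num.max.
  by case: ifPn => _; rewrite ?lerDl ?lerDr sqr_ge0.
Qed.

Lemma cplx_normE (x : H * H) : cplx_norm x ^+ 2 = dot2 x x.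
Proof. by rewrite /cplx_norm /dot2 !(ip_norm hd) sqr_sqrtr// addr_ge0. Qed.

Lemma dot2_ge0 x : 0 <= dot2 x x.
Proof. by rewrite /dot2 !(ip_norm hd) addr_ge0. Qed.

Lemma seq_complete_pair : seq_complete H -> seq_complete (H * H)%type.
Proof.
move=> hc v hv.
have fstb (x : H * H) : `|x.1| <= `|x| by rewrite prod_normE /= le_max lexx.
have sndb (x : H * H) : `|x.2| <= `|x| by rewrite prod_normE /= le_max lexx orbT.
have [|l1 h1] := hc (fun n => (v n).1).
  move=> e /hv[N hN]; exists N => m n Nm Nn.
  exact: le_trans (fstb (v m - v n)) (hN _ _ Nm Nn).
have [|l2 h2] := hc (fun n => (v n).2).
  move=> e /hv[N hN]; exists N => m n Nm Nn.
  exact: le_trans (sndb (v m - v n)) (hN _ _ Nm Nn).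
exists (l1, l2).
have -> : v = (fun n => ((v n).1, (v n).2)) by apply/funext => n; case: (v n).
exact: cvg_pair.
Qed.

Context (a : nat -> H) (da : dense_seq a).

(** A countable form of the duality between |z| and the ratios <z, y> / |y|: the vector y = z
    attains the norm, and a nearby [a n] almost does. *)
Lemma lt_norm_weak (t : R) (z : H) : 0 <= t ->
  t < `|z| <-> exists n, t * `|a n| < dot z (a n).
Proof.
move=> t0; split=> [tz|[n tn]].
  have z0 : 0 < `|z| by exact: le_lt_trans tz.
  (* A distance d between [z] and [a n] is small enough when d (|z| + t) < |z| (|z| - t); the
     denominator is enlarged so that the inequality is strict and no division by 0 occurs. *)
  have d0 : 0 < `|z| * (`|z| - t) / (`|z| + t + 1) / 2.
    by rewrite !divr_gt0// ?mulr_gt0 ?subr_gt0// ltr_wpDl// addr_ge0.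
  have [n zn] := da z d0; exists n.
  set d := (X in _ < X) in zn.
  have h1 : dot z (a n) >= `|z| ^+ 2 - `|z| * d.
    rewrite -[a n](subKr z) ipBr (ip_norm hd) lerD2l lerN2.
    by rewrite (le_trans (ler_norm _))// (le_trans (ip_cs _ _))// ler_wpM2l// ltW.
  have h2 : `|a n| <= `|z| + d.
    by rewrite -[a n](subKr z) (le_trans (ler_normB _ _))// lerD2l ltW.
  apply: (lt_le_trans _ h1); apply: (@le_lt_trans _ _ (t * (`|z| + d))).
    by rewrite ler_wpM2l.
  rewrite -subr_gt0.
  have -> : `|z| ^+ 2 - `|z| * d - t * (`|z| + d) =
    `|z| * (`|z| - t) - d * (`|z| + t) by ring.
  rewrite subr_gt0 /d -mulrA -mulrA gtr_pMr ?mulr_gt0 ?subr_gt0//.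
  rewrite mulrA -invfM mulrC ltr_pdivrMr ?mul1r ?mulr_gt0 ?ltr_wpDl ?addr_ge0//.
  by have := ltW z0; lra.
rewrite ltNge; apply/negP => zt; move: tn; rewrite ltNge => /negP; apply.
rewrite (le_trans (ler_norm _))// (le_trans (ip_cs _ _))//.
by rewrite ler_wpM2r.
Qed.

(** Pettis' theorem in the separable case: by [lt_norm_weak], the set where the distance to [c]
    exceeds t is a countable union of sets given by scalar products. *)
Lemma weak_borel d (T : measurableType d) (f : T -> H) :
  (forall c, measurable_fun setT (fun x => dot (f x) c)) ->
  borel_measurable setT f.
Proof.
move=> mf; apply: (dist_borel da) => // c.
apply: (@measurability _ _ T (measurableTypeR R) _ _ _ (RGenOInfty.measurableE R)).
move=> _ [_ [t ->] <-]; rewrite setTI.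
have [t0|t0] := leP 0 t; last first.
  rewrite (_ : _ @^-1` _ = setT)//; apply/seteqP; split => // x _ /=.
  by rewrite in_itv /= andbT (lt_le_trans t0).
rewrite (_ : _ @^-1` _ = \bigcup_n
    ((fun x => dot (f x) (a n) - dot c (a n)) @^-1` `]t * `|a n|, +oo[)).
  apply: bigcupT_measurable => n; rewrite -[X in measurable X]setTI.
  by apply: measurable_funB => //; exact: mf.
apply/seteqP; split => x /=; rewrite in_itv /= andbT.
  by move/(lt_norm_weak _ t0) => [n]; exists n => //=; rewrite in_itv /= andbT -ipBl.
move=> [n _ /=]; rewrite in_itv /= andbT -ipBl => h.
by apply/(lt_norm_weak _ t0); exists n.
Qed.

Lemma measurable_dot d (T : measurableType d) (f g : T -> H) :
  borel_measurable setT f -> borel_measurable setT g ->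
  measurable_fun setT (fun x => dot (f x) (g x)).
Proof.
move=> mf mg.
under eq_fun do rewrite ip_polarization.
apply: measurable_funM => //; apply: measurable_funB;
  apply/measurable_funX/borel_norm => //.
- exact: (borel_add da).
- exact: (borel_sub measurableT da).
Qed.

Lemma measurable_dot2 d (T : measurableType d) (f g : T -> H * H) :
  borel_measurable setT f -> borel_measurable setT g ->
  measurable_fun setT (fun x => dot2 (f x) (g x)).
Proof.
move=> mf mg; apply: measurable_funD; apply: measurable_dot;
  by [exact: borel_fst|exact: borel_snd].
Qed.

End inner_product.

Section fourier_integral.
Context (R : realType) (H : normedModType R) (dot : H -> H -> R)
  (hd : is_ip dot) (a : nat -> H) (da : dense_seq a) (Hc : seq_complete H).
Local Notation mu := (@lebesgue_measure R).
Local Notation T := (measurableTypeR R).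
Local Notation mu2 := (mu \x mu)%E.
Local Notation dot2 := (dot2 dot).

(** Stands for e^{i r s} w(s), a real vector times a complex phase. *)
Definition fphase (w : R -> H) (r s : R) : H * H :=
  (cos (r * s) *: w s, sin (r * s) *: w s).

Definition FT (w : R -> H) (r : R) : H * H :=
  bochner_integral mu setT (fphase w r).

Context (w : R -> H) (mw : borel_measurable (setT : set T) w)
  (iw : mu.-integrable setT (fun x => `|w x|%:E)).

Lemma measurable_cosl (r : R) : measurable_fun (setT : set T) (fun s : R => cos (r * s)).
Proof. by apply: continuous_measurable_fun; exact: continuous_cosM. Qed.

Lemma measurable_sinl (r : R) : measurable_fun (setT : set T) (fun s : R => sin (r * s)).
Proof.
apply: continuous_measurable_fun.
exact: (is_derive_continuous (is_derive_sinl r)).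
Qed.

Lemma measurable_mul2 : measurable_fun (setT : set (T * T)) (fun z => z.1 * z.2 : R).
Proof. exact: measurable_funM measurable_fst measurable_snd. Qed.

Lemma measurable_cos : measurable_fun (setT : set T) (@cos R).
Proof. by apply: continuous_measurable_fun; exact: continuous_cos. Qed.

Lemma measurable_sin : measurable_fun (setT : set T) (@sin R).
Proof. by apply: continuous_measurable_fun; exact: continuous_sin. Qed.

Lemma borel_fphase r : borel_measurable (setT : set T) (fphase w r).
Proof.
apply: (borel_pair da da) => //; apply: (borel_scale da) => //.
- exact: measurable_cosl.
- exact: measurable_sinl.
Qed.

Lemma borel_fphase2 :
  borel_measurable (setT : set (T * T)) (fun z => fphase w z.1 z.2).
Proof.
have mw2 := borel_snd2 mw.
apply: (borel_pair da da) => //; apply: (borel_scale da) => //.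
- exact: measurableT_comp measurable_cos measurable_mul2.
- exact: measurableT_comp measurable_sin measurable_mul2.
Qed.

Lemma fphase_le r s : `|fphase w r s| <= `|w s|.
Proof.
rewrite prod_normE /= ge_max !normrZ.
by rewrite ler_piMl ?cos_max//= ler_piMl ?sin_max.
Qed.

Lemma integrable_fphase r : mu.-integrable setT (fun s => `|fphase w r s|%:E).
Proof.
apply: (le_integrable measurableT _ _ iw).
  by apply/measurable_EFinP; apply: borel_norm => //; exact: borel_fphase.
by move=> s _; rewrite /= lee_fin !normr_id fphase_le.
Qed.

Lemma dot2_FT r y : dot2 (FT w r) y = \int[mu]_s dot2 (fphase w r s) y.
Proof.
apply: (bochner_pairing (dot2_pairing hd) measurableT (dense_seq_pair da da)).
- exact: borel_fphase.
- exact: integrable_fphase.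
- exact: seq_complete_pair.
Qed.

(** The real part of e^{i r (s - t)} <w s, w t>: hence the Abel factor enters through its cosine
    transform. *)
Lemma dot2_fphase r s t : dot2 (fphase w r s) (fphase w r t) =
  dot (w s) (w t) * cos ((t - s) * r).
Proof.
rewrite /dot2 /= !(ipZl hd) !(ipZr hd).
have -> : (t - s) * r = r * t - r * s by ring.
by rewrite cosB; ring.
Qed.

Lemma integrable_dot2_fphase r y :
  mu.-integrable setT (fun s => (dot2 (fphase w r s) y)%:E).
Proof.
apply: (pairing_integrable (dot2_pairing hd)) => //.
- exact: borel_fphase.
- exact: integrable_fphase.
Qed.

Lemma borel_FT : borel_measurable (setT : set T) (FT w).
Proof.
rewrite (_ : FT w = fun r => ((FT w r).1, (FT w r).2)); last first.
  by apply/funext => r; case: (FT w r).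
have my y : measurable_fun (setT : set T) (fun r => dot2 (FT w r) y).
  under eq_fun do rewrite dot2_FT.
  apply: (measurable_Rintegral mu (f := fun z : T * T => dot2 (fphase w z.1 z.2) y)).
  by apply: (measurable_dot2 hd da); [exact: borel_fphase2|exact: borel_cst].
apply: (borel_pair da da) => //; apply: (weak_borel hd da) => c.
- have := my (c, 0); rewrite /dot2 /=.
  by under eq_fun do rewrite (ip0r hd) addr0.
- have := my (0, c); rewrite /dot2 /=.
  by under eq_fun do rewrite (ip0r hd) add0r.
Qed.

Definition L1norm : R := \int[mu]_s `|w s|.

(** The transform is tested against itself; 2 is the constant of [dot2_pairing]. *)
Lemma norm_FT_le r : `|FT w r| <= 2 * L1norm.
Proof.
have [->|F0] := eqVneq (FT w r) 0.
  by rewrite normr0 mulr_ge0// Rintegral_ge0.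
have nF : 0 < `|FT w r| by rewrite normr_gt0.
rewrite -(ler_pM2l nF) -expr2 (le_trans (pairing_ge (dot2_pairing hd) _))//.
rewrite dot2_FT.
apply: (@le_trans _ _ (\int[mu]_s (2 * `|FT w r| * `|w s|))).
  apply: le_Rintegral => //.
  - exact: integrable_dot2_fphase.
  - exact: (integrableZl measurableT _ iw).
  - move=> s _; rewrite (le_trans (ler_norm _))//.
    rewrite (le_trans (pairing_le (dot2_pairing hd) _ _))// mulrAC.
    by rewrite ler_wpM2l ?mulr_ge0// fphase_le.
by rewrite RintegralZl// /L1norm mulrA (mulrC 2).
Qed.

Context (e : R) (e0 : 0 < e).

(** Both transforms are written as integrals and the integration in r is moved inside, where it
    turns [abel] times a cosine into [poisson]. Since [dot2_FT] opens one factor at a time, there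
    are two exchanges; in the first, the closed factor is bounded by [norm_FT_le]. *)
Lemma Rintegral_abel_FT :
  \int[mu]_r (abel e r * dot2 (FT w r) (FT w r)) =
  \int[mu]_s \int[mu]_t (dot (w t) (w s) * poisson e (s - t)).
Proof.
have iabel := integrable_abel e0.
have mabel1 : measurable_fun (setT : set (T * T)) (fun z => abel e z.1).
  exact: measurableT_comp (measurable_abel e) measurable_fst.
have mnw := borel_norm measurableT mw.
transitivity (\int[mu]_r \int[mu]_s (abel e r * dot2 (fphase w r s) (FT w r))).
  apply: eq_Rintegral => r _; rewrite {1}dot2_FT RintegralZl//.
  exact: integrable_dot2_fphase.
pose f1 (z : T * T) := abel e z.1 * dot2 (fphase w z.1 z.2) (FT w z.1).
have mf1 : measurable_fun setT f1.
  apply: measurable_funM => //; apply: (measurable_dot2 hd da).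
    exact: borel_fphase2.
  exact: (measurableT_comp borel_FT measurable_fst).
rewrite (@Rfubini _ _ _ _ _ mu mu f1 mf1); last first.
  apply: (@prod_dominated _ _ _ _ _ mu mu f1 (fun r => 2 * (2 * L1norm) * abel e r)
    (fun s => `|w s|)) => //.
  - exact: (integrableZl measurableT _ iabel).
  - move=> r s /=; rewrite normrM ger0_norm ?abel_ge0//.
    rewrite (mulrC _ (abel e r)) -mulrA ler_wpM2l ?abel_ge0//.
    rewrite (le_trans (pairing_le (dot2_pairing hd) _ _))//.
    rewrite -!mulrA ler_wpM2l// mulrC [leRHS]mulrA ler_pM// ?fphase_le//.
    exact: norm_FT_le.
apply: eq_Rintegral => s _ /=.
transitivity (\int[mu]_r \int[mu]_t (abel e r * dot2 (fphase w r t) (fphase w r s))).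
  apply: eq_Rintegral => r _; rewrite /f1 /=.
  have -> : dot2 (fphase w r s) (FT w r) = dot2 (FT w r) (fphase w r s).
    by rewrite /dot2 !(ip_sym hd (fphase w r s).1) !(ip_sym hd (fphase w r s).2).
  rewrite dot2_FT RintegralZl//; exact: integrable_dot2_fphase.
pose f2 (z : T * T) := abel e z.1 * dot2 (fphase w z.1 z.2) (fphase w z.1 s).
have mf2 : measurable_fun setT f2.
  apply: measurable_funM => //; apply: (measurable_dot2 hd da).
    exact: borel_fphase2.
  apply: (borel_pair da da) => //; apply: (borel_scale da) => //;
    try exact: borel_cst.
  - apply: measurableT_comp measurable_cos _.
    by apply: measurable_funM => //; exact: measurable_fst.
  - apply: measurableT_comp measurable_sin _.
    by apply: measurable_funM => //; exact: measurable_fst.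
rewrite (@Rfubini _ _ _ _ _ mu mu f2 mf2); last first.
  apply: (@prod_dominated _ _ _ _ _ mu mu f2 (fun r => 2 * `|w s| * abel e r)
    (fun s => `|w s|)) => //.
  - exact: (integrableZl measurableT _ iabel).
  - move=> r t /=; rewrite normrM ger0_norm ?abel_ge0//.
    rewrite (mulrC _ (abel e r)) -mulrA ler_wpM2l ?abel_ge0//.
    rewrite (le_trans (pairing_le (dot2_pairing hd) _ _))//.
    by rewrite -!mulrA ler_wpM2l// mulrC ler_pM// ?fphase_le.
apply: eq_Rintegral => t _ /=.
under eq_Rintegral do rewrite /f2 /= dot2_fphase mulrCA.
rewrite RintegralZl// ?integral_abel_cos//.
apply: (le_integrable measurableT _ _ iabel).
  apply/measurable_EFinP/measurable_funM; first exact: measurable_abel.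
  exact: measurable_cosl.
by move=> r _; rewrite lee_fin /= normrM ler_piMr// cos_max.
Qed.

End fourier_integral.

(** * Two-sided Plancherel inequalities *)

Section product_integral.
Context d1 d2 (T1 : measurableType d1) (T2 : measurableType d2) (R : realType).
Context (m1 : {sigma_finite_measure set T1 -> \bar R})
  (m2 : {sigma_finite_measure set T2 -> \bar R}).

Lemma Rintegral_prod (f : T1 * T2 -> R) : measurable_fun setT f ->
  (\int[m1]_x \int[m2]_y `|f (x, y)|%:E < +oo)%E ->
  \int[m1]_x (\int[m2]_y f (x, y)) = \int[(m1 \x m2)%E]_z f z.
Proof.
move=> mf foo; have mf' : measurable_fun setT (EFin \o f) by exact/measurable_EFinP.
have imf : (m1 \x m2)%E.-integrable setT (EFin \o f).
  by apply/(integrable12ltyP m1 m2 mf').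
rewrite {1}/Rintegral [RHS]/Rintegral; congr fine.
rewrite -(integral12_prod_meas1 imf).
apply: ae_eq_integral => //.
- exact/measurable_EFinP/measurable_Rintegral.
- exact: measurable_fubini_F imf.
- apply: filterS (ae_integrable1 imf) => x ix _.
  by rewrite /Rintegral fineK//; exact: integrable_fin_num.
Qed.

End product_integral.

Section plancherel.
Context (R : realType) (H : normedModType R) (dot : H -> H -> R)
  (hd : is_ip dot) (a : nat -> H) (da : dense_seq a) (Hc : seq_complete H).
Local Notation mu := (@lebesgue_measure R).
Local Notation T := (measurableTypeR R).
Local Notation mu2 := (mu \x mu)%E.
Local Notation dot2 := (dot2 dot).
Context (w : R -> H) (mw : borel_measurable (setT : set T) w)
  (iw : mu.-integrable setT (fun x => `|w x|%:E)) (qw : (sqint mu w < +oo)%E).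

Let q := fine (sqint mu w).

Let qE : sqint mu w = q%:E.
Proof. by rewrite fineK// ge0_fin_numE// sqint_ge0. Qed.

Section fixed_eps.
Context (e : R) (e0 : 0 < e).

Let A (z : T * T) := `|w z.1| ^+ 2 * poisson e (z.1 - z.2).
Let B (z : T * T) := `|w z.1 - w z.2| ^+ 2 * poisson e (z.1 - z.2).
Let f (z : T * T) := dot (w z.2) (w z.1) * poisson e (z.1 - z.2).

Let mnw := borel_norm measurableT mw.

Let mA : measurable_fun setT A.
Proof.
apply: measurable_funM; last exact: measurable_poisson2.
exact: measurableT_comp (measurable_funX 2 mnw) measurable_fst.
Qed.

Let A0 z : 0 <= A z.
Proof. by rewrite mulr_ge0 ?poisson_ge0. Qed.

Let intA : (\int[mu2]_z (A z)%:E = (2 * pi * q)%:E)%E.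
Proof.
rewrite EFinM -qE /A.
rewrite (@integral_poisson_fst _ _ e0 (fun x => `|w x| ^+ 2))//.
exact: measurable_funX.
Qed.

Let iA : mu2.-integrable setT (EFin \o A).
Proof.
apply/integrableP; split; first exact/measurable_EFinP.
by under eq_integral do rewrite gee0_abs ?lee_fin//; rewrite intA ltry.
Qed.

Let mB : measurable_fun setT B.
Proof. by apply/measurable_EFinP; exact: (measurable_energy da e0 mw). Qed.

Let B0 z : 0 <= B z.
Proof. by rewrite mulr_ge0 ?poisson_ge0. Qed.

Let energy_fin : energy e w \is a fin_num.
Proof.
rewrite ge0_fin_numE ?energy_ge0//.
apply: (le_lt_trans (energy_le da e0 mw)).
by rewrite qE -EFinM ltry.
Qed.

Let iB : mu2.-integrable setT (EFin \o B).
Proof.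
apply/integrableP; split; first exact/measurable_EFinP.
under eq_integral do rewrite gee0_abs ?lee_fin//.
by rewrite -ge0_fin_numE ?energy_ge0.
Qed.

Let mf : measurable_fun setT f.
Proof.
apply: measurable_funM; last exact: measurable_poisson2.
apply: (measurable_dot hd da); [exact: borel_snd2|exact: borel_fst2].
Qed.

Let f_lty : (\int[mu]_s \int[mu]_t `|f (s, t)|%:E < +oo)%E.
Proof.
apply: (@prod_dominated _ _ _ _ _ mu mu f (fun s => `|w s|)
  (fun t => 2 / e * `|w t|)) => //.
- exact: (integrableZl measurableT _ iw).
- move=> s t; rewrite /f /= normrM (ger0_norm (poisson_ge0 e0 _)).
  have -> : `|w s| * (2 / e * `|w t|) = (`|w t| * `|w s|) * (2 / e) by ring.
  by rewrite ler_pM ?(poisson_ge0 e0) ?(poisson_le e0) ?(ip_cs hd).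
Qed.

Let if_ : mu2.-integrable setT (EFin \o f).
Proof. by apply/(integrable12ltyP mu mu); [exact/measurable_EFinP|exact: f_lty]. Qed.

Let J := \int[mu]_r (abel e r * dot2 (FT w r) (FT w r)).

Let JE : J = \int[mu2]_z f z.
Proof.
by rewrite /J (Rintegral_abel_FT hd da Hc mw iw e0) (Rintegral_prod mf f_lty).
Qed.

Let ab_le (x y : H) : `|dot (y - x) x| <= 2^-1 * `|x| ^+ 2 + 2^-1 * `|x - y| ^+ 2.
Proof.
rewrite (le_trans (ip_cs hd _ _))// distrC -subr_ge0.
have -> : 2^-1 * `|x| ^+ 2 + 2^-1 * `|x - y| ^+ 2 - `|x - y| * `|x| =
   2^-1 * (`|x| - `|x - y|) ^+ 2 by field.
by rewrite mulr_ge0 ?sqr_ge0.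
Qed.

Let iZ (k : R) (g : T * T -> R) : mu2.-integrable setT (EFin \o g) ->
  mu2.-integrable setT (EFin \o (fun z => k * g z)).
Proof. by move=> /(integrableZl measurableT k). Qed.

(* Polarization-free: <w s, w t> = |w t|^2 + <w s - w t, w t>, and the second
   term is at most half of |w t|^2 + |w s - w t|^2. *)
Lemma abel_mean_ge : pi * q - 2^-1 * fine (energy e w) <= J.
Proof.
rewrite JE.
have -> : pi * q - 2^-1 * fine (energy e w) =
    \int[mu2]_z (2^-1 * A z - 2^-1 * B z).
  rewrite (RintegralB measurableT (iZ _ iA) (iZ _ iB)).
  rewrite !RintegralZl// {1}/Rintegral intA /=.
  by congr (_ - _); field.
apply: le_Rintegral => //.
  by apply: (integrableB measurableT (iZ _ iA) (iZ _ iB)).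
move=> z _; rewrite /A /B /f; have := poisson_ge0 e0 (z.1 - z.2).
move: (poisson e _) => K K0; rewrite !mulrA -mulrBl ler_wpM2r//.
have := ab_le (w z.1) (w z.2); rewrite ler_norml => /andP[+ _].
by rewrite (ipBl hd) (ip_norm hd); lra.
Qed.

(** The same splitting bounded from above: [A] is counted 3/2 times, and its integral is 2 pi q. *)
Lemma abel_mean_le : J <= 3 * pi * q + 2^-1 * fine (energy e w).
Proof.
rewrite JE.
have -> : 3 * pi * q + 2^-1 * fine (energy e w) =
    \int[mu2]_z (3 / 2 * A z + 2^-1 * B z).
  rewrite (RintegralD measurableT (iZ _ iA) (iZ _ iB)).
  rewrite !RintegralZl// {1}/Rintegral intA /=.
  by congr (_ + _); field.
apply: le_Rintegral => //.
  by apply: (integrableD measurableT (iZ _ iA) (iZ _ iB)).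
move=> z _; rewrite /A /B /f; have := poisson_ge0 e0 (z.1 - z.2).
move: (poisson e _) => K K0; rewrite !mulrA -mulrDl ler_wpM2r//.
have := ab_le (w z.1) (w z.2); rewrite ler_norml => /andP[_ +].
by rewrite (ipBl hd) (ip_norm hd); lra.
Qed.

Lemma integrable_abel_FT :
  mu.-integrable setT (EFin \o (fun r => abel e r * dot2 (FT w r) (FT w r))).
Proof.
have K0 : 0 <= L1norm w by apply: Rintegral_ge0.
have mF := borel_FT hd da Hc mw iw.
apply: (le_integrable measurableT _ _
  (integrableZl measurableT (2 * (2 * L1norm w) ^+ 2) (integrable_abel e0))).
  apply/measurable_EFinP/measurable_funM; first exact: measurable_abel.
  exact: (measurable_dot2 hd da).
move=> r _; rewrite lee_fin /= [leRHS]ger0_norm; last by rewrite !mulr_ge0 ?abel_ge0 ?sqr_ge0.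
rewrite normrM ger0_norm ?abel_ge0// mulrC ler_wpM2r ?abel_ge0//.
rewrite (le_trans (pairing_le (dot2_pairing hd) _ _))// expr2.
have h := norm_FT_le hd da Hc mw iw r.
rewrite -mulrA ler_wpM2l//.
by apply: ler_pM => //; exact: norm_ge0.
Qed.

Lemma abel_meanE :
  (\int[mu]_r (abel e r * dot2 (FT w r) (FT w r))%:E = J%:E)%E.
Proof. by rewrite /J /Rintegral fineK// (integrable_fin_num measurableT integrable_abel_FT). Qed.

End fixed_eps.

Local Notation P := (\int[mu]_r (dot2 (FT w r) (FT w r))%:E)%E.

Let mF := borel_FT hd da Hc mw iw.

Lemma energy_small (eta : R) : 0 < eta ->
  exists N, forall n, (N <= n)%N -> fine (energy n.+1%:R^-1 w) <= eta.
Proof.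
move=> eta0; have [N hN] := vanishing_L2 da mw iw qw eta0.
exists N => n /hN h; rewrite -lee_fin fineK// ge0_fin_numE.
  by rewrite (le_lt_trans h)// ltry.
by apply: energy_ge0; exact: natSinv_gt0.
Qed.

(** Since [abel] is at most 1, the Abel mean at one scale of small energy already lies below the
    full integral. *)
Lemma plancherel_ge : (pi%:E * sqint mu w <= P)%E.
Proof.
rewrite qE -EFinM; apply/lee_addgt0Pr => eta eta0.
have [N hN] := energy_small eta0.
have N0 := natSinv_gt0 R N.
apply: (@le_trans _ _ ((\int[mu]_r (abel N.+1%:R^-1 r * dot2 (FT w r) (FT w r)))%:E + eta%:E)%E).
  rewrite -EFinD lee_fin.
  have := abel_mean_ge N0; have := hN N (leqnn N).
  have : 0 <= fine (energy N.+1%:R^-1 w) by rewrite fine_ge0// energy_ge0.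
  lra.
rewrite leeD2r// -abel_meanE//; apply: ge0_le_integral => //.
- by move=> r _; rewrite lee_fin mulr_ge0 ?abel_ge0 ?dot2_ge0.
- apply/measurable_EFinP/measurable_funM; first exact: measurable_abel.
  exact: (measurable_dot2 hd da).
- by apply/measurable_EFinP; exact: (measurable_dot2 hd da).
- by move=> r _; rewrite lee_fin ler_piMl ?dot2_ge0// abel_le1.
Qed.

(** The integral is not yet known to be finite here. Fatou bounds it by the lower limit of the Abel
    means, the damping factor tending to 1. *)
Lemma plancherel_le : (P <= (3 * pi)%:E * sqint mu w)%E.
Proof.
rewrite qE -EFinM; apply/lee_addgt0Pr => eta eta0.
have [N hN] := energy_small eta0.
pose g n r := (abel n.+1%:R^-1 r * dot2 (FT w r) (FT w r))%:E.
have mg n : measurable_fun (setT : set T) (g n).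
  apply/measurable_EFinP/measurable_funM; first exact: measurable_abel.
  exact: (measurable_dot2 hd da).
have g0 n r : (0 <= g n r)%E by rewrite lee_fin mulr_ge0 ?abel_ge0 ?dot2_ge0.
apply: (@le_trans _ _ (\int[mu]_r limn_einf (g ^~ r))%E).
  rewrite le_eqVlt; apply/orP; left; apply/eqP; apply: eq_integral => r _.
  have h : g n r @[n --> \oo] --> (dot2 (FT w r) (FT w r))%:E.
    apply/cvg_EFin; first exact: nearW.
    rewrite -[X in _ --> X]mul1r; apply: cvgM; last exact: cvg_cst.
    have h0 : (- n.+1%:R^-1 * `|r|) @[n --> \oo] --> (0 : R).
      rewrite -(mul0r `|r|) -oppr0; apply: cvgM; last exact: cvg_cst.
      by apply: cvgN; exact: cvg_harmonic.
    rewrite -[X in _ --> X]expR0.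
    have h1 := @continuous_expR R 0.
    have h2 := continuous_cvg _ h1 h0.
    exact: h2.
  by have [-> _] := cvg_limn_einf_sup h.
apply: (le_trans (fatou _ _ _ _)) => //.
apply: (@limn_einf_le _ _ N) => n Nn.
rewrite /g (abel_meanE (natSinv_gt0 R n)) -EFinD lee_fin.
have := abel_mean_le (natSinv_gt0 R n); have := hN n Nn.
have : 0 <= fine (energy n.+1%:R^-1 w) by rewrite fine_ge0// energy_ge0// natSinv_gt0.
lra.
Qed.

End plancherel.

(** * The Fourier transform on L2 *)

Section tends0.
Context (R : realType).
Local Open Scope ereal_scope.

Definition tends0 (x : nat -> \bar R) : Prop := forall e : R, (0 < e)%R ->
  exists N, forall n, (N <= n)%N -> x n <= e%:E.

Lemma tends0_le x y : tends0 y -> (forall n, x n <= y n) -> tends0 x.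
Proof.
move=> hy xy e /hy[N hN]; exists N => n /hN; exact: le_trans.
Qed.

Lemma tends0Z (C : R) x : (0 <= C)%R -> tends0 x -> tends0 (fun n => C%:E * x n).
Proof.
move=> C0 hx e e0.
have C1 : (0 < C + 1)%R by rewrite ltr_wpDl.
have [N hN] := hx _ (divr_gt0 e0 C1).
exists N => n /hN h; apply: (@le_trans _ _ (C%:E * (e / (C + 1))%:E)).
  by rewrite lee_wpmul2l ?lee_fin.
rewrite -EFinM lee_fin mulrCA ler_piMr ?(ltW e0)//.
by rewrite ler_pdivrMr// mul1r lerDl.
Qed.

Lemma tends0D x y : tends0 x -> tends0 y -> tends0 (fun n => x n + y n).
Proof.
move=> hx hy e e0; have e2 : (0 < e / 2)%R by rewrite divr_gt0.
have [N hN] := hx _ e2; have [M hM] := hy _ e2.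
exists (maxn N M) => n; rewrite geq_max => /andP[/hN h1 /hM h2].
by rewrite (splitr e) EFinD leeD.
Qed.

Lemma tends0_const (x : \bar R) : 0 <= x -> tends0 (cst x) -> x = 0.
Proof.
move=> x0 h; apply: le_epsilon_eq0 => // e /h[N hN]; exact: (hN N).
Qed.

Lemma tends0_cst_le (x c : \bar R) y : tends0 y -> (forall n, x <= y n + c) -> x <= c.
Proof.
move=> hy h; apply/lee_addgt0Pr => e /hy[N hN].
by rewrite addeC (le_trans (h N))// leeD2r// hN.
Qed.

End tends0.

Section sq_to.
Context (R : realType) (d : measure_display) (T : measurableType d)
  (mu : {measure set T -> \bar R}).
Context (E : normedModType R) (a : nat -> E) (da : dense_seq a).
Local Open Scope ereal_scope.

Definition sq_to (f : nat -> T -> E) (g : T -> E) : Prop :=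
  tends0 (fun n => sqint mu (fun x => f n x - g x)%R).

Lemma sqint_lty_sub (f g : T -> E) : borel_measurable setT f -> borel_measurable setT g ->
  sqint mu f < +oo -> sqint mu g < +oo -> sqint mu (fun x => f x - g x)%R < +oo.
Proof.
move=> mf mg qf qg; apply: (le_lt_trans (sqintB mu da mf mg)).
by rewrite lte_add_pinfty// lte_mul_pinfty ?sqint_ge0.
Qed.

Lemma sqint_le_sub (f g : T -> E) : borel_measurable setT f -> borel_measurable setT g ->
  sqint mu f <= 2%:E * sqint mu (fun x => g x - f x)%R + 2%:E * sqint mu g.
Proof.
move=> mf mg.
rewrite -(sqint_subC mu f g) /=.
have := sqintD mu da (borelB da mf mg) mg.
by under [X in sqint mu X]eq_fun do rewrite subrK.
Qed.

Lemma sqint_triangle (f g h : T -> E) : borel_measurable setT f ->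
  borel_measurable setT g -> borel_measurable setT h ->
  sqint mu (fun x => f x - h x)%R <=
  2%:E * sqint mu (fun x => f x - g x)%R + 2%:E * sqint mu (fun x => h x - g x)%R.
Proof. by move=> mf mg mh; rewrite (sqint_subC mu h g); exact: (sqint_subadd mu da). Qed.

Lemma sq_to_unique f (g h : T -> E) : (forall n, borel_measurable setT (f n)) ->
  borel_measurable setT g -> borel_measurable setT h ->
  sq_to f g -> sq_to f h -> {ae mu, forall x, g x = h x}.
Proof.
move=> mf mg mh fg fh.
suff : sqint mu (fun x => g x - h x)%R = 0.
  move=> /(sqint_eq0 (borelB da mg mh)); apply: filterS => x /eqP.
  by rewrite subr_eq0 => /eqP.
apply: tends0_const; first exact: sqint_ge0.
apply: (tends0_le (tends0D (@tends0Z _ 2 _ _ fg) (@tends0Z _ 2 _ _ fh))) => // n.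
by rewrite (sqint_subC mu (f n) g); exact: (sqint_subadd mu da).
Qed.

Lemma sq_toB (f f' : nat -> T -> E) (g g' : T -> E) : (forall n, borel_measurable setT (f n)) ->
  (forall n, borel_measurable setT (f' n)) ->
  borel_measurable setT g -> borel_measurable setT g' ->
  sq_to f g -> sq_to f' g' ->
  sq_to (fun n x => f n x - f' n x)%R (fun x => g x - g' x)%R.
Proof.
move=> mf mf' mg mg' fg fg'.
apply: (tends0_le (tends0D (@tends0Z _ 2 _ _ fg) (@tends0Z _ 2 _ _ fg'))) => // n.
have := sqintB mu da (borelB da (mf n) mg) (borelB da (mf' n) mg').
rewrite [X in sqint mu X <= _ -> _](_ : _ =
  fun x => f n x - f' n x - (g x - g' x))%R//.
by apply/funext => x; rewrite !opprB addrACA [RHS]addrACA (addrC (- g x)%R).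
Qed.

Lemma sq_toZ (k : R) (f : nat -> T -> E) (g : T -> E) : (forall n, borel_measurable setT (f n)) ->
  borel_measurable setT g ->
  sq_to f g -> sq_to (fun n x => k *: f n x)%R (fun x => k *: g x)%R.
Proof.
move=> mf mg /(tends0Z (sqr_ge0 k)) /tends0_le; apply => n.
rewrite -sqintZ; last exact: (borelB da).
by under [X in sqint mu X <= _]eq_fun do rewrite -scalerBr.
Qed.

End sq_to.

Section fourier_L2.
#[local] Opaque FT bochner_integral.
Context (R : realType) (H : normedModType R) (dot : H -> H -> R)
  (hd : is_ip dot) (a : nat -> H) (da : dense_seq a) (Hc : seq_complete H).
Local Notation mu := (@lebesgue_measure R).
Local Notation T := (measurableTypeR R).
Local Notation dot2 := (dot2 dot).
Local Notation da2 := (dense_seq_pair da da).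

Let Hc2 := seq_complete_pair Hc.

Lemma dot2_ext (x y : H * H) : (forall c, dot2 x c = dot2 y c) -> x = y.
Proof.
move=> h; case: x y h => [x1 x2] [y1 y2] h; congr pair; apply: (ip_ext hd) => c.
  by have := h (c, 0); rewrite /dot2 /= !(ip0r hd) !addr0.
by have := h (0, c); rewrite /dot2 /= !(ip0r hd) !add0r.
Qed.

Lemma dot2B (x y c : H * H) : dot2 (x - y) c = dot2 x c - dot2 y c.
Proof. by rewrite /dot2 /= !(ipBl hd); ring. Qed.

Lemma dot2Z (k : R) (x c : H * H) : dot2 (k *: x) c = k * dot2 x c.
Proof. by rewrite /dot2 /= !(ipZl hd); ring. Qed.

Lemma FTB (w1 w2 : R -> H) :
  borel_measurable (setT : set T) w1 -> mu.-integrable setT (fun x => `|w1 x|%:E) ->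
  borel_measurable (setT : set T) w2 -> mu.-integrable setT (fun x => `|w2 x|%:E) ->
  FT (fun x => w1 x - w2 x) = (fun r => FT w1 r - FT w2 r).
Proof.
move=> mw1 iw1 mw2 iw2; apply/funext => r; apply: dot2_ext => c.
have iw : mu.-integrable setT (fun x => `|w1 x - w2 x|%:E).
  exact: (sub_integrable measurableT da).
have mw := borelB da mw1 mw2.
rewrite dot2B; apply: etrans; first exact: (dot2_FT hd da Hc mw iw).
apply: (etrans _ (esym (congr2 (fun x y => x - y)
  (dot2_FT hd da Hc mw1 iw1 r c) (dot2_FT hd da Hc mw2 iw2 r c)))).
rewrite -RintegralB//.
- apply: eq_Rintegral => s _; rewrite /dot2 /fphase /= !scalerBr !(ipBl hd); ring.
- exact: (integrable_dot2_fphase hd da mw1 iw1).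
- exact: (integrable_dot2_fphase hd da mw2 iw2).
Qed.

Lemma FTZ (k : R) (w : R -> H) :
  borel_measurable (setT : set T) w -> mu.-integrable setT (fun x => `|w x|%:E) ->
  FT (fun x => k *: w x) = (fun r => k *: FT w r).
Proof.
move=> mw iw; apply/funext => r; apply: dot2_ext => c.
have mkw : borel_measurable (setT : set T) (fun x => k *: w x).
  exact: (borel_scale da measurableT (measurable_cst k) mw).
have ikw : mu.-integrable setT (fun x => `|k *: w x|%:E).
  apply: (eq_integrable measurableT _ _ _ (integrableZl measurableT `|k| iw)) => x _.
  by rewrite /= normrZ.
rewrite dot2Z; apply: etrans; first exact: (dot2_FT hd da Hc mkw ikw).
rewrite (dot2_FT hd da Hc mw iw).
rewrite -RintegralZl//.
- apply: eq_Rintegral => s _; rewrite /dot2 /fphase /= !(ipZl hd); ring.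
- exact: (integrable_dot2_fphase hd da mw iw).
Qed.

Lemma sqint_dot2_ge (g : R -> H * H) : borel_measurable (setT : set T) g ->
  (sqint mu g <= \int[mu]_r (dot2 (g r) (g r))%:E)%E.
Proof.
move=> mg; apply: ge0_le_integral => //.
- exact: sq_measurable.
- by apply/measurable_EFinP; exact: (measurable_dot2 hd da).
- by move=> x _; rewrite lee_fin; exact: (pairing_ge (dot2_pairing hd)).
Qed.

Lemma sqint_dot2_le (g : R -> H * H) : borel_measurable (setT : set T) g ->
  (\int[mu]_r (dot2 (g r) (g r))%:E <= 2%:E * sqint mu g)%E.
Proof.
move=> mg; rewrite -ge0_integralZl_EFin//; last exact: sq_measurable.
apply: ge0_le_integral => //.
- by move=> x _; rewrite lee_fin (dot2_ge0 hd).
- by apply/measurable_EFinP; exact: (measurable_dot2 hd da).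
- by apply/measurable_EFinP/measurable_funM => //; apply/measurable_EFinP; exact: sq_measurable.
- move=> x _; rewrite lee_fin expr2 mulrA (le_trans (ler_norm _))//.
  exact: (pairing_le (dot2_pairing hd)).
Qed.

Lemma sqint_FT_le (w : R -> H) : borel_measurable (setT : set T) w ->
  mu.-integrable setT (fun x => `|w x|%:E) -> (sqint mu w < +oo)%E ->
  (sqint mu (FT w) <= (3 * pi)%:E * sqint mu w)%E.
Proof.
move=> mw iw qw; apply: (le_trans _ (plancherel_le hd da Hc mw iw qw)).
exact: (sqint_dot2_ge (borel_FT hd da Hc mw iw)).
Qed.

(** The factor 2 lost between [dot2] and the squared max-norm is absorbed by pi >= 2. Contraposition
    cancels these factors without a division of extended reals. *)
Lemma sqint_FT_ge (w : R -> H) : borel_measurable (setT : set T) w ->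
  mu.-integrable setT (fun x => `|w x|%:E) -> (sqint mu w < +oo)%E ->
  (sqint mu w <= sqint mu (FT w))%E.
Proof.
move=> mw iw qw.
have := le_trans (plancherel_ge hd da Hc mw iw qw)
  (sqint_dot2_le (borel_FT hd da Hc mw iw)).
apply: contraTT; rewrite -!ltNge => h.
have q0 : (0 < sqint mu w)%E by apply: le_lt_trans h; exact: sqint_ge0.
apply: (@lt_le_trans _ _ (2%:E * sqint mu w)%E).
  by rewrite lte_pmul2l.
by rewrite lee_wpmul2r ?sqint_ge0// lee_fin pi_ge2.
Qed.

Definition trunc (u : R -> H) (n : nat) (s : R) : H :=
  \1_(`[- n%:R, n%:R]%classic : set R) s *: u s.

Lemma norm_trunc_le u n s : `|trunc u n s| <= `|u s|.
Proof. by rewrite /trunc indicE; case: (_ \in _); rewrite ?scale1r// scale0r normr0. Qed.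

Lemma trunc_id u n s : s \in (`[- n%:R, n%:R]%classic : set R) -> trunc u n s = u s.
Proof. by rewrite /trunc indicE => ->; rewrite scale1r. Qed.

Lemma trunc_out u n s : s \notin (`[- n%:R, n%:R]%classic : set R) -> trunc u n s = 0.
Proof. by rewrite /trunc indicE => /negbTE ->; rewrite scale0r. Qed.

Lemma trunc_eq u s : exists N, forall n, (N <= n)%N -> trunc u n s = u s.
Proof.
exists (Num.truncn `|s|).+1 => n Nn; apply: trunc_id.
rewrite inE /= in_itv /= -ler_norml (le_trans (ltW (truncnS_gt _)))//.
by rewrite ler_nat.
Qed.

Section fixed_u.
Context (u : R -> H) (mu_ : borel_measurable (setT : set T) u)
  (qu : (sqint mu u < +oo)%E).

Lemma borel_trunc n : borel_measurable (setT : set T) (trunc u n).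
Proof. by apply: (borel_scale da measurableT _ mu_); exact: measurable_indic. Qed.

Lemma sqint_trunc_le n : (sqint mu (trunc u n) <= sqint mu u)%E.
Proof. by apply: le_sqint => //; [exact: borel_trunc|exact: norm_trunc_le]. Qed.

Lemma sqint_trunc_lty n : (sqint mu (trunc u n) < +oo)%E.
Proof. exact: le_lt_trans (sqint_trunc_le n) qu. Qed.

(** On a bounded interval L2 lies in L1, through t <= 1 + t^2, which follows from the square of t -
    1/2. *)
Lemma integrable_trunc n : mu.-integrable setT (fun x => `|trunc u n x|%:E).
Proof.
have mI : measurable (`[- n%:R, n%:R]%classic : set T) by exact: measurable_itv.
have i1 : mu.-integrable setT (fun x : T => (\1_(`[- n%:R, n%:R]%classic : set T) x : R)%:E).
  apply/integrableP; split; first by apply/measurable_EFinP/measurable_indic.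
  under eq_integral do rewrite gee0_abs ?lee_fin//.
  rewrite integral_indic// setIT /=.
  have := lebesgue_measure_itv `[- n%:R, n%:R : R]; rewrite /= => ->.
  by case: ifP => // _; rewrite -EFinB ltry.
have i2 : mu.-integrable setT (fun x : T => (`|trunc u n x| ^+ 2)%:E).
  apply/integrableP; split; first by apply: sq_measurable; exact: borel_trunc.
  under eq_integral do rewrite gee0_abs ?lee_fin ?sqr_ge0//.
  exact: sqint_trunc_lty.
apply: (le_integrable measurableT _ _ (integrableD measurableT i1 i2)).
  by apply/measurable_EFinP; apply: borel_norm => //; exact: borel_trunc.
move=> x _; rewrite lee_fin normr_id ger0_norm ?addr_ge0//.
have [xI|xI] := boolP (x \in (`[- n%:R, n%:R]%classic : set T)); last first.
  by rewrite (trunc_out u xI) normr0 addr_ge0.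
rewrite indicE xI /=; have := sqr_ge0 (`|trunc u n x| - 2^-1); have := normr_ge0 (trunc u n x); move: (`|trunc u n x|) => t t0; rewrite sqrrB !mulr1n; nra.
Qed.

Lemma trunc_cvg : sq_to mu (trunc u) u.
Proof.
have iu : mu.-integrable setT (fun x : T => (`|u x| ^+ 2)%:E).
  apply/integrableP; split; first exact: sq_measurable.
  under eq_integral do rewrite gee0_abs ?lee_fin ?sqr_ge0//.
  exact: qu.
have [|||||_ _ h] := @dominated_convergence _ T _ mu setT measurableT
  (fun n x => (`|trunc u n x - u x| ^+ 2)%:E) (cst 0%E) (fun x => (`|u x| ^+ 2)%:E).
- by move=> n; apply: sq_measurable; apply: (borelB da) => //; exact: borel_trunc.
- exact: measurable_cst.
- apply: aeW => x _; have [N hN] := trunc_eq u x.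
  apply/cvg_EFin; first exact: nearW.
  apply: cvg_near_cst; exists N => // n /= /hN ->.
  by rewrite subrr normr0 expr0n.
- exact: iu.
- apply: aeW => x n _; rewrite abse_EFin lee_fin ger0_norm ?sqr_ge0//.
  rewrite lerXn2r ?nnegrE//.
  have [xI|xI] := boolP (x \in (`[- n%:R, n%:R]%classic : set T)).
    by rewrite trunc_id// subrr normr0.
  by rewrite trunc_out// sub0r normrN.
move: h; rewrite integral_cst// mul0e => h e e0.
have h0 : (\int[mu]_x (`|trunc u n x - u x| ^+ 2)%:E)%E @[n --> \oo] --> 0%E.
  exact: h.
have [N _ hN] := (cvge0P _ (fun n => sqint_ge0 mu (fun x => trunc u n x - u x))).1 h0 e e0.
by exists N => n Nn; exact: hN.
Qed.

(** One integral is over [-n, n], the other over the whole line. Paired with a vector through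
    [dot2], they become real integrals, for which extension by 0 is immediate. *)
Lemma truncated_fourierE n : truncated_fourier u n = FT (trunc u n).
Proof.
apply/funext => r; apply: dot2_ext => c.
have mI : measurable (`[- n%:R, n%:R]%classic : set T) by exact: measurable_itv.
have E s : s \in (`[- n%:R, n%:R]%classic : set T) ->
    cplx_scale (cexp (0 +i* (r * s))) (cplx_embed (u s)) = fphase (trunc u n) r s.
  move=> sI; rewrite /cplx_scale /fphase /cplx_embed trunc_id//= expR0.
  by rewrite !mul1r !scaler0 subr0 add0r.
have mf := borel_fphase da (borel_trunc n) r.
have if_ := integrable_fphase da (borel_trunc n) (integrable_trunc n) r.
apply: etrans; last exact: (esym (dot2_FT hd da Hc (borel_trunc n) (integrable_trunc n) r c)).
apply: etrans.
  apply: (bochner_pairing (dot2_pairing hd) mI da2 _ _ _ Hc2).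
  - refine (@eq_measurable_fun _ _ T (g_sigma_algebraType (@open (H * H)%type)) _ (fphase (trunc u n) r) _ _ _).
      by move=> s sI; rewrite E.
    exact: (measurable_funS measurableT).
  - apply: (eq_integrable mI (fun s => `|fphase (trunc u n) r s|%:E)).
      by move=> s sI; rewrite E.
    exact: (integrableS measurableT).
rewrite [LHS]Rintegral_mkcond; apply: eq_Rintegral => s _.
rewrite patchE; case: ifPn => sI; first by rewrite E.
by rewrite /dot2 /fphase (trunc_out u sI) !scaler0 !(ip0l hd) addr0.
Qed.

Lemma borel_FT_trunc n : borel_measurable (setT : set T) (FT (trunc u n)).
Proof. exact: (borel_FT hd da Hc (borel_trunc n) (integrable_trunc n)). Qed.

Lemma FT_trunc_cauchy m n :
  (sqint mu (fun r => FT (trunc u m) r - FT (trunc u n) r)%R <=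
   (3 * pi)%:E * sqint mu (fun s => trunc u m s - trunc u n s)%R)%E.
Proof.
have mD : borel_measurable (setT : set T) (fun s => trunc u m s - trunc u n s).
  by apply: (borelB da); exact: borel_trunc.
rewrite -(FTB (borel_trunc m) (integrable_trunc m) (borel_trunc n) (integrable_trunc n)).
apply: sqint_FT_le => //.
  apply: (sub_integrable measurableT da); by [exact: borel_trunc|exact: integrable_trunc].
by apply: (sqint_lty_sub da); by [exact: borel_trunc|exact: sqint_trunc_lty].
Qed.

Lemma L2_cplxE (g : R -> H * H) : L2 (@cplx_norm R H) g <->
  borel_measurable (setT : set T) g /\ (sqint mu g < +oo)%E.
Proof.
have E : (\int[mu]_x ((cplx_norm (g x)) ^+ 2)%:E = \int[mu]_r (dot2 (g r) (g r))%:E)%E.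
  by apply: eq_integral => x _; rewrite (cplx_normE hd).
have N0 : forall x : H * H, 0 <= cplx_norm x by move=> x; exact: sqrtr_ge0.
split=> -[mg h]; split => //.
  move/(L2norm_lty N0): h; rewrite E => h.
  by apply: le_lt_trans h; exact: sqint_dot2_ge.
apply/(L2norm_lty N0); rewrite E.
by apply: (le_lt_trans (sqint_dot2_le mg)); rewrite lte_mul_pinfty ?sqint_ge0.
Qed.

Lemma cplx_L2norm_cvg (f : nat -> R -> H * H) (g : R -> H * H) :
  (forall n, borel_measurable (setT : set T) (f n)) -> borel_measurable (setT : set T) g ->
  L2norm (@cplx_norm R H) (fun r => g r - f n r) @[n --> \oo] --> 0%E <->
  sq_to mu f g.
Proof.
move=> mf mg.
rewrite (L2norm_cvg0 _ _ (fun n r => g r - f n r)); last by move=> x; exact: sqrtr_ge0.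
rewrite (cvge0P _ (fun n => _)); last first.
  by move=> n; apply: integral_ge0 => x _; rewrite lee_fin sqr_ge0.
have mD n : borel_measurable (setT : set T) (fun r => g r - f n r).
  exact: (borelB da2).
have E n : (\int[mu]_x ((cplx_norm (g x - f n x)) ^+ 2)%:E =
    \int[mu]_r (dot2 (g r - f n r) (g r - f n r))%:E)%E.
  by apply: eq_integral => x _; rewrite (cplx_normE hd).
split=> h.
  move=> e /h[N _ hN]; exists N => n Nn; rewrite sqint_subC.
  by rewrite (le_trans (sqint_dot2_ge (mD n)))// -E; exact: hN.
move=> e e0; have [|N hN] := (@tends0Z _ 2 _ _ h) e e0 => //.
exists N => // n /= /hN h'; rewrite E (le_trans (sqint_dot2_le (mD n)))//.
by rewrite sqint_subC.
Qed.

(** Riesz-Fischer provides one limit of the truncated transforms. The set in which [fourier] chooses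
    is therefore inhabited, and whatever it chooses has the defining property. *)
Lemma fourier_spec : [/\ borel_measurable (setT : set T) (fourier u),
  (sqint mu (fourier u) < +oo)%E
  & sq_to mu (fun n => FT (trunc u n)) (fourier u)].
Proof.
have [|g mg hg] := riesz_fischer da2 Hc2 borel_FT_trunc (mu := mu).
  move=> e e0.
  have p0 : (0 <= 3 * pi :> R)%R by rewrite mulr_ge0 ?pi_ge0.
  have e4 : (0 < e / 4)%R by rewrite divr_gt0.
  have [N hN] := tends0Z p0 (tends0Z (ler0n _ 2) trunc_cvg) e4.
  exists N => m n /hN hm /hN hn; apply: (le_trans (FT_trunc_cauchy m n)).
  apply: (@le_trans _ _ ((3 * pi)%:E *
      (2%:E * sqint mu (fun s => trunc u m s - u s)%R +
       2%:E * sqint mu (fun s => trunc u n s - u s)%R))%E).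
    rewrite lee_wpmul2l ?lee_fin ?mulr_ge0 ?pi_ge0//.
    exact: (sqint_triangle mu da (borel_trunc m) mu_ (borel_trunc n)).
  rewrite ge0_muleDr ?mule_ge0 ?sqint_ge0//.
  rewrite (le_trans (leeD hm hn))// -EFinD lee_fin.
  have -> : e / 4 + e / 4 = e / 2 by field.
  by lra.
have sg : sq_to mu (fun n => FT (trunc u n)) g by exact: hg.
have Lg : L2 (@cplx_norm R H) g.
  apply/L2_cplxE; split => //.
  have [//|N hN] := sg 1.
  apply: (le_lt_trans (sqint_le_sub mu da2 mg (borel_FT_trunc N))).
  rewrite lte_add_pinfty// lte_mul_pinfty ?sqint_ge0//.
    by rewrite (le_lt_trans (hN N _))// ltry.
  apply: (le_lt_trans (sqint_FT_le (borel_trunc N) (integrable_trunc N) (sqint_trunc_lty N))).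
  by rewrite lte_mul_pinfty ?sqint_ge0 ?lee_fin ?mulr_ge0 ?pi_ge0// sqint_trunc_lty.
suff : L2 (@cplx_norm R H) (fourier u) /\
    L2norm (@cplx_norm R H) (fun r => fourier u r - truncated_fourier u n r)
      @[n --> \oo] --> 0%E.
  move=> [/L2_cplxE[mF qF] hF]; split => //.
  apply/(cplx_L2norm_cvg borel_FT_trunc mF).
  by under eq_fun do rewrite -truncated_fourierE.
rewrite /fourier; case: xgetP => [F -> []//|/(_ g)]; case; split => //.
under eq_fun do rewrite truncated_fourierE.
exact/(cplx_L2norm_cvg borel_FT_trunc mg).
Qed.

#[local] Opaque fourier.

Lemma fourier_unique g : borel_measurable (setT : set T) g ->
  sq_to mu (fun n => FT (trunc u n)) g -> {ae mu, forall r, fourier u r = g r}.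
Proof.
move=> mg sg; have [mF qF sF] := fourier_spec.
exact: (sq_to_unique da2 borel_FT_trunc).
Qed.

(** The constant is the 3 pi valid for truncations, times the 2 of [sqint_le_sub]. *)
Lemma sqint_fourier_le : (sqint mu (fourier u) <= (6 * pi)%:E * sqint mu u)%E.
Proof.
have [mF qF sF] := fourier_spec.
apply: (tends0_cst_le (tends0Z (ler0n _ 2) sF)) => n.
have h := sqint_le_sub mu da2 mF (borel_FT_trunc n).
apply: (le_trans h).
rewrite leeD2l//; have -> : (6 * pi = 2 * (3 * pi) :> R)%R by ring.
rewrite EFinM -muleA lee_wpmul2l//.
apply: (le_trans (sqint_FT_le (borel_trunc n) (integrable_trunc n) (sqint_trunc_lty n))).
by rewrite lee_wpmul2l ?lee_fin ?mulr_ge0 ?pi_ge0// sqint_trunc_le.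
Qed.

(** The constant is 1 for truncations, doubled once when [u] is replaced by its truncation and once
    more when the transform is. *)
Lemma sqint_fourier_ge : (sqint mu u <= 4%:E * sqint mu (fourier u))%E.
Proof.
have [mF qF sF] := fourier_spec.
have h := tends0D (tends0Z (ler0n _ 2) trunc_cvg) (tends0Z (ler0n _ 4) sF).
apply: (tends0_cst_le h) => n.
have h' := sqint_le_sub mu da mu_ (borel_trunc n).
apply: (le_trans h').
rewrite -addeA leeD2l//.
have -> : (4%:E = 2%:E * 2%:E :> \bar R)%E by rewrite -EFinM; congr EFin; ring.
rewrite -!muleA -ge0_muleDr ?mule_ge0 ?sqint_ge0// lee_wpmul2l//.
apply: (le_trans (sqint_FT_ge (borel_trunc n) (integrable_trunc n) (sqint_trunc_lty n))).
rewrite sqint_subC; exact: (sqint_le_sub mu da2 (borel_FT_trunc n) mF).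
Qed.

End fixed_u.

Lemma truncB (u v : R -> H) n : trunc (fun x => u x - v x) n = (fun x => trunc u n x - trunc v n x).
Proof. by apply/funext => s; rewrite /trunc scalerBr. Qed.

Lemma truncZ (k : R) (u : R -> H) n : trunc (fun x => k *: u x) n = (fun x => k *: trunc u n x).
Proof. by apply/funext => s; rewrite /trunc !scalerA mulrC. Qed.

(** The three transforms are representatives chosen independently, whence an equality almost
    everywhere. *)
Lemma fourierB (u v : R -> H) : borel_measurable (setT : set T) u -> (sqint mu u < +oo)%E ->
  borel_measurable (setT : set T) v -> (sqint mu v < +oo)%E ->
  {ae mu, forall r, fourier (fun x => u x - v x) r = fourier u r - fourier v r}.
Proof.
move=> mu_ qu mv qv.
have [mFu qFu sFu] := fourier_spec mu_ qu.
have [mFv qFv sFv] := fourier_spec mv qv.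
apply: fourier_unique.
- exact: (borelB da).
- exact: (sqint_lty_sub da).
- exact: (borelB da2 mFu mFv).
rewrite [X in sq_to _ X](_ : _ = fun n r => FT (trunc u n) r - FT (trunc v n) r).
  exact: (sq_toB da2 (borel_FT_trunc mu_ qu) (borel_FT_trunc mv qv) mFu mFv sFu sFv).
apply/funext => n; rewrite truncB FTB//; by [exact: borel_trunc|exact: integrable_trunc].
Qed.

Lemma fourierZ (k : R) (u : R -> H) : borel_measurable (setT : set T) u -> (sqint mu u < +oo)%E ->
  {ae mu, forall r, fourier (fun x => k *: u x) r = k *: fourier u r}.
Proof.
move=> mu_ qu.
have [mFu qFu sFu] := fourier_spec mu_ qu.
apply: fourier_unique.
- exact: (borel_scale da measurableT (measurable_cst k) mu_).
- by rewrite sqintZ// lte_mul_pinfty ?sqint_ge0 ?lee_fin ?sqr_ge0.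
- exact: (borel_scale da2 measurableT (measurable_cst k) mFu).
rewrite [X in sq_to _ X](_ : _ = fun n r => k *: FT (trunc u n) r).
  by apply: (sq_toZ da2) => //; exact: borel_FT_trunc.
apply/funext => n; rewrite truncZ FTZ//; by [exact: borel_trunc|exact: integrable_trunc].
Qed.

Lemma fourier_FT (w : R -> H) : borel_measurable (setT : set T) w ->
  mu.-integrable setT (fun x => `|w x|%:E) -> (sqint mu w < +oo)%E ->
  {ae mu, forall r, fourier w r = FT w r}.
Proof.
move=> mw iw qw; apply: fourier_unique => //; first exact: (borel_FT hd da Hc).
apply: (tends0_le (tends0Z _ (trunc_cvg mw qw) (C := 3 * pi))).
  by rewrite mulr_ge0 ?pi_ge0.
move=> n; rewrite -FTB//; [|exact: borel_trunc|exact: integrable_trunc].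
apply: sqint_FT_le.
- by apply: (borelB da) => //; exact: borel_trunc.
- apply: (sub_integrable measurableT da) => //; by [exact: borel_trunc|exact: integrable_trunc].
- by apply: (sqint_lty_sub da) => //; [exact: borel_trunc|exact: sqint_trunc_lty].
Qed.

End fourier_L2.

(** * Convolution with a probability measure on the half-line *)

Section bochner_integrable.
Context (R : realType) (E : normedModType R) (a : nat -> E) (da : dense_seq a).
Context d (T : measurableType d) (mu : {measure set T -> \bar R}) (D : set T).
Hypothesis mD : measurable D.

(** One simple function at finite L1 distance is enough. The contrapositive gives the value of a
    convolution at the points where its integral diverges. *)
Lemma is_bochner_integrable (f : T -> E) v : is_bochner_integral mu D f v ->
  mu.-integrable D (fun x => `|f x|%:E).
Proof.
move=> [mf [s [ss s0 _]]].
have [N _ hN] := (cvge0P _ (fun n => integral_ge0 _ (fun x _ =>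
  normr_ge0 (f x - s n x) : (0 <= `|f x - s n x|%:E)%E))).1 s0 1 ltr01.
have ms := simple_borel (ss N); have is_ := simple_integrable mD (ss N).
have mfs := borel_sub mD da mf ms.
have ifs : mu.-integrable D (fun x => `|f x - s N x|%:E).
  apply/integrableP; split; first exact/measurable_EFinP/borel_norm.
  under eq_integral do rewrite gee0_abs ?lee_fin//.
  by apply: le_lt_trans (ltry 1); exact: (hN N (leqnn N)).
apply: (le_integrable mD _ _ (integrableD mD ifs is_)).
  exact/measurable_EFinP/borel_norm.
move=> x _; rewrite lee_fin normr_id ger0_norm ?addr_ge0//.
by rewrite -{1}(subrK (s N x) (f x)) ler_normD.
Qed.

End bochner_integrable.

Section convolution.
Context (R : realType) (H : normedModType R) (dot : H -> H -> R)
  (hd : is_ip dot) (a : nat -> H) (da : dense_seq a) (Hc : seq_complete H).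
Local Notation mu := (@lebesgue_measure R).
Local Notation T := (measurableTypeR R).
Context (nu : probability T R) (nuD : nu `[0, +oo[%classic = 1%E).
Local Notation D := (`[0, +oo[%classic : set T).

Let mD : measurable D. Proof. exact: measurable_itv. Qed.

Let nuDC : nu (~` D) = 0%E.
Proof. by rewrite probability_setC// nuD subee. Qed.

(** The convolution is defined over [0, oo), but Fubini and translations act on the whole line; this
    moves between the two. *)
Lemma ge0_integral_half (f : T -> \bar R) : measurable_fun setT f ->
  (forall x, 0 <= f x)%E -> (\int[nu]_(x in D) f x = \int[nu]_x f x)%E.
Proof.
move=> mf f0; rewrite [RHS](@ge0_negligible_integral _ _ _ nu _ (~` D))//.
  by rewrite setTD setCK.
exact: measurableC.
Qed.

Lemma integral_half (f : T -> \bar R) : measurable_fun setT f ->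
  (\int[nu]_(x in D) f x = \int[nu]_x f x)%E.
Proof.
move=> mf; rewrite integralE [RHS]integralE !ge0_integral_half//.
- exact: measurable_funeneg.
- exact: measurable_funepos.
Qed.

Lemma integrable_half (f : T -> \bar R) : measurable_fun setT f ->
  nu.-integrable D f <-> nu.-integrable setT f.
Proof.
move=> mf; split=> /integrableP[_ h]; apply/integrableP; split => //.
- by rewrite -ge0_integral_half//; exact: measurableT_comp.
- exact: measurable_funTS.
- by rewrite ge0_integral_half//; exact: measurableT_comp.
Qed.

Definition conv (u : R -> H) (r : R) : H :=
  bochner_integral nu D (fun s : R => Defs.rshift s u r).

Definition conv_dom (u : R -> H) : set T :=
  [set r | \int[nu]_s `|u (r - s)|%:E < +oo]%E.

Lemma measurable_subl (r : R) : measurable_fun (setT : set T) (fun s : T => r - s : T).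
Proof. exact: measurable_funB (measurable_cst r) (@measurable_id _ _ _). Qed.

Section fixed_u.
Context (u : R -> H) (mu_ : borel_measurable (setT : set T) u)
  (u0 : forall r, r < 0 -> u r = 0).

(* Unqualified, rshift is the map of ordinals from fintype. *)
Lemma rshiftE s r : Defs.rshift s u r = u (r - s).
Proof. by rewrite /Defs.rshift; case: leP => // /u0. Qed.

Lemma borel_subl r : borel_measurable (setT : set T) (fun s : T => u (r - s)).
Proof. exact: (measurableT_comp mu_ (measurable_subl r)). Qed.

Lemma borel_sub2 : borel_measurable (setT : set (T * T)) (fun z => u (z.1 - z.2)).
Proof. exact: (measurableT_comp mu_ (@measurable_diff2 R)). Qed.

Lemma measurable_conv_dom : measurable (conv_dom u).
Proof.
have mF : measurable_fun (setT : set T) (fun r => \int[nu]_s `|u (r - s)|%:E)%E.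
  apply: (measurable_fun_fubini_tonelli_F (m2 := nu)
    (fun z : T * T => `|u (z.1 - z.2)|%:E)).
    apply/measurable_EFinP; exact: (borel_norm measurableT borel_sub2).
  by move=> z; rewrite lee_fin.
by have := emeasurable_fun_infty_o measurableT mF +oo; rewrite setTI.
Qed.

Lemma conv_domP r : conv_dom u r <-> nu.-integrable setT (fun s => `|u (r - s)|%:E).
Proof.
have m1 : measurable_fun (setT : set T) (fun s => `|u (r - s)|%:E).
  by apply/measurable_EFinP; exact: (borel_norm measurableT (borel_subl r)).
split=> [h|/integrableP[_]].
  apply/integrableP; split => //.
  by under eq_integral do rewrite gee0_abs ?lee_fin//.
by under eq_integral do rewrite gee0_abs ?lee_fin//.
Qed.

Let convE r : conv u r = bochner_integral nu D (fun s : R => u (r - s)).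
Proof. by congr bochner_integral; apply/funext => s; exact: rshiftE. Qed.

Let mfD r : borel_measurable D (fun s : T => u (r - s)).
Proof. exact: (measurable_funS measurableT (@subsetT _ D) (borel_subl r)). Qed.

(** At such a point there is no Bochner integral, so [bochner_integral] takes its default 0. Knowing
    this value makes [conv u] Borel on the whole line. *)
Lemma conv_out r : ~ conv_dom u r -> conv u r = 0.
Proof.
move=> h; rewrite convE /bochner_integral; case: xgetP => // v _ hv.
exfalso; apply/h/conv_domP/integrable_half.
  by apply/measurable_EFinP; exact: (borel_norm measurableT (borel_subl r)).
exact: (is_bochner_integrable da mD hv).
Qed.

Lemma dot_conv r c : conv_dom u r ->
  dot (conv u r) c = \int[nu]_s dot (u (r - s)) c.
Proof.
move=> /conv_domP h; rewrite convE.
apply: etrans.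
  apply: (bochner_pairing (ip_pairing hd) mD da (mfD r) _ c Hc).
  apply/(integrable_half _).2 => //.
  by apply/measurable_EFinP; exact: (borel_norm measurableT (borel_subl r)).
rewrite /Rintegral integral_half//.
apply/measurable_EFinP; apply: (measurable_dot hd da); first exact: borel_subl.
exact: borel_cst.
Qed.

Lemma borel_conv : borel_measurable (setT : set T) (conv u).
Proof.
apply: (weak_borel hd da) => c.
rewrite (_ : (fun x => dot (conv u x) c) = fun r : T =>
    \1_(conv_dom u) r * \int[nu]_s dot (u (r - s)) c).
  apply: measurable_funM.
    by apply: measurable_indic; exact: measurable_conv_dom.
  apply: (measurable_Rintegral nu (f := fun z : T * T => dot (u (z.1 - z.2)) c)).
  apply: (measurable_dot hd da); [exact: borel_sub2|exact: borel_cst].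
apply/funext => r; rewrite indicE; have [rG|rG] := boolP (r \in conv_dom u).
  by rewrite mul1r dot_conv//; rewrite inE in rG.
rewrite conv_out ?(ip0l hd) ?mul0r//.
by move=> h; move/negP: rG; apply; rewrite inE.
Qed.

Lemma conv_neg r : r < 0 -> conv u r = 0.
Proof.
move=> r0; have [h|] := pselect (conv_dom u r); last exact: conv_out.
apply: (ip_ext hd) => c; rewrite (ip0l hd) dot_conv//.
rewrite /Rintegral -integral_half; last first.
  apply/measurable_EFinP; apply: (measurable_dot hd da); first exact: borel_subl.
  exact: borel_cst.
rewrite (eq_integral (cst 0%E)) ?integral0// => s; rewrite inE /= in_itv/= andbT => s0.
by rewrite u0 ?(ip0l hd)// subr_lt0 (lt_le_trans r0).
Qed.

(* Jensen without a convexity theory: with w = conv u r,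
   2 |w|^2 is the integral of 2 <u (r - s), w> <= |u (r - s)|^2 + |w|^2. *)
Lemma norm_conv_sqr r : ((`|conv u r| ^+ 2)%:E <= \int[nu]_s (`|u (r - s)| ^+ 2)%:E)%E.
Proof.
have [h|/conv_out ->] := pselect (conv_dom u r); last first.
  by rewrite normr0 expr0n; apply: integral_ge0 => s _; rewrite lee_fin.
set w := conv u r.
have m2 : measurable_fun (setT : set T) (fun s : T => `|u (r - s)| ^+ 2).
  exact: (measurable_funX 2 (borel_norm measurableT (borel_subl r))).
have [hlt|] := ltP (\int[nu]_s (`|u (r - s)| ^+ 2)%:E)%E +oo%E; last first.
  by rewrite leye_eq => /eqP ->; rewrite leey.
have i2 : nu.-integrable setT (fun s => (`|u (r - s)| ^+ 2)%:E).
  apply/integrableP; split; first exact/measurable_EFinP.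
  by under eq_integral do rewrite gee0_abs ?lee_fin ?sqr_ge0//.
have i0 : nu.-integrable setT (cst (`|w| ^+ 2)%:E).
  exact: finite_measure_integrable_cst.
have idot : nu.-integrable setT (fun s => (dot (u (r - s)) w)%:E).
  apply: (pairing_integrable (ip_pairing hd) measurableT); first exact: borel_subl.
  exact/conv_domP.
have E0 : `|w| ^+ 2 = \int[nu]_s dot (u (r - s)) w by rewrite -dot_conv// (ip_norm hd).
have E1 : \int[nu]_s (`|u (r - s)| ^+ 2 + cst (`|w| ^+ 2) s) =
    \int[nu]_s (`|u (r - s)| ^+ 2) + `|w| ^+ 2.
  rewrite RintegralD// Rintegral_cst//.
  congr (_ + _); rewrite -[RHS]mulr1; congr (_ * _).
  exact: (congr1 fine (probability_setT nu)).
have : 2 * `|w| ^+ 2 <= \int[nu]_s (`|u (r - s)| ^+ 2) + `|w| ^+ 2.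
  rewrite -E1 {1}E0 -RintegralZl//; apply: le_Rintegral => //.
  - exact: (integrableZl measurableT 2 idot).
  - exact: (integrableD measurableT i2 i0).
  - move=> s _ /=; have := ler_norm (dot (u (r - s)) w); have := ip_cs hd (u (r - s)) w.
    have := sqr_ge0 (`|u (r - s)| - `|w|); lra.
rewrite mulr2n mulrDl !mul1r lerD2r => h1.
rewrite -(@fineK _ (\int[nu]_s _)%E) ?lee_fin//.
exact: (integrable_fin_num measurableT i2).
Qed.

Lemma norm_conv_le r : (`|conv u r|%:E <= \int[nu]_s `|u (r - s)|%:E)%E.
Proof.
have [h|/conv_out ->] := pselect (conv_dom u r); last first.
  by rewrite normr0; apply: integral_ge0 => s _; rewrite lee_fin.
have i1 := (conv_domP r).1 h.
have i1f := integrable_fin_num measurableT i1.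
have [->|w0] := eqVneq (conv u r) 0.
  by rewrite normr0; apply: integral_ge0 => s _; rewrite lee_fin.
have nw : 0 < `|conv u r| by rewrite normr_gt0.
rewrite -(fineK i1f) lee_fin -(ler_pM2r nw) -expr2 -(ip_norm hd) dot_conv//.
rewrite -[leRHS]RintegralZr//; apply: le_Rintegral => //.
- apply: (pairing_integrable (ip_pairing hd) measurableT) => //; exact: borel_subl.
- exact: (integrableZr measurableT _ i1).
- by move=> s _; rewrite (le_trans (ler_norm _))// ip_cs.
Qed.

(** Tonelli puts the translation inside, where Lebesgue measure does not see it; [nu] has mass 1. *)
Lemma ge0_integral_conv (f : T -> R) : measurable_fun setT f -> (forall x, 0 <= f x) ->
  (\int[mu]_r \int[nu]_s (f (r - s))%:E = \int[mu]_x (f x)%:E)%E.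
Proof.
move=> mf f0.
rewrite (@fubini_tonelli _ _ T T R mu nu (fun z => (f (z.1 - z.2))%:E)).
- rewrite (eq_integral (cst (\int[mu]_x (f x)%:E)%E)).
    rewrite integral_cst//.
    rewrite -[RHS]mule1; congr (_ * _)%E; exact: (probability_setT nu).
  move=> s _ /=; rewrite -(ge0_integral_shift (- s) (f := EFin \o f))//.
  exact/measurable_EFinP.
- by apply/measurable_EFinP; exact: (measurableT_comp mf (@measurable_diff2 R)).
- by move=> z; rewrite lee_fin.
Qed.

Lemma sqint_conv_le : (sqint mu (conv u) <= sqint mu u)%E.
Proof.
have m1 : measurable_fun (setT : set T) (fun x => `|u x| ^+ 2).
  exact: (measurable_funX 2 (borel_norm measurableT mu_)).
rewrite [leRHS]/sqint -(ge0_integral_conv m1)//.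
apply: ge0_le_integral => //.
- by apply: sq_measurable; exact: borel_conv.
- apply: (measurable_fun_fubini_tonelli_F (m2 := nu)
    (fun z : T * T => (`|u (z.1 - z.2)| ^+ 2)%:E)).
    by apply/measurable_EFinP; exact: (measurableT_comp m1 (@measurable_diff2 R)).
  by move=> z; rewrite lee_fin.
- by move=> r _; exact: norm_conv_sqr.
Qed.

Lemma integrable_conv : mu.-integrable setT (fun x => `|u x|%:E) ->
  mu.-integrable setT (fun x => `|conv u x|%:E).
Proof.
move=> /integrableP[_ iu].
have m1 : measurable_fun (setT : set T) (fun x => `|u x|) by exact: (borel_norm measurableT mu_).
apply/integrableP; split.
  by apply/measurable_EFinP; apply: borel_norm => //; exact: borel_conv.
under eq_integral do rewrite gee0_abs ?lee_fin//.
apply: le_lt_trans iu.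
under [leRHS]eq_integral do rewrite gee0_abs ?lee_fin//.
rewrite -(ge0_integral_conv m1)//.
apply: ge0_le_integral => //.
- by apply/measurable_EFinP; apply: borel_norm => //; exact: borel_conv.
- apply: (measurable_fun_fubini_tonelli_F (m2 := nu)
    (fun z : T * T => (`|u (z.1 - z.2)|)%:E)).
    by apply/measurable_EFinP; exact: (measurableT_comp m1 (@measurable_diff2 R)).
  by move=> z; rewrite lee_fin.
- by move=> r _; exact: norm_conv_le.
Qed.

(** By Tonelli, |u (r - s)|^2 is [nu]-integrable in s for almost every r, and t <= 1 + t^2 with [nu]
    finite passes to the first power. *)
Lemma ae_conv_dom : (sqint mu u < +oo)%E -> {ae mu, forall r, conv_dom u r}.
Proof.
move=> qu.
have m1 : measurable_fun (setT : set T) (fun x => `|u x| ^+ 2).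
  exact: (measurable_funX 2 (borel_norm measurableT mu_)).
have /(integrable_ae measurableT) h : mu.-integrable setT
    (fun r => \int[nu]_s (`|u (r - s)| ^+ 2)%:E)%E.
  apply/integrableP; split.
    apply: (measurable_fun_fubini_tonelli_F (m2 := nu)
      (fun z : T * T => (`|u (z.1 - z.2)| ^+ 2)%:E)).
      by apply/measurable_EFinP; exact: (measurableT_comp m1 (@measurable_diff2 R)).
    by move=> z; rewrite lee_fin.
  under eq_integral do rewrite gee0_abs ?integral_ge0//.
  by have := ge0_integral_conv m1 (fun x => sqr_ge0 _) => ->.
apply: filterS h => r /(_ I) hr.
have m2 : measurable_fun (setT : set T) (fun s : T => `|u (r - s)| ^+ 2).
  exact: (measurable_funX 2 (borel_norm measurableT (borel_subl r))).
apply/conv_domP.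
have i2 : nu.-integrable setT (fun s => (`|u (r - s)| ^+ 2)%:E).
  apply/integrableP; split; first exact/measurable_EFinP.
  under eq_integral do rewrite gee0_abs ?lee_fin ?sqr_ge0//.
  by rewrite -ge0_fin_numE// integral_ge0.
have i0 : nu.-integrable setT (cst (1 : R)%:E) by exact: finite_measure_integrable_cst.
apply: (le_integrable measurableT _ _ (integrableD measurableT i0 i2)).
  by apply/measurable_EFinP; exact: (borel_norm measurableT (borel_subl r)).
move=> s _; rewrite lee_fin normr_id ger0_norm ?addr_ge0//.
have := sqr_ge0 (`|u (r - s)| - 2^-1); move: (`|u (r - s)|) => t; rewrite sqrrB => /=; nra.
Qed.

End fixed_u.

Lemma conv_dom_sub u v : borel_measurable (setT : set T) u ->
  borel_measurable (setT : set T) v ->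
  forall r, conv_dom u r -> conv_dom v r -> conv_dom (fun x => u x - v x) r.
Proof.
move=> mu_ mv r /(conv_domP mu_) hu /(conv_domP mv) hv.
apply/(conv_domP (borelB da mu_ mv)).
exact: (sub_integrable measurableT da (borel_subl mu_ r) (borel_subl mv r) hu hv).
Qed.

Lemma convB u v : borel_measurable (setT : set T) u ->
  (forall r, r < 0 -> u r = 0) -> (sqint mu u < +oo)%E ->
  borel_measurable (setT : set T) v ->
  (forall r, r < 0 -> v r = 0) -> (sqint mu v < +oo)%E ->
  {ae mu, forall r, conv (fun x => u x - v x) r = conv u r - conv v r}.
Proof.
move=> mu_ u0 qu mv v0 qv.
have h1 := ae_conv_dom mu_ qu; have h2 := ae_conv_dom mv qv.
move: h1 h2; apply: filterS2.
move=> r hu hv; apply: (ip_ext hd) => c.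
have uv0 x : x < 0 -> u x - v x = 0 by move=> x0; rewrite u0// v0// subrr.
have huv := conv_dom_sub mu_ mv hu hv.
rewrite (ipBl hd) (dot_conv (borelB da mu_ mv) uv0)// (dot_conv mu_ u0)// (dot_conv mv v0)//.
rewrite -RintegralB//.
- by apply: eq_Rintegral => s _; rewrite (ipBl hd).
- apply: (pairing_integrable (ip_pairing hd) measurableT); first exact: (borel_subl mu_).
  exact/(conv_domP mu_).
- apply: (pairing_integrable (ip_pairing hd) measurableT); first exact: (borel_subl mv).
  exact/(conv_domP mv).
Qed.

Definition charfun (r : R) : R[i] :=
  (\int[nu]_s cos (r * s)) +i* (\int[nu]_s sin (r * s)).

(** The real part of e^{-i r x} c, that is, the phase of [fphase] moved to the other side of
    [dot2]. *)
Let wave (r : R) (c : H * H) (x : R) : H := cos (r * x) *: c.1 + sin (r * x) *: c.2.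

Let dot_wave (v : H) r c x : dot v (wave r c x) =
  cos (r * x) * dot v c.1 + sin (r * x) * dot v c.2.
Proof. by rewrite (ipDr hd) !(ipZr hd). Qed.

Let dot_wave_le (v : H) r c x : `|dot v (wave r c x)| <= `|v| * (`|c.1| + `|c.2|).
Proof.
rewrite (le_trans (ip_cs hd _ _))// ler_wpM2l// (le_trans (ler_normD _ _))//.
by rewrite !normrZ lerD// ler_piMl// ?cos_max ?sin_max.
Qed.

Let borel_wave r c : borel_measurable (setT : set T) (wave r c).
Proof.
apply: (borel_add da) => //; apply: (borel_scale da) => //;
  by [exact: measurable_cosl|exact: measurable_sinl|exact: borel_cst].
Qed.

Let dot2_fphase_wave w r c x : dot2 dot (fphase w r x) c = dot (w x) (wave r c x).
Proof. by rewrite /dot2 /= !(ipZl hd) dot_wave. Qed.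

(** The addition formula for e^{-i r (x + s)} c, in which (c.2, - c.1) is -i c. *)
Let wave_shift (v : H) r c x s : dot v (wave r c (x + s)) =
  cos (r * s) * dot v (wave r c x) + sin (r * s) * dot v (wave r (c.2, - c.1) x).
Proof.
have N y : dot v (- y) = - dot v y by rewrite -scaleN1r (ipZr hd) mulN1r.
by rewrite !dot_wave /= N mulrDr cosD sinD; ring.
Qed.

Section fixed_L1.
Context (u : R -> H) (mu_ : borel_measurable (setT : set T) u)
  (u0 : forall r, r < 0 -> u r = 0)
  (iu : mu.-integrable setT (fun x => `|u x|%:E)).

Let mcu := borel_conv mu_ u0.
Let icu := integrable_conv mu_ u0 iu.

Let ae_dom : {ae mu, forall r, conv_dom u r}.
Proof.
have m1 : measurable_fun (setT : set T) (fun x => `|u x|) by exact: (borel_norm measurableT mu_).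
have /(integrable_ae measurableT) h : mu.-integrable setT
    (fun r => \int[nu]_s `|u (r - s)|%:E)%E.
  apply/integrableP; split.
    apply: (measurable_fun_fubini_tonelli_F (m2 := nu)
      (fun z : T * T => `|u (z.1 - z.2)|%:E)).
      by apply/measurable_EFinP; exact: (measurableT_comp m1 (@measurable_diff2 R)).
    by move=> z; rewrite lee_fin.
  under eq_integral do rewrite gee0_abs ?integral_ge0//.
  have := ge0_integral_conv m1 (fun x => normr_ge0 _) => ->.
  move: iu => /integrableP[_]; by under eq_integral do rewrite gee0_abs ?lee_fin//.
apply: filterS h => r /(_ I) hr.
by rewrite /conv_dom /= -ge0_fin_numE// integral_ge0.
Qed.

(** After Fubini, translation by s puts the phase at x + s, and [wave_shift] separates s from x. The
    integrals in s are the two components of [charfun], those in x are pairings of [FT u r] with c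
    and with -i c. *)
Lemma FT_conv r : FT (conv u) r = cplx_scale (charfun r) (FT u r).
Proof.
apply: (dot2_ext hd) => c.
apply: etrans; first exact: (dot2_FT hd da Hc mcu icu r c).
have mf : measurable_fun (setT : set (T * T))
    (fun z => dot (u (z.1 - z.2)) (wave r c z.1)).
  apply: (measurable_dot hd da); first exact: borel_sub2.
  exact: (measurableT_comp (borel_wave r c) measurable_fst).
have K0 : 0 <= `|c.1| + `|c.2| by rewrite addr_ge0.
have flty : (\int[mu]_x \int[nu]_s `|dot (u (x - s)) (wave r c x)|%:E < +oo)%E.
  have m1 : measurable_fun (setT : set T) (fun x => `|u x| * (`|c.1| + `|c.2|)).
    by apply: measurable_funM => //; exact: (borel_norm measurableT mu_).
  have := ge0_integral_conv m1 (fun x => mulr_ge0 (normr_ge0 _) K0) => /= E.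
  apply: (@le_lt_trans _ _ (\int[mu]_x (`|u x| * (`|c.1| + `|c.2|))%:E)%E).
    rewrite -E; apply: ge0_le_integral => //.
    - by move=> x _; apply: integral_ge0 => s _; rewrite lee_fin.
    - apply: (measurable_fun_fubini_tonelli_F (m2 := nu)
        (fun z : T * T => `|dot (u (z.1 - z.2)) (wave r c z.1)|%:E)).
        by apply/measurable_EFinP; exact: measurableT_comp.
      by move=> z; rewrite lee_fin.
    - apply: (measurable_fun_fubini_tonelli_F (m2 := nu)
        (fun z : T * T => (`|u (z.1 - z.2)| * (`|c.1| + `|c.2|))%:E)).
        by apply/measurable_EFinP; exact: (measurableT_comp m1 (@measurable_diff2 R)).
      by move=> z; rewrite lee_fin mulr_ge0.
    - move=> x _; apply: ge0_le_integral => //.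
      + apply/measurable_EFinP; apply: measurableT_comp => //.
        apply: (measurable_dot hd da); [exact: borel_subl|exact: borel_cst].
      + by apply/measurable_EFinP; exact: (measurableT_comp m1 (measurable_subl x)).
      + by move=> s _; rewrite lee_fin.
  have /integrableP[_] := integrableZr measurableT (`|c.1| + `|c.2|) iu.
  by under eq_integral do rewrite -EFinM gee0_abs ?lee_fin ?mulr_ge0//.
have iw c' : mu.-integrable setT (fun x => (dot (u x) (wave r c' x))%:E).
  have := integrable_dot2_fphase hd da mu_ iu r c'.
  by apply: eq_integrable => // x _; rewrite dot2_fphase_wave.
apply: (@etrans _ _ (\int[mu]_x \int[nu]_s dot (u (x - s)) (wave r c x))).
  rewrite /Rintegral; congr fine; apply: ae_eq_integral => //.
  - apply/measurable_EFinP; under eq_fun do rewrite dot2_fphase_wave.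
    by apply: (measurable_dot hd da) => //; exact: borel_wave.
  - apply/measurable_EFinP.
    exact: (measurable_Rintegral nu (f := fun z : T * T => dot (u (z.1 - z.2)) (wave r c z.1))).
  - apply: filterS ae_dom => x xG _.
    by rewrite dot2_fphase_wave (dot_conv mu_ u0).
rewrite (@Rfubini _ _ T T _ mu nu (fun z : T * T => dot (u (z.1 - z.2)) (wave r c z.1)))//=.
have mw c' : measurable_fun (setT : set T) (fun x => dot (u x) (wave r c' x)).
  by apply: (measurable_dot hd da) => //; exact: borel_wave.
pose A := \int[mu]_x dot (u x) (wave r c x).
pose B := \int[mu]_x dot (u x) (wave r (c.2, - c.1) x).
have E s : \int[mu]_x dot (u (x - s)) (wave r c x) = cos (r * s) * A + sin (r * s) * B.
  have m1 : measurable_fun (setT : set T) (fun x => dot (u x) (wave r c (x + s))).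
    by under eq_fun do rewrite wave_shift; apply: measurable_funD; apply: measurable_funM.
  apply: (@etrans _ _ (\int[mu]_x dot (u x) (wave r c (x + s)))).
    rewrite /Rintegral -[in RHS](integral_shift (- s)); last exact/measurable_EFinP.
    by congr fine; apply: eq_integral => x _; rewrite /= subrK.
  under eq_Rintegral do rewrite wave_shift.
  rewrite RintegralD//; last 2 first.
  - exact: (integrableZl measurableT _ (iw c)).
  - exact: (integrableZl measurableT _ (iw (c.2, - c.1))).
  by rewrite !RintegralZl//; exact: iw.
under eq_Rintegral do rewrite E.
have icos : nu.-integrable setT (fun s => (cos (r * s))%:E).
  apply: measurable_bounded_integrable => //.
  - by rewrite (le_lt_trans (probability_le1 nu measurableT))// ltry.
  - exact: measurable_cosl.
  - by exists 1; split => // M M1 x _ /=; rewrite (le_trans _ (ltW M1))// cos_max.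
have isin : nu.-integrable setT (fun s => (sin (r * s))%:E).
  apply: measurable_bounded_integrable => //.
  - by rewrite (le_lt_trans (probability_le1 nu measurableT))// ltry.
  - exact: measurable_sinl.
  - by exists 1; split => // M M1 x _ /=; rewrite (le_trans _ (ltW M1))// sin_max.
rewrite RintegralD//; last 2 first.
- exact: (integrableZr measurableT _ icos).
- exact: (integrableZr measurableT _ isin).
rewrite !RintegralZr//.
have -> : A = dot2 dot (FT u r) c.
  apply: (etrans _ (esym (dot2_FT hd da Hc mu_ iu r c))).
  by apply: eq_Rintegral => x _; rewrite dot2_fphase_wave.
have -> : B = dot2 dot (FT u r) (c.2, - c.1).
  apply: (etrans _ (esym (dot2_FT hd da Hc mu_ iu r (c.2, - c.1)))).
  by apply: eq_Rintegral => x _; rewrite dot2_fphase_wave.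
rewrite /charfun /cplx_scale /dot2 /=.
rewrite (ipBl hd) (ipDl hd) !(ipZl hd) -[- c.1]scaleN1r (ipZr hd); ring.
Qed.

End fixed_L1.

End convolution.

(** * Convolution as multiplication by the characteristic function, in L2 *)

Section fourier_convolution.
Context (R : realType) (H : normedModType R) (dot : H -> H -> R)
  (hd : is_ip dot) (a : nat -> H) (da : dense_seq a) (Hc : seq_complete H).
Local Notation mu := (@lebesgue_measure R).
Local Notation T := (measurableTypeR R).
Local Notation da2 := (dense_seq_pair da da).

Lemma cplx_scaleBr (m : R[i]) (x y : H * H) :
  cplx_scale m (x - y) = cplx_scale m x - cplx_scale m y.
Proof.
rewrite /cplx_scale /= !scalerBr; congr pair => /=.
  by rewrite !opprD !opprK addrACA.
by rewrite !opprD addrACA.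
Qed.

Lemma cplx_scale_bound (C : R) (m : R[i]) (x : H * H) :
  `|complex.Re m| <= C -> `|complex.Im m| <= C ->
  `|cplx_scale m x| <= (2 * C) * `|x|.
Proof.
move=> hr hi.
have [h1 h2] : `|x.1| <= `|x| /\ `|x.2| <= `|x|.
  by split; rewrite prod_normE /= le_max lexx ?orbT.
have C0 : 0 <= C by exact: le_trans hr.
have -> : 2 * C * `|x| = C * `|x| + C * `|x| by ring.
rewrite {1}prod_normE /cplx_scale /= ge_max; apply/andP; split.
  by rewrite (le_trans (ler_normB _ _))// !normrZ lerD// ler_pM.
by rewrite (le_trans (ler_normD _ _))// !normrZ lerD// ler_pM.
Qed.

Lemma borel_cplx_scale (m : R -> R[i]) (g : R -> H * H) :
  measurable_fun (setT : set T) (fun r => complex.Re (m r)) ->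
  measurable_fun (setT : set T) (fun r => complex.Im (m r)) ->
  borel_measurable (setT : set T) g ->
  borel_measurable (setT : set T) (fun r => cplx_scale (m r) (g r)).
Proof.
move=> mr mi mg; rewrite /cplx_scale.
have m1 := borel_fst measurableT mg; have m2 := borel_snd measurableT mg.
have m11 := borel_scale da measurableT mr m1.
have m12 := borel_scale da measurableT mr m2.
have m21 := borel_scale da measurableT mi m1.
have m22 := borel_scale da measurableT mi m2.
apply: (borel_pair da da measurableT); first exact: (borelB da m11 m22).
exact: (borel_add da measurableT m12 m21).
Qed.

Lemma sqint_cplx_scale (C : R) (m : R -> R[i]) (g : R -> H * H) :
  measurable_fun (setT : set T) (fun r => complex.Re (m r)) ->
  measurable_fun (setT : set T) (fun r => complex.Im (m r)) ->
  borel_measurable (setT : set T) g ->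
  (forall r, `|complex.Re (m r)| <= C) -> (forall r, `|complex.Im (m r)| <= C) ->
  (sqint mu (fun r => cplx_scale (m r) (g r)) <= ((2 * C) ^+ 2)%:E * sqint mu g)%E.
Proof.
move=> mr mi mg hr hi.
rewrite -(sqintZ mu (2 * C) mg).
apply: le_sqint.
- exact: borel_cplx_scale.
- exact: (borel_scale da2 measurableT (measurable_cst _) mg).
move=> r; rewrite (le_trans (cplx_scale_bound _ (hr r) (hi r)))//.
by rewrite normrZ ler_wpM2r// ler_norm.
Qed.

Context (nu : probability T R) (nuD : nu `[0, +oo[%classic = 1%E).

Lemma measurable_charfun :
  measurable_fun (setT : set T) (fun r => complex.Re (charfun nu r)) /\
  measurable_fun (setT : set T) (fun r => complex.Im (charfun nu r)).
Proof.
split.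
  apply: (measurable_Rintegral nu (f := fun z : T * T => cos (z.1 * z.2))).
  exact: measurableT_comp (@measurable_cos R) (@measurable_mul2 R).
apply: (measurable_Rintegral nu (f := fun z : T * T => sin (z.1 * z.2))).
exact: measurableT_comp (@measurable_sin R) (@measurable_mul2 R).
Qed.

Lemma prob_bound (f : T -> R) : measurable_fun setT f -> (forall x, `|f x| <= 1) ->
  `|\int[nu]_x f x| <= 1.
Proof.
move=> mf f1.
have if_ : nu.-integrable setT (EFin \o f).
  apply: measurable_bounded_integrable => //.
    by rewrite (le_lt_trans (probability_le1 nu measurableT))// ltry.
  by exists 1; split => // M M1 x _ /=; rewrite (le_trans _ (ltW M1)).
rewrite (le_trans (le_normr_Rintegral _ _))//.
have -> : 1 = \int[nu]_x (cst 1 x) :> R.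
  rewrite Rintegral_cst// mul1r; exact: (esym (congr1 fine (probability_setT nu))).
apply: le_Rintegral => //.
- exact: integrable_norm.
- exact: finite_measure_integrable_cst.
Qed.

Lemma charfun_bound r : `|complex.Re (charfun nu r)| <= 1 /\
  `|complex.Im (charfun nu r)| <= 1.
Proof.
split; apply: prob_bound; [exact: measurable_cosl|by move=> x; exact: cos_max|
  exact: measurable_sinl|by move=> x; exact: sin_max].
Qed.

Context (u : R -> H) (mu_ : borel_measurable (setT : set T) u)
  (u0 : forall r, r < 0 -> u r = 0) (qu : (sqint mu u < +oo)%E).

Let un0 n r : r < 0 -> trunc u n r = 0.
Proof. by move=> r0; rewrite /trunc u0// scaler0. Qed.

(** Both sides are continuous in [u] for the L2 norm, and [FT_conv] gives the equality for the
    truncations, which are in L1 and still vanish on the negative half-line. *)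
Lemma fourier_conv :
  {ae mu, forall r, fourier (conv nu u) r = cplx_scale (charfun nu r) (fourier u r)}.
Proof.
have [mr mi] := measurable_charfun.
have [mF qF sF] := fourier_spec hd da Hc mu_ qu.
have mun n := borel_trunc da mu_ n.
have qun n := sqint_trunc_lty da mu_ qu n.
have iun n := integrable_trunc da mu_ qu n.
have mc := borel_conv hd da Hc nuD mu_ u0.
have mcn n := borel_conv hd da Hc nuD (mun n) (@un0 n).
have qc := le_lt_trans (sqint_conv_le hd da Hc nuD mu_ u0) qu.
have qcn n := le_lt_trans (sqint_conv_le hd da Hc nuD (mun n) (@un0 n)) (qun n).
have icn n := integrable_conv hd da Hc nuD (mun n) (@un0 n) (iun n).
have [mFc qFc _] := fourier_spec hd da Hc mc qc.
have mg := borel_cplx_scale mr mi mF.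
have mFn n := borel_FT_trunc hd da Hc mu_ qu n.
have mFcn n : borel_measurable (setT : set T) (FT (conv nu (trunc u n))).
  exact: (borel_FT hd da Hc (mcn n) (icn n)).
suff : sqint mu (fun r => fourier (conv nu u) r - cplx_scale (charfun nu r) (fourier u r)) = 0%E.
  move=> /(sqint_eq0 (borelB da2 mFc mg)); apply: filterS => r /eqP.
  by rewrite subr_eq0 => /eqP.
apply: tends0_const; first exact: sqint_ge0.
have p6 : 0 <= 6 * pi :> R by rewrite mulr_ge0 ?pi_ge0.
(* The first error uses the bound 6 pi of the transform and the contractivity of the convolution; in
   the second, (2 * 1)^2 is the cost of a multiplier with components at most 1. *)
apply: (tends0_le (tends0D
  (tends0Z (ler0n R 2) (tends0Z p6 (trunc_cvg da mu_ qu)))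
  (tends0Z (ler0n R 2) (tends0Z (sqr_ge0 (2 * 1)) sF)))) => n /=.
apply: (le_trans (sqint_subadd mu da2 mFc (mFcn n) mg)).
apply: leeD.
  rewrite lee_wpmul2l//.
  have mB := borelB da mc (mcn n).
  have qB := sqint_lty_sub da mc (mcn n) qc (qcn n).
  have [mFB _ _] := fourier_spec hd da Hc mB qB.
  have e1 : {ae mu, forall r, fourier (fun x => conv nu u x - conv nu (trunc u n) x) r =
      fourier (conv nu u) r - FT (conv nu (trunc u n)) r}.
    have h1 := fourierB hd da Hc mc qc (mcn n) (qcn n).
    have h2 := fourier_FT hd da Hc (mcn n) (icn n) (qcn n).
    by apply: (@filterS2 _ (almost_everywhere mu) _ _ _ _ _ h1 h2) => r -> ->.
  rewrite -(ae_eq_sqint mFB (borelB da2 mFc (mFcn n)) e1).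
  apply: (le_trans (sqint_fourier_le hd da Hc mB qB)).
  rewrite lee_wpmul2l ?lee_fin//.
  have mD := borelB da mu_ (mun n).
  have D0 r : r < 0 -> u r - trunc u n r = 0 by move=> r0; rewrite u0// un0// subrr.
  have mcD := borel_conv hd da Hc nuD mD D0.
  have e2 := convB hd da Hc nuD mu_ u0 qu (mun n) (@un0 n) (qun n).
  rewrite -(ae_eq_sqint mcD mB e2).
  apply: (le_trans (sqint_conv_le hd da Hc nuD mD D0)).
  by rewrite sqint_subC.
rewrite lee_wpmul2l//.
have -> : (fun r => FT (conv nu (trunc u n)) r - cplx_scale (charfun nu r) (fourier u r)) =
    (fun r => cplx_scale (charfun nu r) (FT (trunc u n) r - fourier u r)).
  apply/funext => r.
  by rewrite cplx_scaleBr (FT_conv hd da Hc nuD (mun n) (@un0 n) (iun n)).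
apply: sqint_cplx_scale => //.
- exact: (borelB da2 (mFn n) mF).
- by move=> r; case: (charfun_bound r).
- by move=> r; case: (charfun_bound r).
Qed.

End fourier_convolution.

(** * The complex exponential as a power series *)

Section complex_norm.
Context (R : realType).
Import ComplexField.Normc.
Implicit Types z w : R[i].

Lemma ReD z w : complex.Re (z + w) = complex.Re z + complex.Re w.
Proof. by case: z; case: w. Qed.

Lemma ImD z w : complex.Im (z + w) = complex.Im z + complex.Im w.
Proof. by case: z; case: w. Qed.

Lemma ReN z : complex.Re (- z) = - complex.Re z.
Proof. by case: z. Qed.

Lemma ImN z : complex.Im (- z) = - complex.Im z.
Proof. by case: z. Qed.

Lemma ReM z w : complex.Re (z * w) =
  complex.Re z * complex.Re w - complex.Im z * complex.Im w.
Proof. by case: z; case: w. Qed.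

Lemma ImM z w : complex.Im (z * w) =
  complex.Re z * complex.Im w + complex.Im z * complex.Re w.
Proof. by case: z; case: w. Qed.

Lemma complex_eq z w : complex.Re z = complex.Re w -> complex.Im z = complex.Im w -> z = w.
Proof. by case: z => a b; case: w => c d /= -> ->. Qed.

Lemma normc_ge0 z : 0 <= normc z.
Proof. by case: z => x y; exact: sqrtr_ge0. Qed.

Lemma normcD z w : normc (z + w) <= normc z + normc w.
Proof. exact: le_normcD. Qed.

Lemma normcB z w : normc (z - w) <= normc z + normc w.
Proof. by rewrite -(normcN w) normcD. Qed.

Lemma normc_distC z w : normc (z - w) = normc (w - z).
Proof. by rewrite -normcN opprB. Qed.

Lemma normcX z n : normc (z ^+ n) = normc z ^+ n.
Proof. by elim: n => [|n ih]; rewrite ?expr0 ?normc1// !exprS normcM ih. Qed.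

Lemma normc_real (x : R) : normc x%:C = `|x|.
Proof. by rewrite /normc /= expr0n addr0 sqrtr_sqr. Qed.

Lemma normc_sum I (r : seq I) (P : pred I) (F : I -> R[i]) :
  normc (\sum_(i <- r | P i) F i) <= \sum_(i <- r | P i) normc (F i).
Proof.
elim/big_ind2 : _ => [|x y z w xy zw|//]; first by rewrite normc0.
by rewrite (le_trans (normcD _ _))// lerD.
Qed.

Lemma Re_le_normc z : `|complex.Re z| <= normc z.
Proof.
case: z => x y /=; rewrite -[leLHS]ger0_norm// -sqrtr_sqr.
by rewrite ler_wsqrtr// real_normK ?num_real// lerDl sqr_ge0.
Qed.

Lemma Im_le_normc z : `|complex.Im z| <= normc z.
Proof.
case: z => x y /=; rewrite -[leLHS]ger0_norm// -sqrtr_sqr.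
by rewrite ler_wsqrtr// real_normK ?num_real// lerDr sqr_ge0.
Qed.

Lemma normc_le z : normc z <= `|complex.Re z| + `|complex.Im z|.
Proof.
case: z => x y /=; rewrite -[leRHS]ger0_norm ?addr_ge0// -sqrtr_sqr.
rewrite ler_wsqrtr// sqrrD !real_normK ?num_real//.
by rewrite addrAC lerDl mulrn_wge0// mulr_ge0.
Qed.

Lemma normc_sqr z : normc z ^+ 2 = complex.Re z ^+ 2 + complex.Im z ^+ 2.
Proof. by case: z => x y /=; rewrite sqr_sqrtr// addr_ge0 ?sqr_ge0. Qed.

Lemma cexpD z w : cexp (z + w) = cexp z * cexp w.
Proof.
apply: complex_eq; rewrite ?ReM ?ImM /= ReD ImD expRD ?cosD ?sinD; ring.
Qed.

Lemma cexp_real (x : R) : cexp x%:C = (expR x)%:C.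
Proof. by rewrite /cexp /= cos0 sin0 mulr1 mulr0. Qed.

Lemma normc_cexp z : normc (cexp z) = expR (complex.Re z).
Proof.
rewrite /cexp /normc !exprMn -mulrDr cos2Dsin2 mulr1 sqrtr_sqr.
by rewrite ger0_norm// expR_ge0.
Qed.

End complex_norm.

Section exponential_sums.

(** Over a general field, so that the sum at a complex z can be compared with the sum at the real
    number |z|. *)
Definition expsum (F : numFieldType) (K : nat) (z : F) : F :=
  \sum_(n < K) z ^+ n / n`!%:R.

Section cauchy_product.
Context (F : numFieldType).
Implicit Types a b : F.

Let t a b i j : F := a ^+ i / i`!%:R * (b ^+ j / j`!%:R).

Lemma expsum_add a b K : expsum K (a + b) =
  \sum_(j < K) \sum_(i < K | (i + j < K)%N) t a b i j.
Proof.
have E n : (a + b) ^+ n / n`!%:R = \sum_(j < n.+1) t a b (n - j) j.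
  rewrite exprDn big_distrl /=; apply: eq_bigr => j _.
  have jn : (j <= n)%N by rewrite -ltnS.
  have f0 m : (m`!%:R : F) != 0 by rewrite pnatr_eq0 -lt0n fact_gt0.
  rewrite /t -(bin_fact jn) !natrM -mulr_natr; field.
  rewrite !f0 pnatr_eq0 -lt0n bin_gt0 jn; done.
rewrite /expsum; under eq_bigr do rewrite E.
have E2 (n : 'I_K) : \sum_(j < n.+1) t a b (n - j) j =
    \sum_(j < K | (j <= n)%N) t a b (n - j) j.
  by rewrite (big_ord_widen K (fun j => t a b (n - j) j)).
under eq_bigr do rewrite E2.
rewrite (exchange_big_dep xpredT)//=; apply: eq_bigr => j _.
rewrite -(big_mkord (fun n => j <= n)%N (fun n => t a b (n - j) j)).
rewrite -(big_mkord (fun i => i + j < K)%N (fun i => t a b i j)).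
rewrite (big_cat_nat (n := j)) //=; last by rewrite ltnW.
rewrite big_nat_cond big_pred0 ?add0r; last first.
  by move=> i; rewrite ltnNge; case: (j <= i)%N; rewrite ?andbF.
rewrite -{1}(add0n (j : nat)) big_addn.
rewrite [RHS](big_cat_nat (n := (K - j)%N)) //=; last exact: leq_subr.
rewrite [X in _ + X]big_nat_cond [X in _ + X]big_pred0 ?addr0; last first.
  move=> i; rewrite leq_subLR (addnC (j : nat)) (ltnNge (i + j)); case: (K <= i + j)%N; by rewrite ?andbF.
rewrite big_nat_cond [RHS]big_nat_cond; apply: eq_big => i.
  by rewrite leq_addl andbT ltn_subRL addnC; case: ltnP; rewrite ?andbF.
by rewrite addnK.
Qed.

(** The defect of multiplicativity is the block i, j < K <= i + j of the Cauchy product. Its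
    coefficients are positive, so it is dominated by the same defect at the moduli. *)
Lemma expsum_mul a b K : expsum K a * expsum K b - expsum K (a + b) =
  \sum_(j < K) \sum_(i < K | ~~ (i + j < K)%N) t a b i j.
Proof.
have -> : expsum K a * expsum K b = \sum_(j < K) \sum_(i < K) t a b i j.
  by rewrite mulrC big_distrl; apply: eq_bigr => j _; rewrite big_distrr /=;
    apply: eq_bigr => i _; rewrite mulrC.
rewrite expsum_add -sumrB; apply: eq_bigr => j _.
by rewrite (bigID (fun i : 'I_K => i + j < K)%N) /= addrC addrK.
Qed.

End cauchy_product.

End exponential_sums.

Section complex_exponential.
Context (R : realType).
Import ComplexField.Normc.
Implicit Types z w : R[i].

Lemma expsum_cvg (x : R) : expsum K x @[K --> \oo] --> expR x.
Proof.
have := @is_cvg_series_exp_coeff R x; rewrite /expR /expsum.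
rewrite (_ : (fun K => _) = series (exp_coeff x))//.
by apply/funext => K; rewrite /series /= big_mkord.
Qed.

Lemma expsum_le (x : R) K : 0 <= x -> expsum K x <= expR x.
Proof.
move=> x0; apply: (@cvgr_to_ge _ \oo _ _ _ _ _ (@expsum_cvg x)).
exists K => // n /= Kn; rewrite /expsum -!(big_mkord xpredT (fun n => x ^+ n / n`!%:R)).
rewrite (big_cat_nat (n := K) (leq0n _) Kn) /= lerDl sumr_ge0// => i _.
by rewrite divr_ge0// exprn_ge0.
Qed.

Lemma normc_term z n : normc (z ^+ n / n`!%:R) = normc z ^+ n / n`!%:R.
Proof.
rewrite normcM normcX normcV; congr (_ / _).
by rewrite -[n`!%:R](rmorph_nat (@real_complex R)) normc_real normr_nat.
Qed.

Lemma normc_expsum z K : normc (expsum K z) <= expsum K (normc z).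
Proof.
apply: le_trans (normc_sum _ _ _) _; apply: ler_sum => n _.
by rewrite normc_term.
Qed.

Lemma expsum_addB z w K : normc (expsum K z * expsum K w - expsum K (z + w)) <=
  expsum K (normc z) * expsum K (normc w) - expsum K (normc z + normc w).
Proof.
rewrite !expsum_mul; apply: le_trans (normc_sum _ _ _) _; apply: ler_sum => j _.
apply: le_trans (normc_sum _ _ _) _; apply: ler_sum => i _.
by rewrite normcM !normc_term.
Qed.

Lemma expsum_real (x : R) K : expsum K x%:C = (expsum K x)%:C.
Proof.
rewrite /expsum rmorph_sum; apply: eq_bigr => n _.
by rewrite rmorphM rmorphXn fmorphV rmorph_nat.
Qed.

Lemma im_exp (y : R) n : (0 +i* y : R[i]) ^+ n =
  ((~~ odd n)%:R * (-1) ^+ n./2 * y ^+ n) +i* ((odd n)%:R * (-1) ^+ n.-1./2 * y ^+ n).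
Proof.
have sq : (0 +i* y : R[i]) ^+ 2 = (- y ^+ 2)%:C.
  by rewrite expr2; apply: complex_eq; rewrite ?ReM ?ImM /= ?expr2; ring.
have E m : (0 +i* y : R[i]) ^+ m.*2 = ((-1) ^+ m * y ^+ m.*2)%:C.
  by rewrite -muln2 mulnC !exprM sq -rmorphXn -exprMn mulN1r.
have [no|ne] := boolP (odd n).
  have -> : n = n.-1./2.*2.+1 by rewrite even_halfK ?prednK ?odd_gt0// -subn1 oddB ?odd_gt0// no.
  rewrite exprS E /= doubleK.
  by apply: complex_eq; rewrite ?ReM ?ImM /= ?exprS; ring.
have -> : n = n./2.*2 by rewrite even_halfK.
rewrite E doubleK ?odd_double.
by apply: complex_eq => /=; ring.
Qed.

Lemma expsum_im (y : R) K : expsum K (0 +i* y) =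
  (series (cos_coeff y) K) +i* (series (sin_coeff y) K).
Proof.
rewrite /expsum /series /= !big_mkord.
elim: K => [|K ih]; first by rewrite !big_ord0.
rewrite !big_ord_recr /= ih im_exp.
have -> : (K`!%:R : R[i])^-1 = (K`!%:R^-1)%:C by rewrite fmorphV rmorph_nat.
apply: complex_eq; rewrite ?ReD ?ImD ?ReM ?ImM /= mulr0 ?subr0 ?add0r; congr (_ + _).
Qed.

Lemma cvg_normc (u : nat -> R[i]) (z : R[i]) :
  complex.Re (u n) @[n --> \oo] --> complex.Re z ->
  complex.Im (u n) @[n --> \oo] --> complex.Im z ->
  normc (u n - z) @[n --> \oo] --> (0 : R).
Proof.
move=> hr hi.
have h : `|complex.Re (u n) - complex.Re z| + `|complex.Im (u n) - complex.Im z|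
    @[n --> \oo] --> (0 : R).
  rewrite -[X in _ --> X]addr0; apply: cvgD.
    by rewrite -(@normr0 _ R) -(subrr (complex.Re z)); apply: cvg_norm; apply: cvgB => //; exact: cvg_cst.
  by rewrite -(@normr0 _ R) -(subrr (complex.Im z)); apply: cvg_norm; apply: cvgB => //; exact: cvg_cst.
apply: (squeeze_cvgr _ (cvg_cst 0) h); apply: nearW => n.
by rewrite normc_ge0 -ReN -ReD -ImN -ImD normc_le.
Qed.

(** With z = x + i y, the sum at z is compared with the product of the sums at x and at i y, which
    are the series of the exponential, cosine and sine. The defect is dominated by the one at |x|
    and |y|, which vanishes in the limit because [expR] is multiplicative. *)
Lemma expsum_cexp z : normc (expsum K z - cexp z) @[K --> \oo] --> (0 : R).
Proof.
pose x := complex.Re z; pose y := complex.Im z.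
have zE : z = x%:C + (0 +i* y) by apply: complex_eq; rewrite ?ReD ?ImD /= ?addr0 ?add0r.
pose A := normc x%:C; pose B := normc (0 +i* y).
have hexp : expsum K A * expsum K B - expsum K (A + B) @[K --> \oo] --> (0 : R).
  rewrite -(subrr (expR (A + B))); apply: cvgB; last exact: expsum_cvg.
  by rewrite expRD; apply: cvgM; exact: expsum_cvg.
have himag : normc (expsum K x%:C * expsum K (0 +i* y) - cexp z) @[K --> \oo] --> (0 : R).
  have hc : series (cos_coeff y) K @[K --> \oo] --> cos y.
    have := @is_cvg_series_cos_coeff R y; by rewrite cos.unlock.
  have hs : series (sin_coeff y) K @[K --> \oo] --> sin y.
    have := @is_cvg_series_sin_coeff R y; by rewrite sin.unlock.
  apply: cvg_normc.
    under eq_fun do rewrite expsum_real expsum_im ReM /= mul0r subr0.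
    by apply: cvgM => //; exact: expsum_cvg.
  under eq_fun do rewrite expsum_real expsum_im ImM /= mul0r addr0.
  by apply: cvgM => //; exact: expsum_cvg.
have h : expsum K A * expsum K B - expsum K (A + B) +
    normc (expsum K x%:C * expsum K (0 +i* y) - cexp z) @[K --> \oo] --> (0 : R).
  by rewrite -[X in _ --> X]addr0; exact: cvgD.
apply: (squeeze_cvgr _ (cvg_cst 0) h); apply: nearW => K.
rewrite normc_ge0 /= {1}zE.
have -> : expsum K (x%:C + (0 +i* y)) - cexp z =
  - (expsum K x%:C * expsum K (0 +i* y) - expsum K (x%:C + (0 +i* y))) +
  (expsum K x%:C * expsum K (0 +i* y) - cexp z).
  by rewrite opprB addrA subrK.
by rewrite (le_trans (normcD _ _))// normcN lerD2r; exact: expsum_addB.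
Qed.

(** A Lipschitz bound on the disk of radius [C], uniform in [K]: z^n - w^n is z - w times n terms of
    modulus at most C^(n-1). *)
Lemma normc_expsum_sub (C : R) z w K : normc z <= C -> normc w <= C ->
  normc (expsum K z - expsum K w) <= normc (z - w) * expR C.
Proof.
move=> zC wC; have C0 : 0 <= C by exact: le_trans (normc_ge0 z) zC.
apply: (@le_trans _ _ (normc (z - w) * expsum K C)); last first.
  by rewrite ler_wpM2l ?normc_ge0// expsum_le.
case: K => [|K]; first by rewrite /expsum !big_ord0 subrr normc0 mulr0.
rewrite /expsum -sumrB; apply: le_trans (normc_sum _ _ _) _.
rewrite big_ord_recl [X in normc X + _](_ : _ = 0); last by rewrite /= ?expr0 subrr.
rewrite normc0 add0r.
rewrite [in leRHS]big_ord_recr /= mulrDr mulr_sumr ler_wpDr//.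
  by rewrite mulr_ge0 ?normc_ge0// divr_ge0// exprn_ge0.
apply: ler_sum => n _.
rewrite -mulrBl normcM subrXX normcM -mulrA ler_wpM2l ?normc_ge0//.
rewrite normcV -[_`!%:R](rmorph_nat (@real_complex R)) normc_real normr_nat.
rewrite ler_pdivrMr ?ltr0n ?fact_gt0//.
rewrite /bump /= add1n factS natrM [X in _ * X]mulrC mulrA divfK ?pnatr_eq0 -?lt0n ?fact_gt0//.
apply: le_trans (normc_sum _ _ _) _.
apply: (@le_trans _ _ (\sum_(i < n.+1) C ^+ n)); last first.
  by rewrite sumr_const card_ord mulr_natr.
apply: ler_sum => i _; rewrite normcM !normcX.
have -> : C ^+ n = C ^+ (n - i) * C ^+ i by rewrite -exprD subnK// -ltnS.
by rewrite add0n ler_pM ?exprn_ge0 ?normc_ge0// lerXn2r ?nnegrE ?normc_ge0.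
Qed.

(** The boolean tells whether the constant term is removed: e^z serves for the probability law, e^z
    - 1 for the kernel measure, whose mass may be infinite. With 0 < K that term is present in the
    sum. *)
Lemma expsum_sub_bool (b : bool) z K : (0 < K)%N ->
  normc (expsum K z - b%:R) <= expsum K (normc z) - b%:R.
Proof.
case: K => // K _; case: b; last by rewrite !subr0 normc_expsum.
rewrite /expsum !big_ord_recl /= ?expr0 fact0 !divr1 addrC addKr [leRHS]addrC addKr.
apply: le_trans (normc_sum _ _ _) _; apply: ler_sum => n _.
by rewrite normc_term.
Qed.

Lemma normc_cexp_sub (b : bool) z : normc (cexp z - b%:R) <= expR (normc z) - b%:R.
Proof.
have h : normc (expsum K z - cexp z) + (expsum K (normc z) - b%:R)
    @[K --> \oo] --> expR (normc z) - b%:R.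
  rewrite -[X in _ --> X]add0r; apply: cvgD; first exact: expsum_cexp.
  by apply: cvgB; [exact: expsum_cvg|exact: cvg_cst].
apply: (@cvgr_to_ge _ \oo _ _ _ _ _ h); exists 1%N => // K /= K0.
have -> : cexp z - b%:R = - (expsum K z - cexp z) + (expsum K z - b%:R).
  by rewrite opprB addrA subrK.
by rewrite (le_trans (normcD _ _))// normcN lerD2l expsum_sub_bool.
Qed.

End complex_exponential.

(** * Power series with nonnegative coefficients *)

Section power_series.
Context (R : realType).
Import ComplexField.Normc.
Implicit Types (p q : {poly R}) (z w : R[i]).

Lemma cvg_sum_ord (u : nat -> nat -> R) (l : nat -> R) n :
  (forall i, u K i @[K --> \oo] --> l i) ->
  \sum_(i < n) u K i @[K --> \oo] --> \sum_(i < n) l i.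
Proof.
move=> h; elim: n => [|n ih].
  by under eq_fun do rewrite big_ord0; rewrite big_ord0; exact: cvg_cst.
by under eq_fun do rewrite big_ord_recr; rewrite big_ord_recr; exact: cvgD.
Qed.

Definition ceval p w : R[i] := (map_poly (@real_complex R) p).[w].

Lemma ceval_coef p w n : (size p <= n)%N ->
  ceval p w = \sum_(i < n) (p`_i)%:C * w ^+ i.
Proof.
move=> sp; rewrite /ceval (horner_coef_wide (n := n)) ?size_map_poly//.
by apply: eq_bigr => i _; rewrite coef_map.
Qed.

Lemma ceval_real p (x : R) : ceval p x%:C = (p.[x])%:C.
Proof. by rewrite /ceval horner_map. Qed.

Lemma normc_ceval_sub p q w n : (size p <= n)%N -> (size q <= n)%N ->
  normc (ceval p w - ceval q w) <= \sum_(i < n) `|p`_i - q`_i| * normc w ^+ i.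
Proof.
move=> sp sq; rewrite (ceval_coef w sp) (ceval_coef w sq) -sumrB.
apply: le_trans (normc_sum _ _ _) _; apply: ler_sum => i _.
by rewrite -mulrBl normcM -rmorphB normc_real normcX.
Qed.

Definition coef_le p q : Prop := forall i, 0 <= p`_i /\ p`_i <= q`_i.

Lemma coef_leM p q (p' q' : {poly R}) : coef_le p q -> coef_le p' q' -> coef_le (p * p') (q * q').
Proof.
move=> h h' i; rewrite !coefM; split.
  by apply: sumr_ge0 => j _; rewrite mulr_ge0//; [case: (h j)|case: (h' (i - j)%N)].
apply: ler_sum => j _; case: (h j) => ? ?; case: (h' (i - j)%N) => ? ?.
by rewrite ler_pM.
Qed.

Lemma coef_leX p q n : coef_le p q -> coef_le (p ^+ n) (q ^+ n).
Proof.
move=> h; elim: n => [|n ih]; last by rewrite !exprS; exact: coef_leM.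
by rewrite !expr0 => i; rewrite lexx coef1 ler0n.
Qed.

Lemma coef_leZ (c : R) p q : 0 <= c -> coef_le p q -> coef_le (c *: p) (c *: q).
Proof.
by move=> c0 h i; rewrite !coefZ mulr_ge0 ?ler_wpM2l//; case: (h i).
Qed.

(** A power series with nonnegative coefficients, given by polynomials growing towards it instead of
    by its coefficients; in this form, composition with the exponential is an operation on
    polynomials. *)
Record psrep (rho : R) (Phi : R[i] -> R[i]) (Q : nat -> {poly R}) : Prop := Psrep {
  psrep_le : forall K, coef_le (Q K) (Q K.+1) ;
  psrep_cvg : forall w, normc w < rho ->
    normc (Phi w - ceval (Q K) w) @[K --> \oo] --> (0 : R) }.

Lemma psrepZ rho Phi Q (c : R) : 0 <= c -> psrep rho Phi Q ->
  psrep rho (fun w => c%:C * Phi w) (fun K => c *: Q K).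
Proof.
move=> c0 [h1 h2]; split=> [K|w /h2 h]; first exact: coef_leZ.
have E K : normc (c%:C * Phi w - ceval (c *: Q K) w) = c * normc (Phi w - ceval (Q K) w).
  by rewrite /ceval linearZ /= hornerZ -mulrBr normcM normc_real ger0_norm.
under eq_fun do rewrite E.
by rewrite -(mulr0 c); apply: cvgM => //; exact: cvg_cst.
Qed.

Definition exppoly K (p : {poly R}) : {poly R} := \sum_(n < K) n`!%:R^-1 *: p ^+ n.

Lemma ceval_exppoly K p w : ceval (exppoly K p) w = expsum K (ceval p w).
Proof.
rewrite /ceval /exppoly /expsum rmorph_sum horner_sum; apply: eq_bigr => n _.
rewrite -[GRing.RMorphism.sort _ _]/(map_poly (@real_complex R) (n`!%:R^-1 *: p ^+ n)).
by rewrite map_polyZ hornerZ rmorphXn horner_exp /= fmorphV rmorph_nat mulrC.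
Qed.

(** The length of the exponential sum and the inner polynomial grow together. The error splits into
    that of the exponential sum at the limit point and the Lipschitz bound [normc_expsum_sub]. *)
Lemma psrep_exp rho Phi Q : psrep rho Phi Q ->
  psrep rho (fun w => cexp (Phi w)) (fun K => exppoly K (Q K)).
Proof.
move=> [h1 h2]; split=> [K i|w /h2 h].
  have f0 n : 0 <= n`!%:R^-1 :> R by rewrite invr_ge0.
  rewrite /exppoly big_ord_recr /= coefD !coef_sum; split.
    by apply: sumr_ge0 => n _; have [] := coef_leZ (f0 n) (coef_leX n (h1 K)) i.
  rewrite ler_wpDr//; first by have [] := coef_leZ (f0 K) (coef_leX K (h1 K.+1)) i.
  by apply: ler_sum => n _; have [] := coef_leZ (f0 n) (coef_leX n (h1 K)) i.
(* From some index on, the polynomials at [w] are within 1 of [z], hence in the disk of radius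
   [C]. *)
set z := Phi w; pose C := normc z + 1.
have hC : normc (expsum K z - cexp z) + normc (z - ceval (Q K) w) * expR C
    @[K --> \oo] --> (0 : R).
  rewrite -[X in _ --> X]addr0; apply: cvgD; first exact: expsum_cexp.
  by rewrite -(mul0r (expR C)); apply: cvgM => //; exact: cvg_cst.
apply: (squeeze_cvgr _ (cvg_cst 0) hC).
have /cvgr0Pnorm_le/(_ 1 ltr01) := h; apply: filterS => K hK.
rewrite normc_ge0 /= ceval_exppoly.
have -> : cexp z - expsum K (ceval (Q K) w) =
    - (expsum K z - cexp z) + (expsum K z - expsum K (ceval (Q K) w)).
  by rewrite opprB addrA subrK.
rewrite (le_trans (normcD _ _))// normcN lerD2l normc_expsum_sub ?lerDl//.
rewrite -[ceval _ _](subrK z) addrC (le_trans (normcD _ _))// lerD2l.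
by rewrite normc_distC (le_trans (ler_norm _)).
Qed.

Section unique.
Context (rho : R) (rho0 : 0 < rho).

Lemma psrep_mono Phi Q i : psrep rho Phi Q ->
  {homo (fun K => (Q K)`_i) : m n / (m <= n)%N >-> m <= n}.
Proof.
move=> [h _]; apply: homo_leq => //; first exact: le_trans.
by move=> K; case: (h K i).
Qed.

Lemma psrep_coef_ge0 Phi Q K i : psrep rho Phi Q -> 0 <= (Q K)`_i.
Proof. by move=> [h _]; case: (h K i). Qed.

Lemma horner_wide_mono p q n (x : R) : (size p <= n)%N -> 0 <= x ->
  (forall i, 0 <= q`_i) -> (forall i, p`_i <= q`_i) -> p.[x] <= q.[x].
Proof.
move=> sp x0 q0 pq.
rewrite (horner_coef_wide _ (leq_trans sp (leq_maxl n (size q)))).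
rewrite (horner_coef_wide _ (leq_maxr n (size q))).
by apply: ler_sum => i _; rewrite ler_wpM2r ?exprn_ge0.
Qed.

Lemma psrep_horner_cvg Phi Q (x : R) : psrep rho Phi Q -> 0 <= x < rho ->
  (Q K).[x] @[K --> \oo] --> complex.Re (Phi x%:C).
Proof.
move=> [_ h] /andP[x0 xr].
have /h hx : normc x%:C < rho by rewrite normc_real ger0_norm.
apply/cvgrPdist_le => e e0; have /cvgr0Pnorm_le/(_ e e0) := hx.
apply: filterS => K; rewrite ger0_norm ?normc_ge0//; apply: le_trans.
by rewrite ceval_real (le_trans _ (Re_le_normc _))// ReD ReN.
Qed.

Lemma psrep_horner_le Phi Q (x : R) K : psrep rho Phi Q -> 0 <= x < rho ->
  (Q K).[x] <= complex.Re (Phi x%:C).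
Proof.
move=> h xr; have hx := psrep_horner_cvg h xr.
apply: (@cvgr_to_ge _ \oo _ _ _ _ _ hx); exists K => // n /= Kn.
case/andP: xr => x0 _; apply: (horner_wide_mono (leqnn _)) => // i.
  exact: (psrep_coef_ge0 _ _ h).
exact: (psrep_mono i h).
Qed.

(** A Cauchy estimate at rho/2: by positivity a single term is bounded by the whole sum. *)
Lemma psrep_coef_cvg Phi Q i : psrep rho Phi Q -> cvgn (fun K => (Q K)`_i).
Proof.
move=> h; apply: nondecreasing_is_cvgn; first exact: (psrep_mono i h).
pose y := rho / 2; have y0 : 0 < y by rewrite divr_gt0.
have yr : 0 <= y < rho by rewrite ltW//= ltr_pdivrMr// ltr_pMr// ltr1n.
exists (complex.Re (Phi y%:C) / y ^+ i) => _ [K _ <-].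
rewrite ler_pdivlMr ?exprn_gt0//; apply: le_trans (psrep_horner_le K h yr).
rewrite (horner_coef_wide _ (leq_maxl (size (Q K)) i.+1)).
rewrite (bigD1 (Ordinal (leq_maxr (size (Q K)) i.+1)))//= lerDl.
apply: sumr_ge0 => j _; apply: mulr_ge0; last by rewrite exprn_ge0// ltW.
exact: (psrep_coef_ge0 _ _ h).
Qed.

(** In the tail, (x/y)^i <= (x/y)^n since x <= y. *)
Lemma horner_tail p n (x y : R) : (forall i, 0 <= p`_i) -> 0 <= x -> x <= y -> 0 < y ->
  0 <= p.[x] - \sum_(i < n) p`_i * x ^+ i <= (x / y) ^+ n * p.[y].
Proof.
move=> p0 x0 xy y0; have y0' := ltW y0.
have E (t : R) : p.[t] = \sum_(i < n) p`_i * t ^+ i +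
    \sum_(i < size p) p`_(n + i) * t ^+ (n + i).
  by rewrite (horner_coef_wide _ (leq_addl n (size p))) big_split_ord.
rewrite (E x) addrC addrA addNr add0r; apply/andP; split.
  by apply: sumr_ge0 => i _; rewrite mulr_ge0 ?exprn_ge0.
apply: (@le_trans _ _ ((x / y) ^+ n * \sum_(i < size p) p`_(n + i) * y ^+ (n + i))).
  rewrite mulr_sumr; apply: ler_sum => i _.
  rewrite mulrCA ler_wpM2l// !exprD exprMn exprVn -mulrA mulKf ?expf_neq0 ?gt_eqF//.
  by rewrite ler_wpM2l ?exprn_ge0// lerXn2r ?nnegrE.
rewrite ler_wpM2l ?exprn_ge0 ?divr_ge0// E lerDr.
by apply: sumr_ge0 => i _; rewrite mulr_ge0 ?exprn_ge0.
Qed.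

Context (Phi Psi : R[i] -> R[i]) (Q P : nat -> {poly R})
  (hQ : psrep rho Phi Q) (hP : psrep rho Psi P)
  (eq_real : forall x : R, 0 <= x < rho -> Phi x%:C = Psi x%:C).

Let q i := limn (fun K => (Q K)`_i).
Let p i := limn (fun K => (P K)`_i).

(* If the coefficients below n agree, the partial sums differ by
   |q n - p n| x^n, while the tails are O(x^(n+1)). *)
Lemma psrep_coef_eq i : q i = p i.
Proof.
elim/ltn_ind: i => n ih.
pose y := rho / 2; have y0 : 0 < y by rewrite divr_gt0.
have yr : 0 <= y < rho by rewrite ltW//= ltr_pdivrMr// ltr_pMr// ltr1n.
clearbody y; pose C := complex.Re (Phi y%:C) / y ^+ n.+1.
have C0 : 0 <= C.
  rewrite divr_ge0 ?exprn_ge0 ?(ltW y0)//; apply: le_trans (psrep_horner_le 0 hQ yr).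
  rewrite horner_coef sumr_ge0// => i _.
  apply: mulr_ge0; last by rewrite exprn_ge0// ltW.
  exact: (psrep_coef_ge0 _ _ hQ).
have key x : 0 < x -> x <= y -> `|q n - p n| * x ^+ n <= C * x ^+ n.+1.
  move=> x0 xy.
  have xr : 0 <= x < rho by rewrite ltW//= (le_lt_trans xy)//; case/andP: yr.
  have hl : `|\sum_(i < n.+1) (Q K)`_i * x ^+ i - \sum_(i < n.+1) (P K)`_i * x ^+ i|
      @[K --> \oo] --> `|q n - p n| * x ^+ n.
    have -> : `|q n - p n| * x ^+ n =
        `|\sum_(i < n.+1) q i * x ^+ i - \sum_(i < n.+1) p i * x ^+ i|.
      rewrite -sumrB big_ord_recr /= big1 ?add0r.
        by rewrite -mulrBl normrM (ger0_norm (exprn_ge0 n (ltW x0))).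
      by move=> i _; rewrite ih// subrr.
    apply: cvg_norm; apply: cvgB.
      apply: (cvg_sum_ord (u := fun K i => (Q K)`_i * x ^+ i) (l := fun i => q i * x ^+ i)) => i.
      apply: cvgM; last exact: cvg_cst.
      by apply: (psrep_coef_cvg hQ).
    apply: (cvg_sum_ord (u := fun K i => (P K)`_i * x ^+ i) (l := fun i => p i * x ^+ i)) => i.
    apply: cvgM; last exact: cvg_cst.
    by apply: (psrep_coef_cvg hP).
  have hr : `|(Q K).[x] - (P K).[x]| + C * x ^+ n.+1 @[K --> \oo] --> C * x ^+ n.+1.
    rewrite -[X in _ --> X]add0r; apply: cvgD; last exact: cvg_cst.
    rewrite -(@normr0 _ R) -(subrr (complex.Re (Phi x%:C))); apply: cvg_norm.
    apply: cvgB; first exact: (psrep_horner_cvg hQ xr).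
    rewrite (eq_real xr); exact: (psrep_horner_cvg hP xr).
  apply: (@ler_cvg_to _ \oo _ _ _ _ _ _ hl hr); apply: nearW => K.
  have tQ := horner_tail n.+1 (fun i => psrep_coef_ge0 K i hQ) (ltW x0) xy y0.
  have tP := horner_tail n.+1 (fun i => psrep_coef_ge0 K i hP) (ltW x0) xy y0.
  have bQ : (x / y) ^+ n.+1 * (Q K).[y] <= C * x ^+ n.+1.
    have -> : C * x ^+ n.+1 = (x / y) ^+ n.+1 * complex.Re (Phi y%:C).
      by rewrite /C expr_div_n [LHS]mulrC mulrA mulrAC.
    rewrite ler_wpM2l//; first by rewrite exprn_ge0// divr_ge0// ltW.
    exact: psrep_horner_le.
  have bP : (x / y) ^+ n.+1 * (P K).[y] <= C * x ^+ n.+1.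
    have -> : C * x ^+ n.+1 = (x / y) ^+ n.+1 * complex.Re (Phi y%:C).
      by rewrite /C expr_div_n [LHS]mulrC mulrA mulrAC.
    rewrite ler_wpM2l//; first by rewrite exprn_ge0// divr_ge0// ltW.
    by rewrite (eq_real yr); exact: psrep_horner_le.
  move: tQ tP bQ bP; move: (\sum_(i < _) _) (\sum_(i < _) _) ((Q K).[x]) ((P K).[x]).
  move=> s1 s2 t1 t2 /andP[a1 a2] /andP[b1 b2] c1 c2.
  have := ler_norm (t1 - t2); have := ler_norm (t2 - t1); rewrite (distrC t2).
  by rewrite [`|s2 - s1| <= _]ler_norml => *; apply/andP; split; lra.
apply/eqP; rewrite -subr_eq0 -normr_le0; apply/ler_addgt0Pr => e e0; rewrite add0r.
(* Divided by x^n, the estimate reads |q n - p n| <= C x, with x as small as desired. *)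
pose x := Num.min y (e / (C + 1)).
have C1 : 0 < C + 1 by rewrite ltr_wpDl.
have x0 : 0 < x by rewrite lt_min y0 divr_gt0.
have xy : x <= y by rewrite ge_min lexx.
have := key x x0 xy; rewrite exprS mulrA ler_pM2r ?exprn_gt0// => /le_trans; apply.
apply: (@le_trans _ _ (C * (e / (C + 1)))).
  by rewrite ler_wpM2l// ge_min lexx orbT.
by rewrite mulrCA ler_piMr ?(ltW e0)// ler_pdivrMr// mul1r lerDl.
Qed.

(* At w, the two polynomials differ by at most the sum of their distances to
   the common limit at the real point |w|. *)
Lemma psrep_unique w : normc w < rho -> Phi w = Psi w.
Proof.
move=> wr; pose x := normc w.
have xr : 0 <= x < rho by rewrite normc_ge0.
have x0 : 0 <= x by rewrite normc_ge0.
have qge K i : (Q K)`_i <= q i.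
  apply: (nondecreasing_cvgn_le (psrep_mono i hQ)).
  by apply: (psrep_coef_cvg hQ).
have pge K i : (P K)`_i <= q i.
  rewrite psrep_coef_eq; apply: (nondecreasing_cvgn_le (psrep_mono i hP)).
  by apply: (psrep_coef_cvg hP).
have part n : \sum_(i < n) q i * x ^+ i <= complex.Re (Phi x%:C).
  have hl : \sum_(i < n) (Q K)`_i * x ^+ i @[K --> \oo] --> \sum_(i < n) q i * x ^+ i.
    apply: (cvg_sum_ord (u := fun K i => (Q K)`_i * x ^+ i) (l := fun i => q i * x ^+ i)) => i.
    apply: cvgM; last exact: cvg_cst.
    by apply: (psrep_coef_cvg hQ).
  apply: (@cvgr_to_le _ \oo _ _ _ _ _ hl); apply: nearW => K.
  apply: le_trans (psrep_horner_le K hQ xr).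
  rewrite (horner_coef_wide _ (leq_maxl (size (Q K)) n)).
  rewrite (big_ord_widen (maxn (size (Q K)) n) (fun i => (Q K)`_i * x ^+ i)) ?leq_maxr//.
  rewrite [leRHS](bigID (fun i : 'I__ => i < n)%N) /= lerDl.
  by apply: sumr_ge0 => i _; rewrite mulr_ge0 ?exprn_ge0// (psrep_coef_ge0 _ _ hQ).
have bound K : normc (ceval (Q K) w - ceval (P K) w) <=
    2 * complex.Re (Phi x%:C) - (Q K).[x] - (P K).[x].
  pose n := maxn (size (Q K)) (size (P K)).
  apply: le_trans (normc_ceval_sub w (leq_maxl _ _) (leq_maxr _ _)) _.
  rewrite (horner_coef_wide _ (leq_maxl (size (Q K)) (size (P K)))).
  rewrite (horner_coef_wide _ (leq_maxr (size (Q K)) (size (P K)))).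
  rewrite -/n -/x; apply: (@le_trans _ _ (2 * (\sum_(i < n) q i * x ^+ i) -
    \sum_(i < n) (Q K)`_i * x ^+ i - \sum_(i < n) (P K)`_i * x ^+ i)); last first.
    by rewrite !lerD2r ler_wpM2l// part.
  rewrite mulr_sumr -!sumrB; apply: ler_sum => i _.
  rewrite mulrA -!mulrBl ler_wpM2r ?exprn_ge0//.
  have := qge K i; have := pge K i; rewrite ler_norml => *; apply/andP; split; lra.
have h0 : normc (Phi w - ceval (Q K) w) + (2 * complex.Re (Phi x%:C) - (Q K).[x] - (P K).[x])
    + normc (Psi w - ceval (P K) w) @[K --> \oo] --> (0 : R).
  have -> : 0 = 0 + (2 * complex.Re (Phi x%:C) - complex.Re (Phi x%:C) - complex.Re (Phi x%:C)) + 0 :> R.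
    by ring.
  apply: cvgD; last exact: (psrep_cvg hP wr).
  apply: cvgD; first exact: (psrep_cvg hQ wr).
  apply: cvgB; last (rewrite [X in _ --> X](_ : _ = complex.Re (Psi x%:C)); [exact: (psrep_horner_cvg hP xr)|by rewrite (eq_real xr)]).
  apply: cvgB; first exact: cvg_cst.
  exact: (psrep_horner_cvg hQ xr).
apply/eqP; rewrite -subr_eq0; apply/eqP/eq0_normc/eqP; rewrite eq_le normc_ge0 andbT.
apply: (@cvgr_to_ge _ \oo _ _ _ _ _ h0); apply: nearW => K.
have -> : Phi w - Psi w = (Phi w - ceval (Q K) w) + (ceval (Q K) w - ceval (P K) w) +
    - (Psi w - ceval (P K) w).
  by rewrite opprB !subrKA.
apply: le_trans (normcD _ _) _; rewrite normcN lerD2r.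
by apply: le_trans (normcD _ _) _; rewrite lerD2l.
Qed.

End unique.

End power_series.

(** * From the Laplace transform to the characteristic function *)

Section laplace_series.
Context (R : realType).
Local Notation T := (measurableTypeR R).
Import ComplexField.Normc.
Implicit Types w z : R[i].

(** The partial sum with its constant term put in front when [b] holds. At K = 0 it is [b], and each
    further step adds one term whose integral is finite. *)
Definition expsum_from (b : bool) K z : R[i] :=
  b%:R + \sum_(i < K | (b <= i)%N) z ^+ i / i`!%:R.

Lemma expsum_fromE (b : bool) K z : expsum_from b K.+1 z = expsum K.+1 z.
Proof.
rewrite /expsum_from /expsum; case: b => /=; last by rewrite add0r.
rewrite [RHS](bigD1 ord0)//= ?expr0 divr1; congr (_ + _).
by apply: eq_bigl => i; rewrite lt0n.
Qed.

Lemma exp_term_le (b : bool) (y : R) i : (b <= i)%N -> 0 <= y ->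
  y ^+ i / i`!%:R <= expR y - b%:R.
Proof.
move=> bi y0; rewrite lerBrDr; apply: le_trans (expsum_le i.+1 y0).
have t0 j : 0 <= y ^+ j / j`!%:R by rewrite divr_ge0// exprn_ge0.
rewrite /expsum big_ord_recr /= [leLHS]addrC lerD2r.
case: b bi => /=; last by rewrite sumr_ge0.
by case: i => // i _; rewrite big_ord_recl /= ?expr0 divr1 lerDl sumr_ge0.
Qed.

Let mlin w : measurable_fun (setT : set T) (fun s => complex.Re (w * s%:C)) /\
  measurable_fun (setT : set T) (fun s => complex.Im (w * s%:C)).
Proof.
split.
  under eq_fun do rewrite ReM /= mulr0 subr0; exact: measurable_funM.
under eq_fun do rewrite ImM /= mulr0 add0r; exact: measurable_funM.
Qed.

Lemma measurable_cexp w :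
  measurable_fun (setT : set T) (fun s => complex.Re (cexp (w * s%:C))) /\
  measurable_fun (setT : set T) (fun s => complex.Im (cexp (w * s%:C))).
Proof.
have [mr mi] := mlin w.
split; apply: measurable_funM; try exact: measurableT_comp (@measurable_expR R) mr.
  exact: measurableT_comp (@measurable_cos R) mi.
exact: measurableT_comp (@measurable_sin R) mi.
Qed.

Context (nu : {measure set T -> \bar R}) (D : set T) (mD : measurable D)
  (D0 : forall s, D s -> 0 <= s) (l0 : R) (l00 : 0 < l0) (b : bool).

Let e (s : R) := expR (- l0 * s).

Let e0 s : 0 <= e s. Proof. exact: expR_ge0. Qed.

Let me : measurable_fun (setT : set T) e.
Proof.
by apply: (measurableT_comp (@measurable_expR R)); exact: measurable_funM.
Qed.

(** When [b] holds, the subtracted 1 compensates a possibly infinite mass near 0. *)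
Hypothesis hint : forall x, 0 <= x -> x < l0 ->
  nu.-integrable D (fun s => (e s * (expR (x * s) - b%:R))%:E).

(** When [b] holds, the integral for i = 0 could be infinite; the constant term of [exp - 1] is 0
    instead. *)
Definition lcoef i : R := if (i < b)%N then 0
  else \int[nu]_(s in D) (expR (- l0 * s) * (s ^+ i / i`!%:R)).

Definition lpoly K : {poly R} := \poly_(i < K) lcoef i.

(** With lambda = l0 - w, this is the Laplace transform at lambda when [b] fails, and psi(l0) -
    psi(lambda) when it holds; see [ltrans_prob] and [ltrans_kernel]. *)
Definition ltrans w : R[i] :=
  cintegral nu D (fun s => (expR (- l0 * s))%:C * (cexp (w * s%:C) - b%:R)).

Let mterm i : measurable_fun D (fun s : T => e s * (s ^+ i / i`!%:R)).
Proof.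
apply: measurable_funTS; apply: measurable_funM; first exact: me.
by apply: measurable_funM => //; exact: measurable_funX.
Qed.

(** With x = l0/2, the power s^i/i! is x^-i times a term of the series of exp(x s) - b, and [hint]
    applies at x. *)
Let iterm i : (b <= i)%N -> nu.-integrable D (fun s => (e s * (s ^+ i / i`!%:R))%:E).
Proof.
move=> bi; pose x := l0 / 2; have x0 : 0 < x by rewrite divr_gt0.
have xl : x < l0 by rewrite ltr_pdivrMr// ltr_pMr// ltr1n.
clearbody x; apply: (le_integrable mD _ _ (integrableZl mD (x ^- i) (hint (ltW x0) xl))).
  by apply/measurable_EFinP; exact: mterm.
move=> s /D0 s0; rewrite lee_fin /= !ger0_norm.
- have xi0 : x ^+ i != 0 by rewrite expf_neq0 ?gt_eqF.
  have -> : s ^+ i / i`!%:R = x ^- i * ((x * s) ^+ i / i`!%:R).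
    by rewrite exprMn -mulrA mulKf.
  rewrite [leRHS]mulrCA ler_wpM2l// ler_wpM2l ?invr_ge0 ?exprn_ge0 ?(ltW x0)//.
  by rewrite exp_term_le// mulr_ge0// ltW.
- rewrite mulr_ge0 ?invr_ge0 ?exprn_ge0 ?(ltW x0)// mulr_ge0//.
  have := @exp_term_le b (x * s) b (leqnn _) (mulr_ge0 (ltW x0) s0).
  by apply: le_trans; rewrite divr_ge0 ?exprn_ge0// mulr_ge0// ltW.
- by rewrite mulr_ge0// divr_ge0// exprn_ge0.
Qed.

Lemma lcoef_ge0 i : 0 <= lcoef i.
Proof.
rewrite /lcoef; case: ifP => // _; apply: Rintegral_ge0 => s /D0 s0.
by rewrite mulr_ge0 ?expR_ge0// divr_ge0// exprn_ge0.
Qed.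

(** * Convergence of the expansion, for [L] the real or the imaginary part *)

Section component.
Context (L : R[i] -> R) (LD : forall z z', L (z + z') = L z + L z')
  (LM : forall (r : R) z, L (r%:C * z) = r * L z)
  (Lle : forall z, `|L z| <= normc z)
  (mL : forall w, measurable_fun (setT : set T) (fun s => L (cexp (w * s%:C)))).

Let LB z z' : L (z - z') = L z - L z'.
Proof.
by rewrite LD; congr (_ + _); rewrite -mulN1r -[-1](_ : (-1 : R)%:C = _) ?LM ?mulN1r// rmorphN rmorph1.
Qed.

Context (w : R[i]) (wl : normc w < l0).

Let x := normc w.

Let h K (s : R) := e s * L (cexp (w * s%:C) - expsum_from b K (w * s%:C)).

Let normcs (s : R) : 0 <= s -> normc (w * s%:C) = x * s.
Proof. by move=> s0; rewrite normcM normc_real ger0_norm. Qed.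

Let h0_int : nu.-integrable D (fun s => (h 0 s)%:E).
Proof.
apply: (le_integrable mD _ _ (hint (normc_ge0 w) wl)).
  apply/measurable_EFinP/measurable_funTS/measurable_funM; first exact: me.
  under eq_fun do rewrite LB; apply: measurable_funB; first exact: mL.
  rewrite (_ : (fun _ => _) = cst (L b%:R))//.
  by apply/funext => s; rewrite /expsum_from big_ord0 addr0.
move=> s /D0 s0; rewrite lee_fin /h normrM (ger0_norm (e0 s)).
have hle := @normc_cexp_sub R b (w * s%:C); rewrite normcs// in hle.
rewrite [leRHS]ger0_norm; last by rewrite mulr_ge0// (le_trans (normc_ge0 _) hle).
rewrite ler_wpM2l// (le_trans (Lle _))//.
by rewrite /expsum_from big_ord0 addr0.
Qed.

(** One term of the exponential series is subtracted at a time, so that only finite sums are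
    integrated; the interchange with the limit is left to dominated convergence. *)
Let h_int_val K : nu.-integrable D (fun s => (h K s)%:E) /\
  \int[nu]_(s in D) h K s = \int[nu]_(s in D) h 0 s - \sum_(i < K) lcoef i * L (w ^+ i).
Proof.
elim: K => [|K [iK ihK]]; first by rewrite big_ord0 subr0; split; first exact: h0_int.
have [Kb|bK] := ltnP K b.
  have E : h K.+1 = h K.
    apply/funext => s; rewrite /h /expsum_from big_mkcond [in RHS]big_mkcond big_ord_recr /=.
    by rewrite leqNgt Kb /= addr0.
  by rewrite E big_ord_recr /= {2}/lcoef Kb mul0r addr0.
have E s : h K.+1 s = h K s - L (w ^+ K) * (e s * (s ^+ K / K`!%:R)).
  rewrite /h /expsum_from big_mkcond big_ord_recr /= bK -big_mkcond /= addrA.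
  rewrite opprD addrA [in LHS]LB mulrBr; congr (_ - _).
  have -> : (w * s%:C) ^+ K / K`!%:R = (s ^+ K / K`!%:R)%:C * w ^+ K.
    by rewrite exprMn rmorphM fmorphV rmorph_nat rmorphXn /= -mulrA mulrC.
  by rewrite LM; ring.
have iE : nu.-integrable D (fun s => (L (w ^+ K) * (e s * (s ^+ K / K`!%:R)))%:E).
  exact: (integrableZl mD _ (iterm bK)).
have -> : h K.+1 = fun s => h K s - L (w ^+ K) * (e s * (s ^+ K / K`!%:R)).
  by apply/funext.
split; first exact: (integrableB mD iK iE).
rewrite RintegralB// ihK big_ord_recr /= opprD addrA; congr (_ - _).
by rewrite RintegralZl//; [rewrite mulrC /lcoef ltnNge bK|exact: iterm].
Qed.

Lemma lcoef_component_cvg :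
  \sum_(i < K) lcoef i * L (w ^+ i) @[K --> \oo] -->
  \int[nu]_(s in D) (e s * L (cexp (w * s%:C) - b%:R)).
Proof.
have E0 : \int[nu]_(s in D) (e s * L (cexp (w * s%:C) - b%:R)) = \int[nu]_(s in D) h 0 s.
  by apply: eq_Rintegral => s _; rewrite /h /expsum_from big_ord0 addr0.
rewrite E0 -(cvg_shiftS (fun K => \sum_(i < K) lcoef i * L (w ^+ i))).
suff hc : \int[nu]_(s in D) h K.+1 s @[K --> \oo] --> (0 : R).
  have -> : (fun K => \sum_(i < K.+1) lcoef i * L (w ^+ i)) =
      fun K => \int[nu]_(s in D) h 0 s - \int[nu]_(s in D) h K.+1 s.
    by apply/funext => K; rewrite (h_int_val K.+1).2 opprB addrC subrK.
  suff : \int[nu]_(s in D) h 0 s - \int[nu]_(s in D) h K.+1 s @[K --> \oo] -->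
    \int[nu]_(s in D) h 0 s - 0 by rewrite subr0.
  by apply: cvgB => //; exact: cvg_cst.
(* The factor 2 counts exp(w s) - b and the partial sum minus b, each bounded by exp(x s) - b. *)
have iG := integrableZl mD 2 (hint (normc_ge0 w) wl).
have [|||||_ _ hd] := @dominated_convergence _ T _ nu D mD
  (fun K s => (h K.+1 s)%:E) (cst 0%E)
  (fun s => (2%:E * (e s * (expR (x * s) - b%:R))%:E)%E).
- by move=> K; case: (h_int_val K.+1) => /measurable_int.
- exact: measurable_cst.
- apply: aeW => s Ds; apply/cvg_EFin; first exact: nearW.
  have hz := @expsum_cexp R (w * s%:C).
  have hz' : e s * normc (expsum K.+1 (w * s%:C) - cexp (w * s%:C)) @[K --> \oo] --> (0 : R).
    rewrite -(mulr0 (e s)); apply: cvgM; first exact: cvg_cst.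
    by rewrite (cvg_shiftS (fun K => normc (expsum K (w * s%:C) - cexp (w * s%:C)))).
  apply: norm_cvg0; apply: (squeeze_cvgr _ (cvg_cst 0) hz'); apply: nearW => K.
  rewrite normr_ge0 /= /h expsum_fromE normrM (ger0_norm (e0 s)) ler_wpM2l//.
  by rewrite normc_distC; exact: Lle.
- exact: iG.
- apply: aeW => s K Ds; have s0 := D0 Ds.
  rewrite abse_EFin -EFinM lee_fin /h expsum_fromE normrM (ger0_norm (e0 s)).
  rewrite mulrCA ler_wpM2l// (le_trans (Lle _))//.
  have -> : cexp (w * s%:C) - expsum K.+1 (w * s%:C) =
     (cexp (w * s%:C) - b%:R) - (expsum K.+1 (w * s%:C) - b%:R).
    by rewrite opprB addrA subrK.
  rewrite (le_trans (normcB _ _))// mulr_natl mulr2n -normcs// lerD//.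
    exact: normc_cexp_sub.
  rewrite (le_trans (expsum_sub_bool b _ _))// lerD2r expsum_le//.
  exact: normc_ge0.
have E1 : (\int[nu]_(s in D) cst 0 s = 0 :> \bar R)%E by rewrite integral_cst// mul0e.
by move: hd; rewrite E1 => /fine_cvg.
Qed.

End component.

Lemma psrep_laplace : psrep l0 ltrans lpoly.
Proof.
split=> [K i|w wl].
  rewrite !coef_poly; split.
    by case: ifP => // _; exact: lcoef_ge0.
  case: ifP => [iK|_]; first by rewrite (ltnW iK : (i < K.+1)%N) // ltnS ltnW.
  by case: ifP => // _; exact: lcoef_ge0.
have [mr mi] := measurable_cexp w.
have E K : ceval (lpoly K) w = \sum_(i < K) (lcoef i)%:C * w ^+ i.
  rewrite (ceval_coef w (size_poly _ _)); apply: eq_bigr => i _.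
  by rewrite coef_poly ltn_ord.
under eq_fun do rewrite normc_distC.
apply: cvg_normc; rewrite /ltrans /cintegral /=.
  have -> : (fun K => complex.Re (ceval (lpoly K) w)) =
      (fun K => \sum_(i < K) lcoef i * complex.Re (w ^+ i)).
    apply/funext => K; rewrite E (big_morph _ (@ReD R) (erefl (complex.Re 0))).
    by apply: eq_bigr => i _; rewrite ReM /= mul0r subr0.
  have -> : \int[nu]_(x in D) complex.Re ((expR (- l0 * x))%:C * (cexp (w * x%:C) - b%:R)) =
      \int[nu]_(x in D) (e x * complex.Re (cexp (w * x%:C) - b%:R)).
    by apply: eq_Rintegral => s _; rewrite ReM /= mul0r subr0.
  apply: (lcoef_component_cvg (@ReD R) _ (@Re_le_normc R) _ wl).
  - by move=> r z; rewrite ReM /= mul0r subr0.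
  - by move=> w'; case: (measurable_cexp w').
have -> : (fun K => complex.Im (ceval (lpoly K) w)) =
    (fun K => \sum_(i < K) lcoef i * complex.Im (w ^+ i)).
  apply/funext => K; rewrite E (big_morph _ (@ImD R) (erefl (complex.Im 0))).
  by apply: eq_bigr => i _; rewrite ImM /= mul0r addr0.
have -> : \int[nu]_(x in D) complex.Im ((expR (- l0 * x))%:C * (cexp (w * x%:C) - b%:R)) =
    \int[nu]_(x in D) (e x * complex.Im (cexp (w * x%:C) - b%:R)).
  by apply: eq_Rintegral => s _; rewrite ImM /= mul0r addr0.
apply: (lcoef_component_cvg (@ImD R) _ (@Im_le_normc R) _ wl).
- by move=> r z; rewrite ImM /= mul0r addr0.
- by move=> w'; case: (measurable_cexp w').
Qed.

End laplace_series.

(** * First and second order bounds for the exponential *)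

Section exponential_bounds.
Context (R : realType).
Import ComplexField.Normc.
Implicit Types z : R[i].

Lemma expR_sub1_le (x : R) : expR x - 1 <= x * expR x.
Proof.
have h := expR_ge1Dx (- x).
have : (1 - x) * expR x <= expR (- x) * expR x by rewrite ler_wpM2r ?expR_ge0.
by rewrite -expRD addNr expR0; lra.
Qed.

(** For |z| <= 1 the power series gives |z| exp(1); for |z| > 1 both terms have modulus at most 1,
    and 2 <= 2 |z|. The constant is the sum of the two. *)
Lemma normc_cexp_sub1 z : complex.Re z <= 0 ->
  normc (cexp z - 1) <= (2 + expR 1) * normc z.
Proof.
move=> z0; have n0 := normc_ge0 z; have e1 := expR_ge0 (1 : R).
have [zl|zl] := leP (normc z) 1.
  have h : normc (cexp z - 1) <= expR (normc z) - 1 := @normc_cexp_sub R true z.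
  apply: (le_trans h).
  rewrite (le_trans (expR_sub1_le _))// mulrC ler_wpM2r//.
  by apply: (@le_trans _ _ (expR 1)); [rewrite ler_expR|rewrite lerDr].
have h : normc (cexp z - 1) <= 2.
  rewrite (le_trans (normcB _ _))// normc1 normc_cexp.
  have := expR0 R; have : expR (complex.Re z) <= expR 0 by rewrite ler_expR.
  by move=> + E; rewrite E; lra.
rewrite (le_trans h)// -[leLHS]mulr1 ler_pM// ?lerDl// ltW//.
Qed.

(** The remainder after two terms has positive coefficients, so it is bounded by its value at
    |z|. *)
Lemma normc_cexp_sub2 z :
  normc (cexp z - 1 - z) <= normc z * (expR (normc z) - 1).
Proof.
apply: (@le_trans _ _ (expR (normc z) - 1 - normc z)); last first.
  by have := expR_sub1_le (normc z); lra.
have h : normc (expsum K z - cexp z) + (expsum K (normc z) - 1 - normc z)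
    @[K --> \oo] --> expR (normc z) - 1 - normc z.
  rewrite -[X in _ --> X]add0r; apply: cvgD; first exact: expsum_cexp.
  by apply: cvgB; [apply: cvgB; [exact: expsum_cvg|exact: cvg_cst]|exact: cvg_cst].
apply: (@cvgr_to_ge _ \oo _ _ _ _ _ h); exists 2%N => // -[|[|K]]// _.
have -> : cexp z - 1 - z = - (expsum K.+2 z - cexp z) + (expsum K.+2 z - 1 - z).
  by rewrite opprB -!addrA; congr (_ + _); rewrite [RHS]addrA addNr add0r.
rewrite (le_trans (normcD _ _))// normcN lerD2l.
have E (F : numFieldType) (x : F) : expsum K.+2 x - 1 - x =
    \sum_(i < K) x ^+ i.+2 / (i.+2)`!%:R.
  rewrite /expsum !big_ord_recl /= /bump /= ?expr0 ?expr1 ?fact0 ?divr1.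
  by rewrite (addrC 1) addrK (addrC x) addrK.
rewrite !E; apply: le_trans (normc_sum _ _ _) _; apply: ler_sum => i _.
by rewrite normc_term.
Qed.

End exponential_bounds.

(** * Integrability of min(t, 1) against the kernel measure *)

Section kernel.
Context (R : realType).
Local Notation mu := (@lebesgue_measure R).
Local Notation T := (measurableTypeR R).
Context (k : R -> R) (M : {measure set T -> \bar R}) (HM : is_kernel_measure k M)
  (k_loc : mu.-integrable `[0, 1]%classic (EFin \o k)).

Local Notation pos := (`]0, +oo[%classic : set T).

Section truncation.
Context (n : nat).
Let Dn := (`]n.+1%:R^-1, +oo[%classic : set T).
Let mDn : measurable Dn. Proof. exact: measurable_itv. Qed.
Let n0 : 0 < n.+1%:R^-1 :> R. Proof. exact: natSinv_gt0. Qed.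
Let Mn_lty : (M Dn < +oo)%E.
Proof. by rewrite (HM.2 _ n0) ltry. Qed.
Let Mn := mfrestr mDn Mn_lty.

Let A : set (T * T) := [set z | 0 < z.1 <= 1 /\ z.1 < z.2].

Let mA : measurable A.
Proof.
have m1 : measurable_fun (setT : set (T * T)) (fun z => z.1 : R) by exact: measurable_fst.
have m2 : measurable_fun (setT : set (T * T)) (fun z => z.2 : R) by exact: measurable_snd.
have h : measurable_fun (setT : set (T * T)) (fun z => [&& 0 < z.1, z.1 <= 1 & z.1 < z.2]).
  apply: measurable_and; first exact: measurable_fun_ltr.
  by apply: measurable_and; [exact: measurable_fun_ler|exact: measurable_fun_ltr].
have := h measurableT ([set true] : set bool) Logic.I.
rewrite setTI; congr measurable; apply/seteqP; split=> z /=.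
  by move=> /and3P[h1 h2 h3]; rewrite /A /= h1 h2 h3.
by move=> [/andP[-> ->] ->].
Qed.

Let AE (s t : R) : \1_A (s, t) = (if 0 < s <= 1 then 1 else 0) * \1_(`]s, +oo[%classic : set T) t :> R.
Proof.
rewrite !indicE; case: ifPn => [s01|s01]; last first.
  have -> : ((s, t) \in A) = false.
    by apply/negbTE/negP; rewrite inE => -[/= h _]; rewrite h in s01.
  by rewrite mul0r.
rewrite mul1r; congr ((nat_of_bool _)%:R); apply/idP/idP.
  by rewrite inE => -[_] /= st; rewrite inE /= in_itv/= andbT.
by rewrite inE /= in_itv/= andbT => st; rewrite inE; split.
Qed.

(** Tonelli on the set of 0 < s <= 1, s < t: integration in s gives min(t, 1), integration in t
    gives M((s, oo)) = k s. Restriction to a half-line away from 0, of finite mass, makes the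
    measure finite, as the product measure demands. *)
Lemma int_min1_trunc : (\int[M]_(t in Dn) (Num.min t 1)%:E <=
  \int[mu]_(s in `]0%R, 1%R]%classic) (k s)%:E)%E.
Proof.
have mI : measurable_fun (setT : set (T * T)) (fun z => (\1_A z : R)%:E).
  by apply/measurable_EFinP; apply: measurable_indic; exact: mA.
have mmin : measurable_fun (setT : set T) (fun t : T => Num.min t 1).
  exact: measurable_minr.
have k01 : mu.-integrable `]0%R, 1%R]%classic (EFin \o k).
  apply: (integrableS _ _ _ k_loc) => //.
  by apply: subset_itvr; rewrite bnd_simp.
have mk : measurable_fun (`]0%R, 1%R]%classic : set T) (EFin \o k).
  by case/integrableP: k01.
have k_ge s : 0 < s -> (0 <= k s)%R.
  by move=> s0; rewrite -lee_fin -(HM.2 s s0).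
have E1 : (\int[M]_(t in Dn) (Num.min t 1)%:E = \int[Mn]_(t in Dn) (Num.min t 1)%:E)%E.
  apply: eq_measure_integral => B mB BD.
  by apply: (@etrans _ _ (M (B `&` Dn))); [rewrite (setIidl BD)|].
rewrite E1; apply: (@le_trans _ _ (\int[Mn]_t \int[mu]_s (\1_A (s, t) : R)%:E)%E).
  rewrite integral_mkcond; apply: ge0_le_integral => //.
  - move=> t _; rewrite patchE; case: ifPn => //; rewrite inE /Dn /= in_itv/= andbT => tn.
    by rewrite lee_fin le_min ltW//= (lt_trans n0).
  - apply/(measurable_restrictT _ mDn); apply: measurable_funTS.
    exact/measurable_EFinP.
  - exact: (measurable_fun_fubini_tonelli_G (m1 := mu) (fun z => (\1_A z : R)%:E)).
  move=> t _; rewrite patchE; case: ifPn => [|_]; last first.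
    by apply: integral_ge0 => s _; rewrite lee_fin.
  rewrite inE /Dn /= in_itv/= andbT => tn; have t0 := lt_trans n0 tn.
  have m0 : 0 < Num.min t 1 by rewrite lt_min t0 ltr01.
  (* min(t, 1) is read as the length of an open interval contained in the section of [A] at t. *)
  have hI : mu `]0, Num.min t 1[%classic = (Num.min t 1)%:E.
    by rewrite lebesgue_measure_itv /= lte_fin m0 oppr0 adde0.
  have mJ : measurable (`]0, Num.min t 1[%classic : set T) by exact: measurable_itv.
  rewrite -hI -(setIT `]0, Num.min t 1[%classic) -integral_indic//.
  apply: ge0_le_integral => //.
  - by apply/measurable_EFinP; exact: measurable_indic.
  - exact: (measurableT_comp mI (measurable_pair2 t)).
  move=> s _; rewrite lee_fin !indicE; case: (boolP (s \in _)) => // sI.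
  rewrite (_ : (s, t) \in A)// inE /A /=.
  move: sI; rewrite inE /= in_itv/= lt_min => /and3P[s0 st s1].
  by rewrite s0 ltW.
rewrite -(@fubini_tonelli _ _ T T R mu Mn (fun z => (\1_A z : R)%:E))//.
rewrite [leRHS]integral_mkcond; apply: ge0_le_integral => //.
- by move=> s _; apply: integral_ge0 => t _; rewrite lee_fin.
- exact: (measurable_fun_fubini_tonelli_F (m2 := Mn) (fun z => (\1_A z : R)%:E)).
- by apply/(measurable_restrictT _ (measurable_itv _)).
move=> s _; rewrite patchE; under eq_integral do rewrite AE.
case: (boolP (0 < s <= 1)) => s01.
  rewrite mem_set /=; last by rewrite /= in_itv.
  under eq_integral do rewrite mul1r.
  rewrite integral_indic// setIT -(HM.2 s) ?(andP s01).1//.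
  apply: (@le_trans _ _ (M (`]s, +oo[%classic `&` Dn))); first by [].
  apply: le_measure; rewrite ?inE//; exact: measurableI.
under eq_integral do rewrite mul0r.
by rewrite integral0; case: ifPn => //; rewrite inE /= in_itv/= (negbTE s01).
Qed.

End truncation.

(** The bound for the truncated measures is uniform, and Fatou removes the truncation. *)
Lemma int_min1 : M.-integrable pos (fun t => (Num.min t 1)%:E).
Proof.
have mmin : measurable_fun (setT : set T) (fun t : T => Num.min t 1).
  exact: measurable_minr.
have mpos : measurable pos by exact: measurable_itv.
apply/integrableP; split; first exact/measurable_funTS/measurable_EFinP.
have k01 : mu.-integrable `]0%R, 1%R]%classic (EFin \o k).
  apply: (integrableS _ _ _ k_loc) => //.
  by apply: subset_itvr; rewrite bnd_simp.
have kfin : (\int[mu]_(s in `]0%R, 1%R]%classic) (k s)%:E < +oo)%E.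
  have h := integrable_fin_num (_ : measurable (`]0%R, 1%R]%classic : set T)) k01.
  by rewrite ltey_eq h.
apply: le_lt_trans kfin.
pose Dn n := (`]n.+1%:R^-1, +oo[%classic : set T).
pose g n := ((fun t : T => (Num.min t 1)%:E) \_ (Dn n)).
have mg n : measurable_fun pos (g n).
  apply: measurable_funTS; apply/(measurable_restrictT _ (measurable_itv _)).
  exact/measurable_funTS/measurable_EFinP.
have g0 n t : pos t -> (0 <= g n t)%E.
  rewrite /= in_itv/= andbT /g patchE => t0; case: ifPn => // _.
  by rewrite lee_fin le_min ltW//=.
apply: (@le_trans _ _ (\int[M]_(t in pos) limn_einf (g ^~ t))%E).
  rewrite le_eqVlt; apply/orP; left; apply/eqP; apply: eq_integral => t.
  rewrite inE /= in_itv/= andbT => t0.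
  have hc : g n t @[n --> \oo] --> (Num.min t 1)%:E.
    apply: cvg_near_cst; exists (Num.truncn t^-1) => // n /= tn.
    rewrite /g patchE mem_set// /Dn /= in_itv/= andbT invf_plt ?posrE//.
    by rewrite (lt_le_trans (truncnS_gt _))// ler_nat.
  have [-> _] := cvg_limn_einf_sup hc.
  by rewrite ger0_norm// le_min ltW//=.
apply: (le_trans (fatou M mpos mg _)) => //.
apply: (@limn_einf_le _ _ 0%N) => n _.
rewrite /g -integral_mkcondr (_ : pos `&` Dn n = Dn n).
  exact: int_min1_trunc.
apply/setIidPr => t; rewrite /Dn /= !in_itv/= !andbT => tn.
exact: lt_trans (natSinv_gt0 R n) tn.
Qed.

End kernel.

Section dominated.
Context (R : realType) d (T : measurableType d) (nu : {measure set T -> \bar R})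
  (D : set T) (mD : measurable D).

Lemma Rintegral_dominated (f : nat -> T -> R) (g h : T -> R) :
  (forall n, measurable_fun D (f n)) -> measurable_fun D g ->
  nu.-integrable D (EFin \o h) ->
  (forall n x, D x -> `|f n x| <= h x) ->
  (forall x, D x -> f n x @[n --> \oo] --> g x) ->
  \int[nu]_(x in D) f n x @[n --> \oo] --> \int[nu]_(x in D) g x.
Proof.
move=> mf mg ih fh fg.
have [||||| ig _ hd] := @dominated_convergence _ T _ nu D mD
  (fun n x => (f n x)%:E) (EFin \o g) (EFin \o h).
- by move=> n; exact/measurable_EFinP.
- exact/measurable_EFinP.
- by apply: aeW => x Dx; apply/cvg_EFin; [exact: nearW|exact: fg].
- exact: ih.
- by apply: aeW => x n Dx; rewrite /= lee_fin fh.
apply: fine_cvg; rewrite fineK//; exact: integrable_fin_num.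
Qed.

End dominated.

Section complex_cvg.
Context (R : realType).

Definition ccvg (z_ : nat -> R[i]) (z : R[i]) : Prop :=
  complex.Re (z_ n) @[n --> \oo] --> complex.Re z /\
  complex.Im (z_ n) @[n --> \oo] --> complex.Im z.

Lemma ccvg_cst z : ccvg (fun=> z) z.
Proof. by split; exact: cvg_cst. Qed.

Lemma ccvgM (u v : nat -> R[i]) z w : ccvg u z -> ccvg v w ->
  ccvg (fun n => u n * v n) (z * w).
Proof.
move=> [ur ui] [vr vi]; split.
  by under eq_fun do rewrite ReM; rewrite ReM; apply: cvgB; exact: cvgM.
by under eq_fun do rewrite ImM; rewrite ImM; apply: cvgD; exact: cvgM.
Qed.

Lemma ccvgB (u v : nat -> R[i]) z w : ccvg u z -> ccvg v w ->
  ccvg (fun n => u n - v n) (z - w).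
Proof.
move=> [ur ui] [vr vi]; split.
  by under eq_fun do rewrite ReD ReN; rewrite ReD ReN; exact: cvgB.
by under eq_fun do rewrite ImD ImN; rewrite ImD ImN; exact: cvgB.
Qed.

Lemma ccvg_cexp (u : nat -> R[i]) z : ccvg u z -> ccvg (fun n => cexp (u n)) (cexp z).
Proof.
move=> [ur ui].
have he : expR (complex.Re (u n)) @[n --> \oo] --> expR (complex.Re z).
  by apply: continuous_cvg => //; exact: continuous_expR.
have hc : cos (complex.Im (u n)) @[n --> \oo] --> cos (complex.Im z).
  by apply: continuous_cvg => //; exact: continuous_cos.
have hs : sin (complex.Im (u n)) @[n --> \oo] --> sin (complex.Im z).
  by apply: continuous_cvg => //; exact: continuous_sin.
by split; exact: cvgM.
Qed.

Lemma ccvg_unique (u : nat -> R[i]) z w : ccvg u z -> ccvg u w -> z = w.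
Proof.
move=> [ur ui] [vr vi]; apply: complex_eq.
  exact: (cvg_unique _ ur vr).
exact: (cvg_unique _ ui vi).
Qed.

Lemma ccvg_normc (u : nat -> R[i]) z :
  ComplexField.Normc.normc (u n - z) @[n --> \oo] --> (0 : R) -> ccvg u z.
Proof.
move=> h; split; apply/cvgrPdist_le => e e0; have /cvgr0Pnorm_le/(_ e e0) := h;
  apply: filterS => n; rewrite ger0_norm ?normc_ge0//; apply: le_trans.
  by rewrite distrC -ReN -ReD; exact: Re_le_normc.
by rewrite distrC -ImN -ImD; exact: Im_le_normc.
Qed.

End complex_cvg.

(** * The Laplace exponent up to the imaginary axis *)

Section laplace_exponent.
Context (R : realType).
Local Notation mu := (@lebesgue_measure R).
Local Notation T := (measurableTypeR R).
Import ComplexField.Normc.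
Local Notation pos := (`]0, +oo[%classic : set T).
Local Notation half := (`[0, +oo[%classic : set T).
Context (M : {measure set T -> \bar R})
  (iM : M.-integrable pos (fun t => (Num.min t 1)%:E)).

Let mpos : measurable pos. Proof. exact: measurable_itv. Qed.
Let mhalf : measurable half. Proof. exact: measurable_itv. Qed.

Let pos0 t : pos t -> 0 < t. Proof. by rewrite /= in_itv/= andbT. Qed.
Let pos_ge0 t : pos t -> 0 <= t. Proof. by move=> /pos0/ltW. Qed.
Let half0 t : half t -> 0 <= t. Proof. by rewrite /= in_itv/= andbT. Qed.

(** For t <= 1 the cancellation at 0 yields a factor t; for t > 1 both terms have modulus at most
    1. *)
Lemma normc_1cexp_le (z : R[i]) (t : R) : 0 <= complex.Re z -> 0 < t ->
  normc (1 - cexp (- z * t%:C)) <= (2 + (2 + expR 1) * normc z) * Num.min t 1.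
Proof.
move=> z0 t0; have K0 : 0 <= (2 + expR 1) * normc z.
  by rewrite mulr_ge0 ?normc_ge0// addr_ge0// expR_ge0.
have Re0 : complex.Re (- z * t%:C) <= 0.
  by rewrite ReM ReN /= mulr0 subr0 mulNr oppr_le0 mulr_ge0// ltW.
rewrite normc_distC; have [t1|t1] := leP t 1.
  rewrite (le_trans (normc_cexp_sub1 Re0))//.
  rewrite normcM normcN normc_real (ger0_norm (ltW t0)) mulrA ler_wpM2r ?(ltW t0)//.
  by rewrite lerDr.
rewrite mulr1 (le_trans (normcB _ _))// normc_cexp normc1.
have : expR (complex.Re (- z * t%:C)) <= expR 0 by rewrite ler_expR.
by rewrite expR0; lra.
Qed.

Lemma psi_integrable (z : R[i]) : 0 <= complex.Re z ->
  M.-integrable pos (fun t => (complex.Re (1 - cexp (- z * t%:C)))%:E) /\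
  M.-integrable pos (fun t => (complex.Im (1 - cexp (- z * t%:C)))%:E).
Proof.
move=> z0; have [mr mi] := measurable_cexp (- z).
have iC := integrableZl mpos (2 + (2 + expR 1) * normc z) iM.
split; apply: (le_integrable mpos _ _ iC).
- apply/measurable_EFinP/measurable_funTS.
  by under eq_fun do rewrite ReD ReN; exact: measurable_funB.
- move=> t; rewrite /= in_itv/= andbT => t0; rewrite lee_fin.
  apply: le_trans (Re_le_normc _) (le_trans (normc_1cexp_le z0 t0) (ler_norm _)).
- apply/measurable_EFinP/measurable_funTS.
  by under eq_fun do rewrite ImD ImN; exact: measurable_funB.
- move=> t; rewrite /= in_itv/= andbT => t0; rewrite lee_fin.
  apply: le_trans (Im_le_normc _) (le_trans (normc_1cexp_le z0 t0) (ler_norm _)).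
Qed.

Lemma Re_psi_ge0 (z : R[i]) : 0 <= complex.Re z -> 0 <= complex.Re (psi M z).
Proof.
move=> z0; apply: Rintegral_ge0 => t /pos0 t0.
rewrite ReD ReN subr_ge0 (le_trans (ler_norm _))// (le_trans (Re_le_normc _))//.
rewrite normc_cexp ReM ReN /= mulr0 subr0 -expR0 ler_expR.
by rewrite mulNr oppr_le0 mulr_ge0// ltW.
Qed.

Lemma psi_real (x : R) : psi M x%:C = (complex.Re (psi M x%:C))%:C.
Proof.
apply: complex_eq => //=; apply: (@etrans _ _ (\int[M]_(t in pos) (0 : R))); last by rewrite /Rintegral integral0.
apply: eq_Rintegral => t _.
by rewrite oppr0 !mul0r mulr0 addr0 sin0 mulr0 subr0.
Qed.

Section laplace_M.
Context (l0 : R) (l00 : 0 < l0).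

(** For s <= 1 the integrand is at most x s <= l0 s, for s > 1 at most 1; hence the factor 1 + l0
    before min(s, 1). *)
Lemma integrable_laplace_kernel x : 0 <= x -> x < l0 ->
  M.-integrable pos (fun s => (expR (- l0 * s) * (expR (x * s) - true%:R))%:E).
Proof.
move=> x0 xl; apply: (le_integrable mpos _ _ (integrableZl mpos (1 + l0) iM)).
  apply/measurable_EFinP/measurable_funTS/measurable_funM.
    by apply: (measurableT_comp (@measurable_expR R)); exact: measurable_funM.
  apply: measurable_funB => //.
  by apply: (measurableT_comp (@measurable_expR R)); exact: measurable_funM.
move=> s; rewrite /= in_itv/= andbT => s0; rewrite lee_fin.
have s0' := ltW s0; have xs0 : 0 <= x * s by rewrite mulr_ge0.
have d0 : 0 <= expR (x * s) - 1 by rewrite subr_ge0 -expR0 ler_expR.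
rewrite ger0_norm; last by rewrite mulr_ge0 ?expR_ge0.
apply: le_trans (ler_norm _).
have e1 : expR (- l0 * s) * expR (x * s) <= 1.
  by rewrite -expRD -expR0 ler_expR -mulrDl mulr_le0_ge0// addrC subr_le0 ltW.
have [t1|t1] := leP s 1.
  apply: (@le_trans _ _ (expR (- l0 * s) * (x * s * expR (x * s)))).
    by rewrite ler_wpM2l ?expR_ge0// expR_sub1_le.
  rewrite mulrCA; apply: (@le_trans _ _ (x * s)); first by rewrite ler_piMr.
  by rewrite ler_wpM2r// (le_trans (ltW xl))// lerDr.
rewrite mulr1.
apply: (@le_trans _ _ (expR (- l0 * s) * expR (x * s))).
  by rewrite ler_wpM2l ?expR_ge0// gerBl.
by rewrite (le_trans e1)// lerDl ltW.
Qed.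

Lemma ltrans_kernel w : 0 <= complex.Re (l0%:C - w) ->
  ltrans M pos l0 true w = psi M l0%:C - psi M (l0%:C - w).
Proof.
move=> w0; have l0r : 0 <= complex.Re l0%:C by exact: ltW.
have [i1 i2] := psi_integrable l0r; have [i3 i4] := psi_integrable w0.
have E s : (expR (- l0 * s))%:C * (cexp (w * s%:C) - true%:R) =
    (1 - cexp (- l0%:C * s%:C)) - (1 - cexp (- (l0%:C - w) * s%:C)).
  have -> : - (l0%:C - w) * s%:C = - l0%:C * s%:C + w * s%:C by ring.
  rewrite cexpD -cexp_real -[(- l0 * s)%:C](_ : - l0%:C * s%:C = _); last first.
    by rewrite rmorphM rmorphN.
  by rewrite [true%:R]mulr1n; ring.
apply: complex_eq; rewrite ?ReD ?ImD ?ReN ?ImN.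
  apply: (@etrans _ _ (\int[M]_(s in pos) (complex.Re (1 - cexp (- l0%:C * s%:C)) -
      complex.Re (1 - cexp (- (l0%:C - w) * s%:C))))).
    by apply: eq_Rintegral => s _; rewrite E [LHS]ReD ReN.
  exact: RintegralB.
apply: (@etrans _ _ (\int[M]_(s in pos) (complex.Im (1 - cexp (- l0%:C * s%:C)) -
    complex.Im (1 - cexp (- (l0%:C - w) * s%:C))))).
  by apply: eq_Rintegral => s _; rewrite E [LHS]ImD ImN.
exact: RintegralB.
Qed.

End laplace_M.

(** Boundedness of the sequence makes the constant of [normc_1cexp_le] uniform, hence a domination
    by min(t, 1). *)
Lemma psi_cvg (z_ : nat -> R[i]) z B : (forall n, 0 <= complex.Re (z_ n)) ->
  (forall n, normc (z_ n) <= B) -> ccvg z_ z ->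
  ccvg (fun n => psi M (z_ n)) (psi M z).
Proof.
move=> z0 zB hz.
have iC := integrableZl mpos (2 + (2 + expR 1) * B) iM.
have bnd n t : pos t -> normc (1 - cexp (- z_ n * t%:C)) <=
    (2 + (2 + expR 1) * B) * Num.min t 1.
  move=> /pos0 t0; apply: (le_trans (normc_1cexp_le (z0 n) t0)).
  rewrite ler_wpM2r ?le_min ?(ltW t0)//= lerD2l ler_wpM2l//.
have hc t : ccvg (fun n => 1 - cexp (- z_ n * t%:C)) (1 - cexp (- z * t%:C)).
  apply: ccvgB; first exact: ccvg_cst.
  apply: ccvg_cexp; apply: ccvgM; last exact: ccvg_cst.
  have := ccvgB (ccvg_cst 0) hz; rewrite sub0r.
  by under [X in ccvg X _ -> _]eq_fun do rewrite sub0r.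
have mre w : measurable_fun pos (fun t => complex.Re (1 - cexp (- w * t%:C))).
  have [mr mi] := measurable_cexp (- w); apply: measurable_funTS.
  by under eq_fun do rewrite ReD ReN; exact: measurable_funB.
have mim w : measurable_fun pos (fun t => complex.Im (1 - cexp (- w * t%:C))).
  have [mr mi] := measurable_cexp (- w); apply: measurable_funTS.
  by under eq_fun do rewrite ImD ImN; exact: measurable_funB.
split.
  apply: (@Rintegral_dominated _ _ _ M pos mpos _ _
    (fun t => (2 + (2 + expR 1) * B) * Num.min t 1)).
  - by move=> n; exact: mre.
  - exact: mre.
  - exact: iC.
  - by move=> n t tp; apply: (le_trans _ (bnd n t tp)); exact: Re_le_normc.
  - by move=> t _; case: (hc t).
apply: (@Rintegral_dominated _ _ _ M pos mpos _ _
  (fun t => (2 + (2 + expR 1) * B) * Num.min t 1)).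
- by move=> n; exact: mim.
- exact: mim.
- exact: iC.
- by move=> n t tp; apply: (le_trans _ (bnd n t tp)); exact: Im_le_normc.
- by move=> t _; case: (hc t).
Qed.

Section subordinator.
Context (t : R) (t0 : 0 <= t) (nu : probability T R)
  (Hnu : is_subordinator_law M t nu).

Lemma integrable_laplace_prob l0 x : 0 <= x -> x < l0 ->
  nu.-integrable half (fun s => (expR (- l0 * s) * (expR (x * s) - false%:R))%:E).
Proof.
move=> x0 xl; apply: measurable_bounded_integrable => //.
- by rewrite (le_lt_trans (probability_le1 nu mhalf))// ltry.
- apply: measurable_funTS; apply: measurable_funM.
    by apply: (measurableT_comp (@measurable_expR R)); exact: measurable_funM.
  apply: measurable_funB => //.
  by apply: (measurableT_comp (@measurable_expR R)); exact: measurable_funM.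
- exists 1; split => // K K1 s; rewrite /= in_itv/= andbT => s0.
  rewrite (le_trans _ (ltW K1))// subr0 -expRD ger0_norm ?expR_ge0//.
  by rewrite -expR0 ler_expR -mulrDl mulr_le0_ge0// addrC subr_le0 ltW.
Qed.

Lemma ltrans_prob (l0 : R) w : ltrans nu half l0 false w =
  cintegral nu half (fun s => cexp (- (l0%:C - w) * s%:C)).
Proof.
have E s : (expR (- l0 * s))%:C * (cexp (w * s%:C) - false%:R) =
    cexp (- (l0%:C - w) * s%:C).
  have -> : - (l0%:C - w) * s%:C = - l0%:C * s%:C + w * s%:C by ring.
  rewrite cexpD -cexp_real -[(- l0 * s)%:C](_ : - l0%:C * s%:C = _); last first.
    by rewrite rmorphM rmorphN.
  by rewrite [false%:R]mulr0n subr0.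
rewrite /ltrans /cintegral; under eq_Rintegral do rewrite E.
by under [X in _ +i* X]eq_Rintegral do rewrite E.
Qed.

(* Both sides are limits of polynomials with nonnegative nondecreasing
   coefficients around l0 = |z|^2 / Re z, whose disk of radius l0 contains z. *)
Lemma laplace_complex (z : R[i]) : 0 < complex.Re z ->
  cintegral nu half (fun s => cexp (- z * s%:C)) = cexp (- t%:C * psi M z).
Proof.
move=> z0; pose l0 := (complex.Re z ^+ 2 + complex.Im z ^+ 2) / complex.Re z.
have l00 : 0 < l0 by rewrite divr_gt0// ltr_wpDr ?sqr_ge0// exprn_gt0.
pose w := l0%:C - z.
(* As l0 Re z = |z|^2, one has |l0 - z|^2 = l0^2 - l0 Re z. *)
have wl : normc w < l0.
  rewrite -(@ltr_pXn2r _ 2) ?nnegrE ?normc_ge0 ?(ltW l00)//.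
  rewrite normc_sqr /w ReD ImD ReN ImN /= add0r sqrrN.
  have E : l0 * complex.Re z = complex.Re z ^+ 2 + complex.Im z ^+ 2.
    by rewrite /l0 mulfVK// gt_eqF.
  have : 0 < l0 * complex.Re z by rewrite mulr_gt0.
  rewrite sqrrB; lra.
have zE : z = l0%:C - w by rewrite /w opprB addrC subrK.
rewrite zE -ltrans_prob.
pose c := expR (- t * complex.Re (psi M l0%:C)).
(* exp(-t psi(l0 - w)) is the positive constant exp(-t psi(l0)) times exp(t (psi(l0) - psi(l0 -
   w))), and t >= 0 keeps the coefficients of the exponent nonnegative. *)
have hM := psrepZ t0 (psrep_laplace mpos pos_ge0 l00 (@integrable_laplace_kernel l0 l00)).
have hP := psrepZ (expR_ge0 (- t * complex.Re (psi M l0%:C))) (psrep_exp hM).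
have hQ := psrep_laplace mhalf half0 l00 (@integrable_laplace_prob l0).
have EP (v : R[i]) : 0 <= complex.Re (l0%:C - v) ->
  (expR (- t * complex.Re (psi M l0%:C)))%:C * cexp (t%:C * ltrans M pos l0 true v) =
  cexp (- t%:C * psi M (l0%:C - v)).
  move=> v0; rewrite ltrans_kernel// -cexp_real -cexpD; congr cexp.
  set p := complex.Re (psi M l0%:C).
  by rewrite (psi_real l0) -/p rmorphM rmorphN; ring.
rewrite -EP; last by rewrite -zE ltW.
apply: (psrep_unique l00 hQ hP _ wl).
move=> x /andP[x0 xl]; rewrite EP; last by rewrite ReD ReN /= subr_ge0 ltW.
rewrite ltrans_prob -rmorphB; apply: (Hnu.2).
by rewrite subr_gt0.
Qed.

Lemma laplace_nu_cvg (z_ : nat -> R[i]) z : (forall n, 0 <= complex.Re (z_ n)) ->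
  ccvg z_ z ->
  ccvg (fun n => cintegral nu half (fun s => cexp (- z_ n * s%:C)))
    (cintegral nu half (fun s => cexp (- z * s%:C))).
Proof.
move=> z0 hz.
have i1 : nu.-integrable half (EFin \o cst (1 : R)) by exact: finite_measure_integrable_cst.
have bnd n s : half s -> normc (cexp (- z_ n * s%:C)) <= 1.
  move=> /half0 s0; rewrite normc_cexp -expR0 ler_expR ReM ReN /= mulr0 subr0.
  by rewrite mulNr oppr_le0 mulr_ge0.
have hc s : ccvg (fun n => cexp (- z_ n * s%:C)) (cexp (- z * s%:C)).
  apply: ccvg_cexp; apply: ccvgM; last exact: ccvg_cst.
  have := ccvgB (ccvg_cst 0) hz; rewrite sub0r.
  by under [X in ccvg X _ -> _]eq_fun do rewrite sub0r.
split.
  apply: (@Rintegral_dominated _ _ _ nu half mhalf _ _ (cst 1)) => //.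
  - by move=> n; apply: measurable_funTS; case: (measurable_cexp (- z_ n)).
  - by apply: measurable_funTS; case: (measurable_cexp (- z)).
  - by move=> n s /(bnd n); apply: le_trans; exact: Re_le_normc.
  - by move=> s _; case: (hc s).
apply: (@Rintegral_dominated _ _ _ nu half mhalf _ _ (cst 1)) => //.
- by move=> n; apply: measurable_funTS; case: (measurable_cexp (- z_ n)).
- by apply: measurable_funTS; case: (measurable_cexp (- z)).
- by move=> n s /(bnd n); apply: le_trans; exact: Im_le_normc.
- by move=> s _; case: (hc s).
Qed.

(** At lambda = -i r the Laplace kernel is e^{i r s}; the point is approached from the right by
    1/(n+1) - i r. *)
Lemma charfun_psi (r : R) : charfun nu r = cexp (- t%:C * psi M (0 -i* r)).
Proof.
pose z_ n : R[i] := n.+1%:R^-1 +i* (- r).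
have z0 n : 0 < complex.Re (z_ n) by exact: natSinv_gt0.
have hz : ccvg z_ (0 -i* r).
  by split; [exact: cvg_harmonic|exact: cvg_cst].
have h1 := laplace_nu_cvg (fun n => ltW (z0 n)) hz.
have zB n : normc (z_ n) <= 1 + `|r|.
  rewrite (le_trans (normc_le _))//= normrN lerD2r ger0_norm ?(ltW (z0 n))//.
  by rewrite invf_le1// ler1n.
have h2 : ccvg (fun n => cexp (- t%:C * psi M (z_ n))) (cexp (- t%:C * psi M (0 -i* r))).
  apply: ccvg_cexp; apply: ccvgM; first exact: ccvg_cst.
  exact: (psi_cvg (fun n => ltW (z0 n)) zB hz).
have -> : charfun nu r = cintegral nu half (fun s => cexp (- (0 -i* r) * s%:C)).
  rewrite /charfun /cintegral /=.
  have hd : nu half = 1%E by case: Hnu.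
  have E (f : T -> R) : measurable_fun setT f -> \int[nu]_s f s = \int[nu]_(s in half) f s.
    by move=> mf; rewrite /Rintegral (integral_half hd)//; exact/measurable_EFinP.
  rewrite E; last exact: measurable_cosl.
  rewrite (E (fun s => sin (r * s))); last exact: measurable_sinl.
  congr (_ +i* _); apply: eq_Rintegral => s _;
    by rewrite !opprK oppr0 !mul0r mulr0 sub0r oppr0 expR0 mul1r add0r.
apply: (ccvg_unique h1); move: h2.
by under [X in ccvg X _ -> _]eq_fun do rewrite -laplace_complex//.
Qed.

End subordinator.

End laplace_exponent.

(** * The generator *)

Section generator.
Context (R : realType) (H : normedModType R) (dot : H -> H -> R)
  (hd : is_ip dot) (a : nat -> H) (da : dense_seq a) (Hc : seq_complete H).
Local Notation lam := (@lebesgue_measure R).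
Local Notation T := (measurableTypeR R).
Local Notation da2 := (dense_seq_pair da da).
Local Notation pos := (`]0, +oo[%classic : set T).
Import ComplexField.Normc.
Context (M : {measure set T -> \bar R})
  (iM : M.-integrable pos (fun t => (Num.min t 1)%:E))
  (nu : R -> probability T R)
  (Hnu : forall t, 0 <= t -> is_subordinator_law M t (nu t)).

Let nuD t : 0 <= t -> nu t `[0, +oo[%classic = 1%E.
Proof. by move=> /Hnu []. Qed.

Let ps (r : R) : R[i] := psi M (0 -i* r).
Let C0 : R := 2 + expR 1.
Let C00 : 0 <= C0. Proof. by rewrite addr_ge0// expR_ge0. Qed.

Lemma Re_realM (c : R) z : complex.Re (c%:C * z) = c * complex.Re z.
Proof. by rewrite ReM /= mul0r subr0. Qed.

(** The Fourier multiplier of the difference quotient of the semigroup at time t. *)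
Definition quot (t r : R) : R[i] := (t^-1)%:C * (charfun (nu t) r - 1).

Let quotE t r : 0 < t -> quot t r = (t^-1)%:C * (cexp (- t%:C * ps r) - 1).
Proof. by move=> t0; rewrite /quot (charfun_psi iM (ltW t0) (Hnu (ltW t0))). Qed.

Let norm_tps t r : 0 < t -> normc (- t%:C * ps r) = t * normc (ps r).
Proof. by move=> t0; rewrite normcM normcN normc_real gtr0_norm. Qed.

Lemma normc_quot_le t r : 0 < t -> normc (quot t r) <= C0 * normc (ps r).
Proof.
move=> t0; rewrite quotE// normcM normc_real ger0_norm ?invr_ge0 ?(ltW t0)//.
have Re0 : complex.Re (- t%:C * ps r) <= 0.
  rewrite -rmorphN Re_realM mulNr oppr_le0 mulr_ge0 ?(ltW t0)//.
  exact: Re_psi_ge0.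
rewrite mulrC ler_pdivrMr// (le_trans (normc_cexp_sub1 Re0))//.
by rewrite norm_tps// mulrCA mulrC.
Qed.

Lemma quot_cvg_le t r : 0 < t ->
  normc (quot t r - - ps r) <= normc (ps r) * (expR (t * normc (ps r)) - 1).
Proof.
move=> t0; rewrite quotE//.
have tC : (t%:C : R[i]) != 0 by rewrite eq_complex /= negb_and gt_eqF.
have -> : (t^-1)%:C * (cexp (- t%:C * ps r) - 1) - - ps r =
    (t^-1)%:C * (cexp (- t%:C * ps r) - 1 - (- t%:C * ps r)).
  rewrite [RHS]mulrBr; congr (_ - _).
  by rewrite mulrA mulrN -rmorphM mulVf ?gt_eqF// mulN1r.
rewrite normcM normc_real ger0_norm ?invr_ge0 ?(ltW t0)//.
rewrite mulrC ler_pdivrMr// (le_trans (normc_cexp_sub2 _))// norm_tps//.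
by rewrite -mulrA [leRHS]mulrC.
Qed.

Lemma quot_cvg (t_ : nat -> R) r : (forall n, 0 < t_ n) -> t_ n @[n --> \oo] --> (0 : R) ->
  normc (quot (t_ n) r - - ps r) @[n --> \oo] --> (0 : R).
Proof.
move=> t0 ht.
have h : normc (ps r) * (expR (t_ n * normc (ps r)) - 1) @[n --> \oo] --> (0 : R).
  have h1 : t_ n * normc (ps r) @[n --> \oo] --> (0 : R).
    by rewrite -(mul0r (normc (ps r))); apply: cvgM => //; exact: cvg_cst.
  have h2 : expR (t_ n * normc (ps r)) @[n --> \oo] --> expR (0 : R).
    by apply: continuous_cvg => //; exact: continuous_expR.
  rewrite -(mulr0 (normc (ps r))) -(subrr 1) -{2}(expR0 R).
  by apply: cvgM; [exact: cvg_cst|apply: cvgB => //; exact: cvg_cst].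
apply: (squeeze_cvgr _ (cvg_cst 0) h); apply: nearW => n.
by rewrite normc_ge0 quot_cvg_le.
Qed.

Lemma measurable_quot t : 0 < t ->
  measurable_fun (setT : set T) (fun r => complex.Re (quot t r)) /\
  measurable_fun (setT : set T) (fun r => complex.Im (quot t r)).
Proof.
move=> t0; have [mr mi] := measurable_charfun (nu t).
split.
  under eq_fun do rewrite /quot ReM ReD ReN /= mul0r subr0.
  by apply: measurable_funM => //; exact: measurable_funB.
under eq_fun do rewrite /quot ImM ImD ImN /= mul0r addr0 subr0.
exact: measurable_funM.
Qed.

Let tn (n : nat) : R := n.+1%:R^-1.
Let tn0 n : 0 < tn n. Proof. exact: natSinv_gt0. Qed.
Let tn_cvg : tn n @[n --> \oo] --> (0 : R). Proof. exact: cvg_harmonic. Qed.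

(** [M] carries no sigma-finite structure, so measurability in r comes from the limit of the
    multipliers [quot], which are built from the probability laws. *)
Lemma measurable_Npsi :
  measurable_fun (setT : set T) (fun r => complex.Re (- ps r)) /\
  measurable_fun (setT : set T) (fun r => complex.Im (- ps r)).
Proof.
have hc r := ccvg_normc (quot_cvg r tn0 tn_cvg).
split.
  apply: (measurable_fun_cvg (h := fun n r => complex.Re (quot (tn n) r))).
    by move=> n; case: (measurable_quot (tn0 n)).
  by move=> r _; case: (hc r).
apply: (measurable_fun_cvg (h := fun n r => complex.Im (quot (tn n) r))).
  by move=> n; case: (measurable_quot (tn0 n)).
by move=> r _; case: (hc r).
Qed.

Lemma measurable_normc_psi : measurable_fun (setT : set T) (fun r => normc (ps r)).
Proof.
have [mr mi] := measurable_Npsi.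
rewrite (_ : (fun r => normc (ps r)) = fun r =>
    Num.sqrt (complex.Re (- ps r) ^+ 2 + complex.Im (- ps r) ^+ 2)).
  apply: (measurableT_comp (f := @Num.sqrt R : T -> T)).
    by apply: continuous_measurable_fun; exact: sqrt_continuous.
  by apply: measurable_funD; exact: measurable_funX.
by apply/funext => r; rewrite -normcN -normc_sqr sqrtr_sqr ger0_norm// normc_ge0.
Qed.

Lemma cplx_scaleDl (z w : R[i]) (x : H * H) :
  cplx_scale (z + w) x = cplx_scale z x + cplx_scale w x.
Proof.
rewrite /cplx_scale ReD ImD !scalerDl; congr pair => /=.
  by rewrite opprD addrACA.
by rewrite addrACA.
Qed.

Lemma cplx_scaleNl (z : R[i]) (x : H * H) : cplx_scale (- z) x = - cplx_scale z x.
Proof.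
rewrite /cplx_scale ReN ImN !scaleNr; congr pair => /=.
  by rewrite opprD.
by rewrite opprD.
Qed.

Lemma cplx_scale_real (c : R) (x : H * H) : cplx_scale c%:C x = c *: x.
Proof. by case: x => x y; rewrite /cplx_scale /= !scale0r subr0 addr0. Qed.

Lemma cplx_scaleA (z w : R[i]) (x : H * H) :
  cplx_scale z (cplx_scale w x) = cplx_scale (z * w) x.
Proof.
rewrite /cplx_scale /= ReM ImM !scalerBr !scalerDr !scalerA !scalerBl !scalerDl.
congr pair; first by rewrite !opprD [X in _ + X]addrC addrACA.
by rewrite [X in _ + X = _]addrC addrACA.
Qed.

Lemma cplx_scale_normc (z : R[i]) (x : H * H) :
  `|cplx_scale z x| <= 2 * normc z * `|x|.
Proof. by apply: cplx_scale_bound; [exact: Re_le_normc|exact: Im_le_normc]. Qed.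

(** For [dot2] the scaling is exact, and dot2 x x lies between |x|^2 and 2 |x|^2. *)
Lemma normc_scale_le (z : R[i]) (x : H * H) :
  `|normc z *: x| <= 2 * `|cplx_scale z x|.
Proof.
rewrite -(@ler_pXn2r _ 2) ?nnegrE ?mulr_ge0// normrZ exprMn.
have E : dot2 dot (cplx_scale z x) (cplx_scale z x) = normc z ^+ 2 * dot2 dot x x.
  rewrite normc_sqr /dot2 /= !(ipBl hd, ipBr hd, ipDl hd, ipDr hd, ipZl hd, ipZr hd).
  rewrite (ip_sym hd x.2 x.1); ring.
rewrite (ger0_norm (normc_ge0 z)).
apply: (@le_trans _ _ (normc z ^+ 2 * dot2 dot x x)).
  by rewrite ler_wpM2l ?sqr_ge0// (pairing_ge (dot2_pairing hd)).
rewrite -E (le_trans (ler_norm _))// (le_trans (pairing_le (dot2_pairing hd) _ _))//.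
move: (normr_ge0 (cplx_scale z x)); move: (`|cplx_scale z x|) => t t0.
by rewrite exprMn; nra.
Qed.

Definition L2pos_sq (u : R -> H) : Prop :=
  [/\ borel_measurable (setT : set T) u, (sqint lam u < +oo)%E
    & forall r, r < 0 -> u r = 0].

Lemma L2posP u : L2pos u <-> L2pos_sq u.
Proof.
have N0 : forall x : H, 0 <= `|x| by [].
split=> [[[h1 /(L2norm_lty N0) h2] h3]|[h1 h2 h3]]; first by split.
by split => //; split => //; apply/(L2norm_lty N0).
Qed.

Definition dquot (u : R -> H) (t r : R) : H := t^-1 *: (conv (nu t) u r - u r).

Section fixed_u.
Context (u : R -> H) (hu : L2pos_sq u).

Let mu_ : borel_measurable (setT : set T) u. Proof. by case: hu. Qed.
Let qu : (sqint lam u < +oo)%E. Proof. by case: hu. Qed.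
Let u0 r : r < 0 -> u r = 0. Proof. by case: hu => _ _ h; exact: h. Qed.

Let mF : borel_measurable (setT : set T) (fourier u).
Proof. by case: (fourier_spec hd da Hc mu_ qu). Qed.

Let dconv t : 0 < t -> L2pos_sq (conv (nu t) u).
Proof.
move=> /ltW t0; split; first exact: (borel_conv hd da Hc (nuD t0) mu_ u0).
  exact: (le_lt_trans (sqint_conv_le hd da Hc (nuD t0) mu_ u0) qu).
exact: (conv_neg hd da Hc (nuD t0) mu_ u0).
Qed.

Lemma dquot_L2pos t : 0 < t -> L2pos_sq (dquot u t).
Proof.
move=> t0; have [m1 q1 n1] := dconv t0.
have mB := borelB da m1 mu_; have qB := sqint_lty_sub da m1 mu_ q1 qu.
split.
- exact: (borel_scale da measurableT (measurable_cst t^-1) mB).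
- by rewrite /dquot sqintZ// lte_mul_pinfty ?sqint_ge0 ?lee_fin ?sqr_ge0.
- by move=> r r0; rewrite /dquot n1// u0// subrr scaler0.
Qed.

Lemma fourier_dquot t : 0 < t ->
  {ae lam, forall r, fourier (dquot u t) r = cplx_scale (quot t r) (fourier u r)}.
Proof.
move=> t0; have [m1 q1 n1] := dconv t0.
have mB := borelB da m1 mu_; have qB := sqint_lty_sub da m1 mu_ q1 qu.
have h1 := fourierZ hd da Hc t^-1 mB qB.
have h2 := fourierB hd da Hc m1 q1 mu_ qu.
have h3 := fourier_conv hd da Hc (nuD (ltW t0)) mu_ u0 qu.
apply: (@filterS3 _ (almost_everywhere lam) _ _ _ _ _ _ h1 h2 h3) => r e1 e2 e3.
rewrite [LHS]e1 e2 e3 /quot -cplx_scaleA cplx_scale_real; congr (_ *: _).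
by rewrite cplx_scaleDl -[in RHS](rmorph1 (@real_complex R)) cplx_scaleNl cplx_scale_real scale1r.
Qed.

Let g r := cplx_scale (- ps r) (fourier u r).

Let mg : borel_measurable (setT : set T) g.
Proof. by have [mr mi] := measurable_Npsi; exact: (borel_cplx_scale da mr mi mF). Qed.

Section direct.
Context (v : R -> H) (hv : L2pos_sq v)
  (huv : sq_to lam (fun n => dquot u (tn n)) v).

(** The transforms of the quotients have the limit [fourier v] in L2 and the limit [g] almost
    everywhere, so these two agree. *)
Lemma fourier_generator : {ae lam, forall r, fourier v r = g r}.
Proof.
have [mv qv _] := hv.
have [mFv qFv _] := fourier_spec hd da Hc mv qv.
have hq n := dquot_L2pos (tn0 n).
have mq n : borel_measurable (setT : set T) (dquot u (tn n)) by case: (hq n).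
have qq n : (sqint lam (dquot u (tn n)) < +oo)%E by case: (hq n).
have mFq n : borel_measurable (setT : set T) (fourier (dquot u (tn n))).
  by case: (fourier_spec hd da Hc (mq n) (qq n)).
apply: (sqint_lim_unique da2 mFq mFv mg).
  apply: (tends0_le (tends0Z _ huv (C := 6 * pi))).
    by rewrite mulr_ge0 ?pi_ge0.
  move=> n; have mB := borelB da (mq n) mv.
  have qB := sqint_lty_sub da (mq n) mv (qq n) qv.
  have [mFB _ _] := fourier_spec hd da Hc mB qB.
  rewrite -(ae_eq_sqint mFB (borelB da2 (mFq n) mFv) (fourierB hd da Hc (mq n) (qq n) mv qv)).
  exact: (sqint_fourier_le hd da Hc mB qB).
(* A sequence of times leaves a countable union of null sets to discard. *)
have hae := ae_foralln (fun n => fourier_dquot (tn0 n)).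
apply: filterS hae => r hr; under eq_fun do rewrite hr.
have hc := quot_cvg r tn0 tn_cvg.
have hc' : 2 * normc (quot (tn n) r - - ps r) * `|fourier u r| @[n --> \oo] --> (0 : R).
  rewrite -(mul0r `|fourier u r|); apply: cvgM; last exact: cvg_cst.
  by rewrite -(mulr0 2); apply: cvgM => //; exact: cvg_cst.
apply/cvgrPdist_le => e e0; have /cvgr0Pnorm_le/(_ e e0) := hc'.
apply: filterS => n; apply: le_trans; rewrite distrC /g.
rewrite ger0_norm ?mulr_ge0 ?normc_ge0//.
apply: le_trans (cplx_scale_normc _ _).
by rewrite cplx_scaleDl [X in _ <= `|_ + X|]cplx_scaleNl.
Qed.

End direct.

Section converse.
Hypothesis hg : (sqint lam (fun r => normc (ps r) *: fourier u r) < +oo)%E.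

Let S r := normc (ps r) *: fourier u r.

Let mS : borel_measurable (setT : set T) S.
Proof. exact: (borel_scale da2 measurableT measurable_normc_psi mF). Qed.

Let normS r : `|S r| = normc (ps r) * `|fourier u r|.
Proof. by rewrite /S normrZ ger0_norm// normc_ge0. Qed.

Section along_sequence.
Context (t_ : nat -> R) (t0 : forall n, 0 < t_ n) (ht : t_ n @[n --> \oo] --> (0 : R)).

Let q n r := cplx_scale (quot (t_ n) r - - ps r) (fourier u r).

Let mq n : borel_measurable (setT : set T) (q n).
Proof.
have [mr mi] := measurable_Npsi; have [mr' mi'] := measurable_quot (t0 n).
apply: (borel_cplx_scale da) => //.
  by under eq_fun do rewrite ReD ReN; exact: measurable_funB.
by under eq_fun do rewrite ImD ImN; exact: measurable_funB.
Qed.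

Let q_le n r : `|q n r| <= (2 * (C0 + 1)) * `|S r|.
Proof.
rewrite (le_trans (cplx_scale_normc _ _))// normS -!mulrA ler_wpM2l// mulrA ler_wpM2r//.
rewrite (le_trans (normcB _ _))// normcN mulrDl mul1r lerD2r; exact: normc_quot_le.
Qed.

Let mdq n : borel_measurable (setT : set T) (fourier (dquot u (t_ n))).
Proof.
have [m1 q1 _] := dquot_L2pos (t0 n).
by case: (fourier_spec hd da Hc m1 q1).
Qed.

(** The error is dominated by 2 (C0 + 1) |S|, with C0 for [quot] and 1 for its limit. The sequence
    of times is arbitrary because two are used: 1/(n+1) to construct the limit, and one extracted by
    contradiction. *)
Lemma fourier_dquot_to : sq_to lam (fun n => fourier (dquot u (t_ n))) g.
Proof.
have E n : sqint lam (fun r => fourier (dquot u (t_ n)) r - g r) = sqint lam (q n).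
  apply: (ae_eq_sqint (borelB da2 (mdq n) mg) (mq n)).
  apply: (@filterS _ (almost_everywhere lam) _ _ _ _ (fourier_dquot (t0 n))) => r ->.
  by rewrite /q /g cplx_scaleDl [in RHS]cplx_scaleNl.
suff h : sqint lam (q n) @[n --> \oo] --> 0%E.
  move=> e e0; have [N _ hN] := (cvge0P _ (fun n => sqint_ge0 lam (q n))).1 h e e0.
  by exists N => n Nn; rewrite E; exact: hN.
have iS : lam.-integrable setT (fun r => (`|S r| ^+ 2)%:E).
  apply/integrableP; split; first exact: sq_measurable.
  by under eq_integral do rewrite gee0_abs ?lee_fin ?sqr_ge0//.
have [|||||_ _ hdc] := @dominated_convergence _ T _ lam setT measurableT
  (fun n r => (`|q n r| ^+ 2)%:E) (cst 0%E)
  (fun r => (((2 * (C0 + 1)) ^+ 2)%:E * (`|S r| ^+ 2)%:E)%E).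
- by move=> n; exact: sq_measurable.
- exact: measurable_cst.
- apply: aeW => r _.
  have hc : 2 * normc (quot (t_ n) r - - ps r) * `|fourier u r| @[n --> \oo] --> (0 : R).
    rewrite -(mul0r `|fourier u r|); apply: cvgM; last exact: cvg_cst.
    by rewrite -(mulr0 2); apply: cvgM; [exact: cvg_cst|exact: quot_cvg].
  have hn : `|q n r| @[n --> \oo] --> (0 : R).
    apply: (squeeze_cvgr _ (cvg_cst 0) hc); apply: nearW => n.
    by rewrite normr_ge0; exact: cplx_scale_normc.
  apply/cvg_EFin; first exact: nearW.
  rewrite [X in _ --> X](_ : _ = (0 * 0 : R)); last by rewrite mulr0.
  by rewrite (_ : _ \o _ = fun n => `|q n r| * `|q n r|)//; exact: cvgM.
- exact: (integrableZl measurableT _ iS).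
- apply: aeW => r n _; rewrite -EFinM lee_fin ger0_norm ?sqr_ge0// -exprMn.
  rewrite lerXn2r ?nnegrE ?q_le// (le_trans (normr_ge0 (q n r)) (q_le n r))//.
by move: hdc; rewrite integral_cst// mul0e.
Qed.

Lemma sqint_dquotB_le (v : R -> H) n : L2pos_sq v ->
  (sqint lam (fun r => dquot u (t_ n) r - v r)%R <=
   4%:E * sqint lam (fun r => fourier (dquot u (t_ n)) r - fourier v r)%R)%E.
Proof.
move=> [mv qv _]; have [m1 q1 _] := dquot_L2pos (t0 n).
have mB := borelB da m1 mv; have qB := sqint_lty_sub da m1 mv q1 qv.
have [mFB _ _] := fourier_spec hd da Hc mB qB.
have [mFv _ _] := fourier_spec hd da Hc mv qv.
rewrite -(ae_eq_sqint mFB (borelB da2 (mdq n) mFv) (fourierB hd da Hc m1 q1 mv qv)).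
exact: (sqint_fourier_ge hd da Hc mB qB).
Qed.

End along_sequence.

Lemma dquot_limit : exists2 v, L2pos_sq v &
  {ae lam, forall r, fourier v r = g r}.
Proof.
have hq n := dquot_L2pos (tn0 n).
have mq n : borel_measurable (setT : set T) (dquot u (tn n)) by case: (hq n).
have qq n : (sqint lam (dquot u (tn n)) < +oo)%E by case: (hq n).
have mFq n : borel_measurable (setT : set T) (fourier (dquot u (tn n))).
  by case: (fourier_spec hd da Hc (mq n) (qq n)).
have hFg := fourier_dquot_to tn0 tn_cvg.
have [|v0 mv0 hv0] := riesz_fischer da Hc mq (mu := lam).
  (* The bound is 4 times the sum of two errors, each counted twice, hence e/16. *)
  move=> e e0; have e16 : 0 < e / 16 by rewrite divr_gt0.
  have [N hN] := hFg _ e16; exists N => m n Nm Nn.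
  apply: (le_trans (sqint_dquotB_le tn0 m (hq n))).
  apply: (@le_trans _ _ (4%:E * ((2 * (e / 16))%:E + (2 * (e / 16))%:E))%E).
    rewrite lee_wpmul2l//.
    apply: (le_trans (sqint_triangle lam da2 (mFq m) mg (mFq n))).
    by apply: leeD; rewrite EFinM lee_wpmul2l//; exact: hN.
  by rewrite -EFinD -EFinM lee_fin; lra.
have mhalf : measurable (`[0, +oo[%classic : set T) by exact: measurable_itv.
(* The Riesz-Fischer limit is determined up to a null set only; multiplied by the indicator it
   vanishes at every negative point, without increasing the distance to the quotients, which vanish
   there too. *)
pose v r := \1_(`[0, +oo[%classic : set R) r *: v0 r.
have mv : borel_measurable (setT : set T) v.
  by apply: (borel_scale da measurableT _ mv0); exact: measurable_indic.
have v0E r : 0 <= r -> v r = v0 r.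
  by move=> r0; rewrite /v indicE mem_set ?scale1r//= in_itv/= r0.
have vneg r : r < 0 -> v r = 0.
  move=> r0; rewrite /v indicE memNset ?scale0r//= in_itv/= andbT.
  by apply/negP; rewrite -ltNge.
have hv : sq_to lam (fun n => dquot u (tn n)) v.
  apply: (tends0_le hv0) => n; apply: le_sqint.
  - exact: (borelB da).
  - exact: (borelB da).
  move=> r; have [r0|r0] := leP 0 r; first by rewrite v0E.
  by rewrite vneg//; case: (hq n) => _ _ ->//; rewrite subrr normr0.
have qv : (sqint lam v < +oo)%E.
  have [//|N hN] := hv 1.
  apply: (le_lt_trans (sqint_le_sub lam da mv (mq N))).
  rewrite lte_add_pinfty// lte_mul_pinfty ?sqint_ge0//.
  by rewrite (le_lt_trans (hN N _))// ltry.
have hvL : L2pos_sq v by [].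
by exists v => //; exact: fourier_generator.
Qed.

(** If convergence at 0+ failed, one could pick times below 1/(n+1) that stay e-far from [v],
    against the convergence along this sequence. *)
Lemma dquot_cvg v : L2pos_sq v -> {ae lam, forall r, fourier v r = g r} ->
  forall e, 0 < e -> \forall t \near 0^'+,
    (sqint lam (fun r => dquot u t r - v r)%R <= e%:E)%E.
Proof.
move=> hv hvg e e0; apply: contrapT => hn.
have /choice[t_ ht] : forall n, exists t, [/\ 0 < t, t < tn n &
    ~ (sqint lam (fun r => dquot u t r - v r)%R <= e%:E)%E].
  move=> n; apply: contrapT => hno; apply: hn.
  apply: filterS2 (nbhs_right_lt (tn0 n)) (nbhs_right_gt 0) => t tlt tgt.
  by apply: contrapT => hle; apply: hno; exists t.
have t0 n : 0 < t_ n by case: (ht n).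
have tc : t_ n @[n --> \oo] --> (0 : R).
  apply: (squeeze_cvgr _ (cvg_cst 0) tn_cvg); apply: nearW => n.
  by case: (ht n) => /ltW -> /ltW ->.
have [mv qv _] := hv; have [mFv _ _] := fourier_spec hd da Hc mv qv.
have e4 : 0 < e / 4 by rewrite divr_gt0.
have [N hN] := fourier_dquot_to t0 tc e4.
have [_ _] := ht N; apply.
apply: (le_trans (sqint_dquotB_le t0 N hv)).
have [m1 q1 _] := dquot_L2pos (t0 N).
have [mFN _ _] := fourier_spec hd da Hc m1 q1.
rewrite (@ae_eq_sqint _ _ _ lam _ _ (fun r => fourier (dquot u (t_ N)) r - g r)).
- apply: (@le_trans _ _ (4%:E * (e / 4)%:E)%E).
    by rewrite lee_wpmul2l//; exact: hN.
  by rewrite -EFinM lee_fin; lra.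
- exact: (borelB da2 mFN mFv).
- exact: (borelB da2 mFN mg).
- by apply: (@filterS _ (almost_everywhere lam) _ _ _ _ hvg) => r ->.
Qed.

End converse.

End fixed_u.

End generator.

Lemma dot_is_ip (R : realType) (H : normedModType R) (dot : {dot H for idfun}) :
  (forall x : H, `|x| ^+ 2 = dot x x) -> is_ip (dot : H -> H -> R).
Proof.
move=> Hdot; split=> [a x y z|x y|x]; last by rewrite Hdot.
  by rewrite linearPl.
by rewrite hermC /= expr0 mul1r.
Qed.

Lemma complete_seq_complete (R : realType) (H : completeNormedModType R) :
  seq_complete H.
Proof.
move=> v hv.
suff /cauchy_cvg hc : cauchy (v @ \oo) by exists (lim (v @ \oo)).
apply: cauchy_exP => e e0; have e2 : 0 < e / 2 by rewrite divr_gt0.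
have [N hN] := hv _ e2; exists (v N); exists N => // n /= Nn.
rewrite -ball_normE /= (le_lt_trans (hN _ _ (leqnn N) Nn))//.
by rewrite ltr_pdivrMr// ltr_pMr// ltr1n.
Qed.

Theorem proposition3p1
  (R : realType)
  (H : completeNormedModType R) (dot : {dot H for idfun})
  (Hdot : forall x : H, `|x| ^+ 2 = dot x x)
  (Hsep : separable H)
  (k : R -> R)
  (k_loc : forall T : R,
     (@lebesgue_measure R).-integrable `[0, T]%classic (EFin \o k))
  (k_ge0 : forall s : R, 0 < s -> 0 <= k s)
  (k_noninc : forall s t : R, 0 < s -> s <= t -> k t <= k s)
  (k_rcont : forall s : R, 0 < s -> k x @[x --> s^'+] --> k s)
  (k_lim : k x @[x --> +oo] --> 0)
  (M : {measure set (measurableTypeR R) -> \bar R})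
  (HM : is_kernel_measure k M)
  (mu : R -> probability (measurableTypeR R) R)
  (Hmu : forall t : R, 0 <= t -> is_subordinator_law M t (mu t)) :
  generator_domain (conv_semigroup (H := H) mu) =
    [set u | L2pos u /\
       L2 (@cplx_norm R H)
         (fun r => ComplexField.Normc.normc (psi M (0 -i* r)) *: fourier u r)] /\
  (forall u v : R -> H, generator_graph (conv_semigroup mu) u v ->
     {ae @lebesgue_measure R, forall r : R,
        fourier v r = cplx_scale (- psi M (0 -i* r)) (fourier u r)}).
Proof.
have hd := dot_is_ip Hdot.
have Hc := @complete_seq_complete R H.
have [a da] := separable_dense_seq Hsep.
have iM := int_min1 HM (k_loc 1).
have N0 : forall x : H, 0 <= `|x| by [].
have graphP (u v : R -> H) : generator_graph (conv_semigroup mu) u v <->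
    [/\ L2pos_sq u, L2pos_sq v & forall e, 0 < e -> \forall t \near 0^'+,
      (sqint lebesgue_measure (fun r => dquot mu u t r - v r)%R <= e%:E)%E].
  have F0 : Filter ((0 : R)^'+) by exact: _.
  have E := @L2norm_cvg0 R H _ N0 R _ F0 (fun t r => dquot mu u t r - v r).
  have E' := @cvge0P R R _ F0 _ (fun t =>
    sqint_ge0 lebesgue_measure (fun r => dquot mu u t r - v r)).
  split=> -[hu hv h]; split; try exact/L2posP.
    by move/E.1: h => /E'.1.
  by apply/E.2/E'.2.
have direct (u v : R -> H) : generator_graph (conv_semigroup mu) u v ->
    {ae @lebesgue_measure R, forall r : R,
      fourier v r = cplx_scale (- psi M (0 -i* r)) (fourier u r)}.
  move=> /graphP[hu hv h].
  apply: (fourier_generator hd da Hc iM Hmu hu hv) => e /h.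
  (* A right neighbourhood of 0 contains 1/(n+1) for all n from the integer part of 1/d on. *)
  move=> [d /= d0 hd']; pose N := Num.truncn d^-1.
  exists N => n Nn; apply: hd' => /=; last exact: natSinv_gt0.
  rewrite sub0r normrN gtr0_norm ?natSinv_gt0// invf_plt ?posrE//.
  by rewrite (lt_le_trans (truncnS_gt _))// ler_nat.
split=> //; apply/seteqP; split => [u [v huv]|u [/L2posP hu hL]].
  have [hu hv _] := (graphP u v).1 huv; split; first by case: huv.
  have [mu_ qu _] := hu; have [mv qv _] := hv.
  have [mF _ _] := fourier_spec hd da Hc mu_ qu.
  have [mFv qFv _] := fourier_spec hd da Hc mv qv.
  have da2 := dense_seq_pair da da.
  have mS := borel_scale da2 measurableT (measurable_normc_psi iM Hmu) mF.
  apply/(L2_cplxE hd da); split => //.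
  have [mr mi] := measurable_Npsi iM Hmu.
  have mg := borel_cplx_scale da mr mi mF.
  have m2g := borel_scale da2 measurableT (measurable_cst (2 : R)) mg.
  (* The weight |psi| is compared with the multiplier -psi, for which the product with u^ is the
     transform of [v], hence square integrable. *)
  apply: (@le_lt_trans _ _ (sqint lebesgue_measure
      (fun r => (2 : R) *: cplx_scale (- psi M (0 -i* r)) (fourier u r)))).
    apply: (le_sqint _ mS m2g) => r; rewrite [leRHS]normrZ normr_nat.
    by rewrite -(normcN (psi _ _)); exact: (normc_scale_le hd).
  rewrite sqintZ// lte_mul_pinfty ?sqint_ge0 ?lee_fin ?sqr_ge0//.
  by rewrite -(ae_eq_sqint mFv mg (direct _ _ huv)).
have /(L2_cplxE hd da)[_ hq] := hL.
have [v hv hvg] := dquot_limit hd da Hc iM Hmu hu hq.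
exists v; apply/graphP; split => //.
exact: (dquot_cvg hd da Hc iM Hmu hu hq hv hvg).
Qed.
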